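(* Let $\theta\geq 1$. For each $n$ let $a_{n1},\dots,a_{nn}\in\mathbb{Z}$ and let $h_n(\sigma)=\sum_{j\le n}a_{nj}k_j(\sigma)$ be the corresponding integer-valued additive function on $\mathbf{S}_n$; write $a_j=a_{nj}$. Let $Y$ be a random variable taking values in $\mathbb{Z}_+=\{0,1,2,\dots\}$ such that $\mathbf{E}Y^\alpha<\infty$ for some $\alpha$ and $\varepsilon>0$ with $\alpha\geq 2+\varepsilon$. If $T_n(x):=\nu_n(h_n(\sigma)<x)$ converges weakly to the distribution function $F_Y$ of $Y$ as $n\to\infty$, then \[ \sum_{j<n}\frac{\mathbf{1}\{a_j\le -1\}}{j}\Big(1-\frac{j}{n}\Big)^{\theta-1}=o(1)\qquad (n\to\infty), \] and, for each fixed natural number $l\le \alpha-1-\varepsilon$, \[ \lim_{m\to\infty}\limsup_{n\to\infty}\big|\Upsilon_n(l,m)-\mathbf{E}Y_{(l)}\big|=0 . \]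
   Context: $\mathbf{S}_n$ is the symmetric group; $k_j(\sigma)$ is the number of cycles of length $j$ of $\sigma$ and $w(\sigma)$ its total number of cycles. For fixed $\theta>0$ the Ewens measure is $\nu_n(A)=\frac{1}{\theta^{(n)}}\sum_{\sigma\in A}\theta^{w(\sigma)}$, $\theta^{(n)}=\theta(\theta+1)\cdots(\theta+n-1)$. $x_{(r)}=x(x-1)\cdots(x-r+1)$ is the falling factorial, $x_{(0)}=1$. For $m\in\mathbb{N}$ put $b_j=b_j(m):=\min\{\max\{a_j,0\},m\}$ and \[ \Upsilon_n(l,m):=\sum_{u=1}^l\theta^u\sum_{\substack{r_1+\cdots+r_u=l\\ 1\le r_i\le m}}\binom{l-1}{r_1-1}\binom{l-r_1-1}{r_2-1}\cdots\binom{l-r_1-\cdots-r_{u-1}-1}{r_u-1}\sum_{\substack{j_1,\dots,j_u\ge1\\ j_1+\cdots+j_u<n}}\frac{(b_{j_1})_{(r_1)}\cdots(b_{j_u})_{(r_u)}}{j_1\cdots j_u}\Big(1-\frac{j_1+\cdots+j_u}{n}\Big)^{\theta-1}, \] where all $r_i,j_i$ are natural numbers. *)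

(* Defs.v *)
From HB Require Import structures.
From mathcomp Require Import all_boot all_order all_algebra all_fingroup.
From mathcomp Require Import all_classical all_reals all_analysis.
Set Implicit Arguments. Unset Strict Implicit. Unset Printing Implicit Defensive.
Import Order.TTheory GRing.Theory Num.Theory numFieldNormedType.Exports.
Local Open Scope ring_scope.

Definition kcyc (n : nat) (s : {perm 'I_n}) (j : nat) : nat :=
  #|[set c in porbits s | #|c| == j]|.

Definition wcyc (n : nat) (s : {perm 'I_n}) : nat := #|porbits s|.

Definition rising {R : realType} (theta : R) (n : nat) : R :=
  \prod_(i < n) (theta + i%:R).

Definition ewens {R : realType} (theta : R) (n : nat) (A : pred {perm 'I_n}) : R :=
  (\sum_(s : {perm 'I_n} | A s) theta ^+ wcyc s) / rising theta n.

Definition hfun (a : nat -> nat -> int) (n : nat) (s : {perm 'I_n}) : int :=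
  \sum_(1 <= j < n.+1) a n j * (kcyc s j)%:Z.

Definition Tn {R : realType} (theta : R) (a : nat -> nat -> int) (n : nat) (x : R) : R :=
  ewens theta (fun s : {perm 'I_n} => (hfun a s)%:~R < x).

(* distribution function F_Y(x) = P(Y < x) of a Z_+-valued r.v. with pmf p *)
Definition FY {R : realType} (p : nat -> R) (x : R) : R :=
  limn (series (fun k : nat => if k%:R < x then p k else 0)).

Definition EfallY {R : realType} (p : nat -> R) (l : nat) : R :=
  limn (series (fun k : nat => p k * (k ^_ l)%:R)).

Definition bj (a : nat -> nat -> int) (n m j : nat) : nat :=
  match a n j with Posz k => minn k m | Negz _ => 0%N end.

Definition Upsilon {R : realType} (theta : R) (a : nat -> nat -> int)
    (n l m : nat) : R :=
  \sum_(1 <= u < l.+1)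
    theta ^+ u *
    \sum_(r : {ffun 'I_u -> 'I_l.+1} |
            [forall i, (1 <= r i <= m)%N] && (\sum_(i < u) (r i : nat) == l)%N)
      ((\prod_(i < u) 'C(l - \sum_(k < u | (k < i)%N) (r k : nat) - 1, (r i).-1))%:R *
       \sum_(j : {ffun 'I_u -> 'I_n} |
               [forall i, (1 <= j i)%N] && (\sum_(i < u) (j i : nat) < n)%N)
         ((\prod_(i < u) (bj a n m (j i)) ^_ (r i))%:R /
          (\prod_(i < u) (j i : nat))%:R *
          powR (1 - (\sum_(i < u) (j i : nat))%:R / n%:R) (theta - 1))).

(* Main.v *)
(** Averages over the Ewens measure are computed by splitting off the cycle
    through a fixed point; with [c_n = theta^(n) / n!] this brings in the ratios
    [psi n j = c_(n-j) / c_n], which lie above [(1 - j/n)^(theta-1)] because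
    [theta >= 1], and are close to it uniformly in [j] for large [n].

    Let [y0] be the least value of [Y], so that [h < y0] has small probability
    while [h = y0] does not.  Merging two cycles [i], [j] into one, or splitting
    [i + j], cannot often lead from [h = y0] to [h < y0]; as the numbers of
    admissible merges and splits concentrate around their means, [a_(i+j)] equals
    [a_i + a_j] for most pairs.  Hence [a_j = lam * j] outside a set of [j] with
    bounded sum of [1/j].  With probability bounded below a permutation has no
    cycle with length in such a set, and then [h = lam * n]; tightness forces
    [lam = 0].  Thus the [1/j] with [a_j <> 0] have bounded sum, and having
    exactly one cycle with [a_j <> 0], this one with [a_j < 0], makes [h < 0]:
    this bounds the weight of the negative [a_j] by a multiple of [P(h < 0)].

    For [b_j = b_j(m)] and [H = \sum_j b_j k_j], the [l]-th factorial moment of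
    [H] is [Upsilon_n(l,m)] with [psi] in place of the power, up to [o(1)].  For
    fixed [m] the factorial moments of [H] are bounded in [n], so [H] may be
    truncated at a high level; and [H] differs from [h] only if there is a cycle
    with [a_j < 0] or [h > m]. *)

Require Import Defs.
From HB Require Import structures.
From mathcomp Require Import all_boot all_order all_algebra all_fingroup.
From mathcomp Require Import all_classical all_reals all_analysis.
From mathcomp Require Import zify ring lra.
Set Implicit Arguments. Unset Strict Implicit. Unset Printing Implicit Defensive.
Import Order.TTheory GRing.Theory Num.Theory numFieldNormedType.Exports.
Local Open Scope classical_set_scope.
Local Open Scope ring_scope.

(** * Ewens averages of functions of the cycle lengths *)

(** The [a_j] are arbitrary integers, possibly huge and of either sign, so no moment of [h] is
    available at the outset; what is available is one-sided: little mass lies below [y0]. Merges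
    exploit [a_(i+j) < a_i + a_j], splits the opposite inequality. The short piece [i] stays below
    [q], about [n/Q], and the long one in a window [[q, q * 2^k)], with [Q] and [k] fixed. Then
    [psi] is close to 1 at all lengths involved, at most [n/q] cycles are long, and the window holds
    a large constant number of cycles on average, so a second moment argument works.

    The condition [theta >= 1] acts as log-concavity of [c_n]: removing a cycle never raises the
    mean number of the others, and second moments need no correlation estimates.

    Additivity for most pairs gives linearity without accumulating errors, because every [d] is
    compared with a new pair of good indices [i], [i + d].

    In the factorial moments the exact formula also counts marked cycles of total length exactly
    [n], which [Upsilon] omits. Such terms force a permutation with few cycles, which is
    improbable. *)

Lemma big_nat_trunc (R : pzSemiRingType) (n N : nat) (F : nat -> R) :
  (n <= N)%N ->
  \sum_(1 <= i < n.+1) F i = \sum_(1 <= i < N.+1) (i <= n)%:R * F i.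
Proof.
move=> nN; rewrite (big_nat_widen _ _ N.+1) // big_mkcond /=.
by apply: eq_bigr => i _; rewrite ltnS; case: leqP; rewrite ?mul1r ?mul0r.
Qed.

Section Zsum.
Variables (R : realType) (theta : R).

(* [Zsum n F] is [theta^(n) / n!] times the Ewens average of [F] at the list of
   cycle lengths, each cycle listed being the one through the least point not yet
   covered; [k] is only fuel. *)
Fixpoint Zsum_rec (k n : nat) (F : seq nat -> R) : R :=
  if k is k'.+1 then
    if n == 0%N then F [::]
    else theta / n%:R *
         \sum_(1 <= j < n.+1) Zsum_rec k' (n - j) (fun t => F (j :: t))
  else F [::].

Definition Zsum (n : nat) (F : seq nat -> R) : R := Zsum_rec n n F.
Local Notation Z := Zsum.

Lemma Zsum_rec_fuel k n F : (n <= k)%N -> Zsum_rec k n F = Zsum n F.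
Proof.
rewrite /Zsum; elim/ltn_ind: n k F => -[|n] IH [|k] F //= lenk.
congr (_ * _); rewrite !big_nat; apply: eq_bigr => j /andP[j1 jn].
by rewrite (IH (n.+1 - j)%N _ k) ?(IH (n.+1 - j)%N _ n) //; lia.
Qed.

Lemma Zsum0 F : Z 0 F = F [::].
Proof. by []. Qed.

Lemma Zsum_eqrec n F :
  n%:R * Z n F = theta * \sum_(1 <= j < n.+1) Z (n - j) (fun t => F (j :: t)).
Proof.
case: n => [|n]; first by rewrite mul0r big_geq // mulr0.
rewrite {1}/Zsum /= mulrA (mulrCA _ theta) mulfV ?pnatr_eq0 // mulr1.
congr (_ * _); rewrite !big_nat; apply: eq_bigr => j /andP[j1 jn].
by rewrite Zsum_rec_fuel //; lia.
Qed.

Lemma Zsum_eqn (n : nat) F (y : R) :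
  (0 < n)%N ->
  n%:R * y = theta * \sum_(1 <= j < n.+1) Z (n - j) (fun t => F (j :: t)) ->
  y = Z n F.
Proof.
move=> n0 e; apply: (@mulfI _ (n%:R : R)); first by rewrite pnatr_eq0 -lt0n.
by rewrite e Zsum_eqrec.
Qed.

Definition is_comp (n : nat) (t : seq nat) := all (leq 1) t && (sumn t == n).

Lemma eq_Zsum n F G :
  (forall t, is_comp n t -> F t = G t) -> Z n F = Z n G.
Proof.
elim/ltn_ind: n F G => -[|n] IH F G FG; first by rewrite !Zsum0 FG.
apply: Zsum_eqn => //; rewrite Zsum_eqrec; congr (_ * _).
rewrite !big_nat; apply: eq_bigr => j /andP[j1 jn].
apply: IH => [|t /andP[t1 /eqP tn]]; first by lia.
apply: FG; rewrite /is_comp /= j1 t1 /= tn; apply/eqP; lia.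
Qed.

Lemma ZsumD n F G : Z n (fun t => F t + G t) = Z n F + Z n G.
Proof.
elim/ltn_ind: n F G => -[|n] IH F G; first by rewrite !Zsum0.
apply/esym/Zsum_eqn => //; rewrite mulrDr !Zsum_eqrec -mulrDr -big_split /=.
congr (_ * _); rewrite !big_nat; apply: eq_bigr => j /andP[j1 jn].
by rewrite IH //; lia.
Qed.

Lemma ZsumZ n (c : R) F : Z n (fun t => c * F t) = c * Z n F.
Proof.
elim/ltn_ind: n F => -[|n] IH F; first by rewrite !Zsum0.
apply/esym/Zsum_eqn => //; rewrite mulrCA Zsum_eqrec mulrCA mulr_sumr.
congr (_ * _); rewrite !big_nat; apply: eq_bigr => j /andP[j1 jn].
by rewrite IH //; lia.
Qed.

Lemma Zsum_zero n : Z n (fun=> 0) = 0.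
Proof.
rewrite -[RHS](mul0r (Z n (fun=> 0))) -ZsumZ.
by apply: eq_Zsum => t _; rewrite mul0r.
Qed.

Lemma ZsumN n F : Z n (fun t => - F t) = - Z n F.
Proof. by rewrite -mulN1r -ZsumZ; apply: eq_Zsum => t _; rewrite mulN1r. Qed.

Lemma ZsumB n F G : Z n (fun t => F t - G t) = Z n F - Z n G.
Proof. by rewrite ZsumD ZsumN. Qed.

Lemma Zsum_sum n (I : Type) (r : seq I) (P : pred I) (F : I -> seq nat -> R) :
  Z n (fun t => \sum_(i <- r | P i) F i t) = \sum_(i <- r | P i) Z n (F i).
Proof.
elim: r => [|i r IH].
  by rewrite big_nil -[RHS](Zsum_zero n); apply: eq_Zsum => t _; rewrite big_nil.
rewrite big_cons -IH; case: ifP => Pi; rewrite -?ZsumD;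
  by apply: eq_Zsum => t _; rewrite big_cons Pi.
Qed.

Hypothesis theta0 : 0 < theta.

Lemma Zsum_ge0 n F : (forall t, is_comp n t -> 0 <= F t) -> 0 <= Z n F.
Proof.
elim/ltn_ind: n F => -[|n] IH F F0; first by rewrite Zsum0 F0.
rewrite -(pmulr_rge0 _ (ltr0Sn R n)) Zsum_eqrec mulr_ge0 ?(ltW theta0) //.
rewrite big_nat; apply: sumr_ge0 => j /andP[j1 jn]; apply: IH; first by lia.
move=> t /andP[t1 /eqP tn]; apply: F0; rewrite /is_comp /= j1 t1 /= tn.
by apply/eqP; lia.
Qed.

Lemma le_Zsum n F G :
  (forall t, is_comp n t -> F t <= G t) -> Z n F <= Z n G.
Proof.
move=> FG; rewrite -subr_ge0 -ZsumB; apply: Zsum_ge0 => t /FG.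
by rewrite subr_ge0.
Qed.

End Zsum.

(** * Palm formulas: averaging over a marked cycle *)

Section Palm.
Variables (R : realType) (theta : R).
Local Notation Z := (Zsum theta).

(* The sum of [f c t'] over all ways of taking one entry [c] out of [t],
   [t'] being what is left. *)
Fixpoint pick_sum (f : nat -> seq nat -> R) (t : seq nat) : R :=
  if t is c :: t' then f c t' + pick_sum (fun d s => f d (c :: s)) t' else 0.

(** The picked entry is the first one or a later one. For a later entry of length [i], the sum over
    the first entry is the recursion at size [n - i] and contributes the factor [(n - i)/i]; the
    first-entry term adds [i/i], and the total [n/i] cancels the factor [n]. *)
Lemma Zsum_pick_sum n f :
  Z n (pick_sum f) = \sum_(1 <= j < n.+1) theta / j%:R * Z (n - j) (f j).
Proof.
elim/ltn_ind: n f => -[|n] IH f; first by rewrite Zsum0 big_geq.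
apply/esym/Zsum_eqn => //=.
have -> : \sum_(1 <= j < n.+2) Z (n.+1 - j)
      (fun t => f j t + pick_sum (fun d s => f d (j :: s)) t) =
   \sum_(1 <= j < n.+2) Z (n.+1 - j) (f j) +
   \sum_(1 <= j < n.+2) \sum_(1 <= i < n.+2) (i + j <= n.+1)%:R *
      (theta / i%:R * Z (n.+1 - i - j) (fun s => f i (j :: s))).
  rewrite -big_split /= !big_nat; apply: eq_bigr => j /andP[j1 jn].
  rewrite ZsumD; congr (_ + _); rewrite IH; last by lia.
  rewrite (@big_nat_trunc _ _ n.+1); last by lia.
  rewrite !big_nat; apply: eq_bigr => i /andP[i1 i2].
  rewrite (_ : (i <= n.+1 - j)%N = (i + j <= n.+1)%N); last by lia.
  by congr (_ * (_ * Z _ _)); lia.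
rewrite exchange_big /= mulrDr !mulr_sumr -big_split /= !big_nat.
apply: eq_bigr => i /andP[i1 i2].
have -> : \sum_(1 <= j < n.+2) (i + j <= n.+1)%:R *
   (theta / i%:R * Z (n.+1 - i - j) (fun s => f i (j :: s))) =
   (n.+1 - i)%:R / i%:R * Z (n.+1 - i) (f i).
  rewrite mulrAC Zsum_eqrec [in RHS](@big_nat_trunc _ _ n.+1); last by lia.
  rewrite mulr_sumr mulr_suml.
  rewrite !big_nat; apply: eq_bigr => j /andP[j1 j2].
  rewrite (_ : (j <= n.+1 - i)%N = (i + j <= n.+1)%N); last by lia.
  by ring.
have i0 : i%:R != 0 :> R by rewrite pnatr_eq0; lia.
rewrite natrB; last by lia.
by field.
Qed.

Lemma eq_pick_sum f g t :
  (forall c s, f c s = g c s) -> pick_sum f t = pick_sum g t.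
Proof. by elim: t f g => //= d t IH f g fg; rewrite fg; congr (_ + _); apply: IH. Qed.

Lemma pick_sum_sym (Phi : nat -> seq nat -> R) t :
  (forall c s s', perm_eq s s' -> Phi c s = Phi c s') ->
  pick_sum (fun c s => Phi c (c :: s)) t = \sum_(c <- t) Phi c t.
Proof.
elim: t Phi => [|d t IH] Phi sym /=; first by rewrite big_nil.
rewrite big_cons; congr (_ + _).
rewrite -(IH (fun c s => Phi c (d :: s))); last first.
  by move=> c s s' ss'; apply: sym; rewrite perm_cons.
apply: eq_pick_sum => c s; apply: sym.
by rewrite -![[:: _, _ & _]]/([:: _] ++ [:: _] ++ _) perm_catCA.
Qed.

(** Marking a cycle of length [j] costs [theta / j] and leaves an unrestricted permutation of
    [n - j] points. Symmetry of [Phi] allows the marked cycle to be put back at the head of the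
    list. *)
Lemma Zsum_palm n (Phi : nat -> seq nat -> R) :
  (forall c s s', perm_eq s s' -> Phi c s = Phi c s') ->
  Z n (fun t => \sum_(c <- t) Phi c t) =
  \sum_(1 <= j < n.+1) theta / j%:R * Z (n - j) (fun t => Phi j (j :: t)).
Proof.
move=> sym; rewrite -(Zsum_pick_sum n (fun c s => Phi c (c :: s))).
by apply: eq_Zsum => t _; rewrite pick_sum_sym.
Qed.

End Palm.

(** * Cycle types of permutations and the insertion of a point *)

Definition perm_invariant (T : Type) (F : seq nat -> T) :=
  forall s t, perm_eq s t -> F s = F t.

Section CycleType.
Variable (R : realType).

Lemma pick_sum_map (T : eqType) (g : T -> nat) (f : nat -> seq nat -> R) e :
  uniq e ->
  pick_sum f (map g e) = \sum_(B <- e) f (g B) (map g (rem B e)).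
Proof.
elim: e f => [|B0 e IH] f /=; first by rewrite big_nil.
case/andP=> B0e ue; rewrite big_cons eqxx; congr (_ + _); rewrite IH //.
rewrite !big_seq; apply: eq_bigr => B Be; case: eqP => // eB.
by rewrite eB Be in B0e.
Qed.

(** The order of the list is that of an arbitrary enumeration of the cycles, so only functions
    satisfying [perm_invariant] may be applied to it. *)
Definition ctype n (s : {perm 'I_n}) : seq nat :=
  map (fun c : {set 'I_n} => #|c|) (enum (porbits s)).

Lemma porbit_sub_stable (T : finType) (s : {perm T}) (A : {set T}) x :
  x \in A -> (forall y, y \in A -> s y \in A) -> porbit s x \subset A.
Proof.
move=> xA sA; apply/fintype.subsetP => y /porbitP[k ->].
elim: k => [|k IH]; first by rewrite expg0 perm1.
by rewrite expgSr permM sA.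
Qed.

Section Insert.
Variables (n : nat) (s : {perm 'I_n}) (i : 'I_n).
Local Notation m := (@ord0 n).
Local Notation up := (lift m).

Definition insert_fix : {perm 'I_n.+1} := lift_perm m m s.
(** The new point is placed on the arc from [i] to [s i], so the cycle of [i] grows by one and the
    others are unchanged. *)
Definition insert_after : {perm 'I_n.+1} := (tperm m (up i) * lift_perm m m s)%g.

Lemma up_or0 (x : 'I_n.+1) : x = m \/ exists j, x = up j.
Proof. by case: (unliftP m x) => [j ->|->]; [right; exists j|left]. Qed.

Lemma insert_fix0 : insert_fix m = m.
Proof. exact: lift_perm_id. Qed.

Lemma insert_fix_up j : insert_fix (up j) = up (s j).
Proof. exact: lift_perm_lift. Qed.

Lemma insert_after0 : insert_after m = up (s i).
Proof. by rewrite permM tpermL lift_perm_lift. Qed.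

Lemma insert_after_up j : insert_after (up j) = if j == i then m else up (s j).
Proof.
rewrite permM; case: eqP => [->|ji]; first by rewrite tpermR lift_perm_id.
rewrite tpermD ?lift_perm_lift // ?neq_lift //.
by apply/eqP => /lift_inj /esym.
Qed.

Definition grow (c : {set 'I_n}) : {set 'I_n.+1} :=
  if i \in c then m |: up @: c else up @: c.

Lemma mem_up (c : {set 'I_n}) j : (up j \in up @: c) = (j \in c).
Proof. by rewrite mem_imset //; apply: lift_inj. Qed.

Lemma m_notin_up (c : {set 'I_n}) : m \notin up @: c.
Proof. by apply/imsetP => -[j _ /eqP]; apply/negP; rewrite neq_lift. Qed.

Lemma mem_grow_up c j : (up j \in grow c) = (j \in c).
Proof. by rewrite /grow; case: ifP => _; rewrite ?inE mem_up // eq_sym (negbTE (neq_lift _ _)). Qed.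

Lemma mem_grow0 c : (m \in grow c) = (i \in c).
Proof. by rewrite /grow; case: ifP; rewrite ?inE ?eqxx // (negbTE (m_notin_up _)). Qed.

Lemma grow_inj : injective grow.
Proof. by move=> c d cd; apply/setP => j; rewrite -mem_grow_up cd mem_grow_up. Qed.

Lemma card_grow c : #|grow c| = ((i \in c) + #|c|)%N.
Proof.
rewrite /grow; case: ifP => ic; last by rewrite card_imset //; apply: lift_inj.
by rewrite cardsU1 m_notin_up card_imset //; apply: lift_inj.
Qed.

Lemma porbit_stable (T : finType) (t : {perm T}) x y :
  y \in porbit t x -> t y \in porbit t x.
Proof. by case/porbitP => k ->; rewrite -permM -expgSr mem_porbit. Qed.

Lemma porbit_insert_after j : porbit insert_after (up j) = grow (porbit s j).
Proof.
apply/eqP; rewrite finset.eqEsubset; apply/andP; split.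
  apply: porbit_sub_stable => [|y]; first by rewrite mem_grow_up porbit_id.
  case: (up_or0 y) => [->|[k ->]].
    by rewrite mem_grow0 insert_after0 mem_grow_up => /porbit_stable.
  rewrite mem_grow_up insert_after_up; case: eqP => [->|_].
    by rewrite mem_grow0.
  by rewrite mem_grow_up => /porbit_stable.
have upS : forall k, k \in porbit s j -> up k \in porbit insert_after (up j).
  suff /fintype.subsetP h : porbit s j \subset [set k | up k \in porbit insert_after (up j)]%SET.
    by move=> k /h; rewrite inE.
  apply: porbit_sub_stable => [|k]; rewrite !inE ?porbit_id // => kj.
  have := porbit_stable kj; rewrite insert_after_up; case: eqP => // -> mj.
  by rewrite -insert_after0; apply: porbit_stable.
apply/fintype.subsetP => y; case: (up_or0 y) => [->|[k ->]]; last first.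
  by rewrite mem_grow_up => /upS.
rewrite mem_grow0 => /upS /porbit_stable.
by rewrite insert_after_up eqxx.
Qed.

Lemma porbit_insert_fix j : porbit insert_fix (up j) = up @: porbit s j.
Proof.
apply/eqP; rewrite finset.eqEsubset; apply/andP; split.
  apply: porbit_sub_stable => [|y]; first by rewrite mem_up porbit_id.
  case/imsetP => k kj ->; rewrite insert_fix_up mem_up; exact: porbit_stable.
suff /fintype.subsetP h : porbit s j \subset [set k | up k \in porbit insert_fix (up j)]%SET.
  by apply/fintype.subsetP => y /imsetP[k /h]; rewrite inE => + ->.
apply: porbit_sub_stable => [|k]; rewrite !inE ?porbit_id // => kj.
by have := porbit_stable kj; rewrite insert_fix_up.
Qed.

Lemma porbits_insert_after : porbits insert_after = grow @: porbits s.
Proof.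
have p0 : porbit insert_after m = grow (porbit s i).
  rewrite -porbit_insert_after; apply/eqP; rewrite eq_porbit_mem.
  by have := porbit_stable (porbit_id insert_after (up i)); rewrite insert_after_up eqxx.
apply/setP => c; apply/imsetP/imsetP => [[x _ ->]|[d /imsetP[j _ ->] ->]].
  case: (up_or0 x) => [->|[k ->]].
    by exists (porbit s i); rewrite ?p0 //; apply: imset_f.
  by exists (porbit s k); rewrite ?porbit_insert_after //; apply: imset_f.
by exists (up j); rewrite ?porbit_insert_after.
Qed.

Lemma porbits_insert_fix :
  porbits insert_fix = [set m]%SET |: (fun c : {set 'I_n} => up @: c) @: porbits s.
Proof.
have p0 : porbit insert_fix m = [set m]%SET.
  apply/eqP; rewrite finset.eqEsubset finset.sub1set porbit_id andbT.
  by apply: porbit_sub_stable => [|y]; rewrite !inE // => /eqP ->; rewrite insert_fix0.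
apply/setP => c; rewrite !inE; apply/imsetP/orP => [[x _ ->]|[/eqP->|/imsetP[d /imsetP[j _ ->] ->]]].
- case: (up_or0 x) => [->|[k ->]]; first by left; rewrite p0.
  by right; rewrite porbit_insert_fix; apply: imset_f; apply: imset_f.
- by exists m; rewrite ?p0.
- by exists (up j); rewrite ?porbit_insert_fix.
Qed.

Lemma ctype_insert_fix : perm_eq (ctype insert_fix) (1%N :: ctype s).
Proof.
have upI : injective (fun c : {set 'I_n} => up @: c) by apply: imset_inj; apply: lift_inj.
rewrite /ctype -(cards1 m).
have -> : map (fun c : {set 'I_n} => #|c|) (enum (porbits s)) =
   map (fun c : {set 'I_n.+1} => #|c|) ([seq up @: (c : {set 'I_n}) | c <- enum (porbits s)]).
  by rewrite -map_comp; apply: eq_map => c /=; rewrite card_imset //; apply: lift_inj.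
rewrite -map_cons; apply: perm_map; apply: uniq_perm; rewrite ?enum_uniq //=.
  rewrite map_inj_uniq ?enum_uniq // andbT; apply/mapP => -[c _ e].
  by have := m_notin_up c; rewrite -e set11.
move=> c; rewrite mem_enum porbits_insert_fix !inE; congr (_ || _).
by apply/imsetP/mapP => -[d dP ->]; exists d; rewrite ?mem_enum // -mem_enum.
Qed.

Lemma ctype_insert_after :
  perm_eq (ctype insert_after)
    (map (fun c : {set 'I_n} => ((i \in c) + #|c|)%N) (enum (porbits s))).
Proof.
rewrite /ctype; have -> : (map (fun c : {set 'I_n} => ((i \in c) + #|c|)%N) (enum (porbits s))) =
   map (fun c : {set 'I_n.+1} => #|c|) ([seq grow (c : {set 'I_n}) | c <- enum (porbits s)]).
  by rewrite -map_comp; apply: eq_map => c /=; rewrite card_grow.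
apply: perm_map; apply: uniq_perm; rewrite ?enum_uniq //=.
  by rewrite map_inj_uniq ?enum_uniq //; apply: grow_inj.
move=> c; rewrite mem_enum porbits_insert_after.
by apply/imsetP/mapP => -[d dP ->]; exists d; rewrite ?mem_enum // -mem_enum.
Qed.

End Insert.

Definition insert n (p : {perm 'I_n} * option 'I_n) : {perm 'I_n.+1} :=
  if p.2 is Some i then insert_after p.1 i else insert_fix p.1.

(** The preimage of the new point, itself or some [i], can be read off from the result, and so can
    the old permutation; the cardinals agree because [(n+1)! = (n+1) n!]. *)
Lemma insert_bij n : bijective (@insert n).
Proof.
apply: inj_card_bij; last first.
  by rewrite card_prod card_option !card_Sn card_ord factS mulnC.
move=> [s o] [s' o'] /= e.
have e0 x : insert (s, o) x = insert (s', o') x by rewrite e.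
have lI : injective (@lift_perm n ord0 ord0).
  move=> p q pq; apply/permP => j; apply: (@lift_inj _ (@ord0 n)).
  by rewrite -!(lift_perm_lift ord0 ord0) pq.
case: o o' e e0 => [i|] [i'|]; rewrite /insert /= => e e0.
- have ii : i = i'.
    have := e0 (lift ord0 i); rewrite !insert_after_up eqxx.
    by case: eqP => // _ /eqP; rewrite -[_ == _]negbK neq_lift.
  subst i'; congr (_, _); apply: lI; move: e; rewrite /insert_after; exact: mulgI.
- have := e0 ord0; rewrite insert_after0 insert_fix0 => /eqP.
  by rewrite eq_sym -[_ == _]negbK neq_lift.
- have := e0 ord0; rewrite insert_after0 insert_fix0 => /eqP.
  by rewrite -[_ == _]negbK neq_lift.
- by congr (_, _); apply: lI.
Qed.

(** A cycle of length [c] can receive the new point after any of its [c] points, whence the factor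
    [c]; the term with [1%N] is a new cycle. *)
Lemma sum_ctypeS n (G : seq nat -> R) : perm_invariant G ->
  \sum_(s : {perm 'I_n.+1}) G (ctype s) =
  \sum_(s : {perm 'I_n}) (G (1%N :: ctype s) +
     pick_sum (fun c t => c%:R * G (c.+1 :: t)) (ctype s)).
Proof.
move=> Gs; rewrite (reindex (@insert n)) /=; last exact: onW_bij (insert_bij n).
rewrite -(pair_big predT predT (fun s o => G (ctype (insert (s, o))))) /=.
apply: eq_bigr => s _.
have bo (H : option 'I_n -> R) : \sum_o H o = H None + \sum_i H (Some i).
  rewrite (bigD1 None) //=; congr (_ + _).
  rewrite (reindex_omap Some id) /=; last by case.
  by apply: eq_bigl => i; rewrite eqxx.
rewrite bo /insert /= (Gs _ _ (ctype_insert_fix s)); congr (_ + _).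
rewrite pick_sum_map ?enum_uniq // big_enum /=.
transitivity (\sum_(i in finset.cover (porbits s)) G (ctype (insert_after s i))).
  apply: eq_bigl => i; symmetry; apply/finset.bigcupP; exists (porbit s i); rewrite ?porbit_id //.
  exact: imset_f.
have tI : finset.trivIset (porbits s).
  apply/finset.trivIsetP => _ _ /imsetP[x _ ->] /imsetP[y _ ->]; apply: contraR.
  case/pred0Pn => z /andP[/= zx zy]; move: zx zy.
  by rewrite -!eq_porbit_mem => /eqP -> /eqP ->.
rewrite (finset.big_trivIset _ tI) /=; apply: eq_bigr => B BP.
have -> : #|B|%:R * G (#|B|.+1 :: map (fun c : {set 'I_n} => #|c|) (rem B (enum (porbits s))))
  = \sum_(i in B) G (#|B|.+1 :: map (fun c : {set 'I_n} => #|c|) (rem B (enum (porbits s)))).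
  by rewrite sumr_const mulr_natl.
apply: eq_bigr => i iB; apply: Gs; apply: (perm_trans (ctype_insert_after s i)).
have Be : B \in enum (porbits s) by rewrite mem_enum.
apply: (perm_trans (perm_map _ (perm_to_rem Be))) => /=; rewrite iB add1n perm_cons.
rewrite (_ : map _ _ = map (fun c : {set 'I_n} => #|c|) (rem B (enum (porbits s)))) //.
apply/eq_in_map => c; rewrite mem_rem_uniq ?enum_uniq // !inE mem_enum => /andP[cB cP].
case: (boolP (i \in c)) => // ic.
have /finset.trivIsetP/(_ _ _ cP BP cB) := tI.
by rewrite disjoint_subset => /fintype.subsetP/(_ _ ic); rewrite !inE iB.
Qed.

End CycleType.

Lemma perm_eq_rem (T : eqType) (c : T) s t :
  perm_eq s t -> perm_eq (rem c s) (rem c t).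
Proof.
move=> st; apply/seq.permP => P; rewrite !count_rem (perm_mem st).
by move/seq.permP: st => ->.
Qed.

Definition hsum (b : nat -> int) (t : seq nat) : int := \sum_(c <- t) b c.

Lemma perm_invariant_hsum b : perm_invariant (hsum b).
Proof. by move=> s t; apply: perm_big. Qed.

(** * From sums over permutations to the recursion on cycle lengths *)

Section Crp.
Variables (R : realType) (theta : R).
Local Notation Z := (Zsum theta).

Definition Zc n : R := Z n (fun=> 1).
Definition psi n j : R := Zc (n - j) / Zc n.

(** The Chinese restaurant step: a new point opens a cycle with weight [theta] or joins a cycle of
    length [c] with weight [c]. It follows from the first-cycle recursion, since shortening the
    first cycle by one point is an instance of the Palm formula. *)
Lemma Zsum_crp n F :
  n.+1%:R * Z n.+1 F = theta * Z n (fun t => F (1%N :: t)) +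
    Z n (pick_sum (fun c s => c%:R * F (c.+1 :: s))).
Proof.
rewrite Zsum_eqrec big_ltn // mulrDr subn1 /=; congr (_ + _).
rewrite Zsum_pick_sum mulr_sumr big_add1 /= !big_nat; apply: eq_bigr => j /andP[j1 jn].
have j0 : j%:R != 0 :> R by rewrite pnatr_eq0 -lt0n.
by rewrite ZsumZ subSS mulrA divfK.
Qed.

Lemma pick_sum_size t : pick_sum (fun c _ => c%:R) t = (sumn t)%:R :> R.
Proof.
by elim: t => [|c t IH] //=; rewrite IH natrD.
Qed.

Lemma Zc0 : Zc 0 = 1.
Proof. by []. Qed.

Lemma ZcS n : n.+1%:R * Zc n.+1 = (theta + n%:R) * Zc n.
Proof.
rewrite Zsum_crp mulrDl; congr (_ + _); rewrite -ZsumZ; apply: eq_Zsum => t /andP[_ /eqP tn].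
by rewrite mulr1 -tn -pick_sum_size; apply: eq_pick_sum => c s; rewrite mulr1.
Qed.

Lemma pick_sumZ (x : R) f t :
  pick_sum (fun c s => x * f c s) t = x * pick_sum f t.
Proof.
by elim: t f => [|c t IH] f /=; rewrite ?mulr0 // mulrDr IH.
Qed.

Lemma eq_pick_sum_size (f g : nat -> seq nat -> R) t :
  (forall c s, (size s).+1 = size t -> f c s = g c s) ->
  pick_sum f t = pick_sum g t.
Proof.
elim: t f g => // c [|d t] IH f g fg; first by rewrite /= fg.
have e h : pick_sum h (c :: d :: t) =
  h c (d :: t) + pick_sum (fun e s => h e (c :: s)) (d :: t) :> R by [].
by rewrite !e fg //; congr (_ + _); apply: IH => x s /= st; apply: fg; rewrite /= st.
Qed.

(** Both sides satisfy the same recursion in [n], by insertion of a point on the left and by the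
    restaurant step on the right. *)
Lemma sum_ctype n (F : seq nat -> R) : perm_invariant F ->
  \sum_(s : {perm 'I_n}) theta ^+ wcyc s * F (ctype s) = n`!%:R * Z n F.
Proof.
have wE m (s : {perm 'I_m}) : wcyc s = size (ctype s) by rewrite size_map -cardE.
elim: n F => [|n IH] F Fs.
  rewrite (eq_bigr (fun=> F [::])) => [|s _].
    by rewrite sumr_const cardT /= -cardT card_Sn mulr1n mul1r Zsum0.
  have e : ctype s = [::].
    rewrite /ctype (_ : porbits s = finset.set0) ?enum_set0 //.
    by apply/setP => c; rewrite !inE; apply/imsetP => -[[]].
  by rewrite wE e mul1r.
have Gs : perm_invariant (fun t => theta ^+ size t * F t).
  by move=> s t st; rewrite (perm_size st) (Fs _ _ st).
rewrite (eq_bigr (fun s => theta ^+ size (ctype s) * F (ctype s))) => [|s _]; last by rewrite wE.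
rewrite (sum_ctypeS n Gs) factS mulnC natrM -mulrA Zsum_crp mulrDr -ZsumZ -!IH.
- rewrite -big_split; apply: eq_bigr => s _ /=; rewrite wE exprS.
  congr (_ + _); first by rewrite -mulrA mulrCA.
  rewrite -pick_sumZ; apply: eq_pick_sum_size => c t st.
  by rewrite /= st mulrCA.
- move=> s t st; have e u : pick_sum (fun c s => c%:R * F (c.+1 :: s)) u =
      \sum_(c <- u) c%:R * F (c.+1 :: rem c u).
    rewrite -(@pick_sum_sym _ (fun c u => c%:R * F (c.+1 :: rem c u))).
      by apply: eq_pick_sum => c v /=; rewrite eqxx.
    by move=> c v w vw; rewrite (Fs (c.+1 :: rem c v) (c.+1 :: rem c w)) // perm_cons perm_eq_rem.
  rewrite !e (perm_big _ st) /=; apply: eq_bigr => c _.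
  by rewrite (Fs (c.+1 :: rem c s) (c.+1 :: rem c t)) // perm_cons perm_eq_rem.
- by move=> s t st; rewrite (Fs (1%N :: s) (1%N :: t)) // perm_cons.
Qed.

Definition Ew n F := Z n F / Zc n.

Lemma rising_Zc n : rising theta n = n`!%:R * Zc n.
Proof.
elim: n => [|n IH]; first by rewrite /rising big_ord0 fact0 Zc0 mulr1.
rewrite /rising big_ord_recr /= -/(rising theta n) IH.
transitivity (n`!%:R * ((theta + n%:R) * Zc n)); first by ring.
by rewrite -ZcS factS natrM; ring.
Qed.

Hypothesis theta0 : 0 < theta.

Lemma Zc_gt0 n : 0 < Zc n.
Proof.
elim: n => [|n IH]; first by rewrite Zc0.
by rewrite -(pmulr_rgt0 _ (ltr0Sn R n)) ZcS mulr_gt0 // ltr_wpDr.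
Qed.

Lemma ewens_Ew n (P : seq nat -> bool) : perm_invariant P ->
  ewens theta (fun s : {perm 'I_n} => P (ctype s)) = Ew n (fun t => (P t)%:R).
Proof.
move=> Ps; have Ps' : perm_invariant (fun t => (P t)%:R : R) by move=> s t /Ps ->.
rewrite /ewens /Ew rising_Zc; transitivity (n`!%:R * Z n (fun t => (P t)%:R) / (n`!%:R * Zc n)).
  rewrite -(sum_ctype n Ps') big_mkcond; congr (_ / _); apply: eq_bigr => s _.
  by case: (P _); rewrite ?mulr1 ?mulr0.
have f0 : n`!%:R != 0 :> R by rewrite pnatr_eq0 -lt0n fact_gt0.
have c0 : Zc n != 0 by rewrite gt_eqF // Zc_gt0.
by field; rewrite f0 c0.
Qed.

End Crp.

Lemma hfun_ctype a n (s : {perm 'I_n}) : hfun a s = hsum (a n) (ctype s).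
Proof.
rewrite /hfun /hsum /ctype big_map big_enum /=.
transitivity (\sum_(1 <= j < n.+1)
   \sum_(c in porbits s) (if #|c| == j then a n j else 0)).
  apply: eq_bigr => j _; rewrite -big_mkcondr /= sumr_const -mulr_natr natz /kcyc.
  congr (_ * Posz _); apply: eq_card => c; rewrite !inE //.
rewrite exchange_big /=; apply: eq_bigr => c /imsetP[x _ ->].
have c1 : (1 <= #|porbit s x| < n.+1)%N.
  rewrite lt0n card_porbit_neq0 ltnS -[X in (_ <= X)%N]card_ord; exact: max_card.
rewrite (bigD1_seq #|porbit s x|) ?mem_index_iota ?iota_uniq //= eqxx.
rewrite big1_seq ?addr0 // => j /andP[j1 _].
by rewrite eq_sym (negbTE j1).
Qed.

(** * The ratios [psi]: monotonicity and lower bound *)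

Section Psi.
Variables (R : realType) (theta : R).
Hypothesis theta1 : 1 <= theta.
Local Notation Z := (Zsum theta).
Local Notation c := (Zc theta).
Local Notation psi := (psi theta).
Local Notation E := (Ew theta).

Let theta0 : 0 < theta. Proof. exact: lt_le_trans theta1. Qed.
Let c0 n : 0 < c n := Zc_gt0 theta0 n.
Let cN0 n : c n != 0. Proof. by rewrite gt_eqF. Qed.

Lemma ZcS_div n : c n.+1 = (theta + n%:R) / n.+1%:R * c n.
Proof. by rewrite mulrAC -ZcS mulrAC divff ?mul1r // pnatr_eq0. Qed.

Lemma Zc_leS n : c n <= c n.+1.
Proof.
rewrite ZcS_div ler_peMl ?(ltW (c0 n)) // ler_pdivlMr ?ltr0n // mul1r -natr1.
by rewrite addrC lerD2r.
Qed.

Lemma Zc_mono m n : (m <= n)%N -> c m <= c n.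
Proof.
move=> mn; rewrite -(subnK mn); elim: (n - m)%N => [|k IH] //.
by rewrite addSn; apply: (le_trans IH); apply: Zc_leS.
Qed.

Lemma psi_gt0 n j : 0 < psi n j.
Proof. by rewrite divr_gt0. Qed.

Lemma psi_ge0 n j : 0 <= psi n j.
Proof. exact/ltW/psi_gt0. Qed.

Lemma psi_le1 n j : psi n j <= 1.
Proof. by rewrite ler_pdivrMr // mul1r Zc_mono // leq_subr. Qed.

Lemma psi_add n i j : psi n (i + j) = psi n i * psi (n - i) j.
Proof.
by rewrite /@psi subnDA; field; rewrite !cN0.
Qed.

(** Log-concavity of [c]: the quotient [(theta + k) / (k + 1)] of neighbours decreases in [k]
    because [theta >= 1]. *)
Lemma psi_mono s n j : (j <= s)%N -> (s <= n)%N -> psi s j <= psi n j.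
Proof.
move=> js sn; rewrite -(subnK sn); elim: (n - s)%N => [|k IH] //.
rewrite addSn; apply: (le_trans IH); rewrite /@psi subSn; last by lia.
have -> : (k + s)%N = (k + s - j + j)%N by lia.
rewrite addnK; move: (k + s - j)%N => m.
rewrite ler_pdivrMr // mulrAC ler_pdivlMr // !ZcS_div.
have -> : (theta + m%:R) / m.+1%:R * c m * c (m + j) =
  c m * (c (m + j) * ((theta + m%:R) / m.+1%:R)) by ring.
rewrite ler_pM2l // [X in X <= _]mulrC ler_pM2l //.
rewrite ler_pdivrMr ?ltr0n // mulrAC ler_pdivlMr ?ltr0n //.
rewrite -!natr1 natrD -subr_ge0.
have -> : (theta + m%:R) * (m%:R + j%:R + 1) - (theta + (m%:R + j%:R)) * (m%:R + 1) =
  (theta - 1) * j%:R by ring.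
by rewrite mulr_ge0 // subr_ge0.
Qed.

Lemma psi_submul n i j : (i + j <= n)%N -> psi n (i + j) <= psi n i * psi n j.
Proof.
move=> ijn; rewrite psi_add; apply: ler_wpM2l; first exact: psi_ge0.
by apply: psi_mono; lia.
Qed.

(** The left side is [1 + (theta - 1)/(k + 1)], at most [exp((theta - 1)/(k + 1))], and
    [exp(1/(k + 1)) <= (k + 1)/k]. *)
Lemma ratio_powR_ge k : (0 < k)%N ->
  (theta + k%:R) / k.+1%:R <= powR (k.+1%:R / k%:R) (theta - 1).
Proof.
move=> k0; have kp : 0 < k%:R :> R by rewrite ltr0n.
have Kp : 0 < k.+1%:R :> R by rewrite ltr0n.
have e1 : expR (k.+1%:R^-1) <= k.+1%:R / k%:R :> R.
  rewrite -[leLHS]invrK -[leRHS]invrK lef_pV2 ?posrE ?invr_gt0 ?expR_gt0 ?divr_gt0 //.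
  rewrite invf_div -expRN; apply: le_trans (expR_ge1Dx _).
  rewrite le_eqVlt; apply/orP; left; apply/eqP.
  by rewrite -natr1; field; rewrite natr1 gt_eqF.
apply: le_trans (ge0_ler_powR _ _ _ e1); rewrite ?nnegrE ?subr_ge0 ?expR_ge0 ?divr_ge0 //.
rewrite -expRM; apply: le_trans (expR_ge1Dx _).
by rewrite -natr1 le_eqVlt; apply/orP; left; apply/eqP; field; rewrite natr1 gt_eqF.
Qed.

Lemma Zc_powR_ratio k n : (0 < k)%N -> (k <= n)%N ->
  c n <= powR (n%:R / k%:R) (theta - 1) * c k.
Proof.
move=> k0 kn; rewrite -(subnK kn); elim: (n - k)%N => [|d IH].
  by rewrite add0n divff ?pnatr_eq0 ?gtn_eqF // powR1 mul1r.
rewrite addSn ZcS_div; set m := (d + k)%N in IH *.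
have m0 : (0 < m)%N by rewrite /m; lia.
have -> : (m.+1%:R / k%:R : R) = (m.+1%:R / m%:R) * (m%:R / k%:R).
  by rewrite mulrA divfK // pnatr_eq0 gtn_eqF.
rewrite powRM ?divr_ge0 // -[leRHS]mulrA; apply: ler_pM => //.
- by rewrite divr_ge0 // addr_ge0 // ltW.
- exact: ltW.
- exact: ratio_powR_ge.
Qed.

Lemma psi_ge n j : (j < n)%N -> powR (1 - j%:R / n%:R) (theta - 1) <= psi n j.
Proof.
move=> jn; have n0 : n%:R != 0 :> R by rewrite pnatr_eq0; lia.
have -> : 1 - j%:R / n%:R = (n - j)%:R / n%:R :> R.
  by rewrite natrB 1?ltnW // mulrBl divff.
rewrite ler_pdivlMr //; have := @Zc_powR_ratio (n - j) n.
rewrite subn_gt0 jn leq_subr => /(_ isT isT) h.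
have p0 : 0 <= powR ((n - j)%:R / n%:R) (theta - 1) :> R by apply: powR_ge0.
apply: le_trans (ler_wpM2l p0 h) _.
rewrite mulrA -powRM ?divr_ge0 // mulrA divfK // divff ?powR1 ?mul1r //.
by rewrite pnatr_eq0; lia.
Qed.

Lemma psi_ge_frac n j (y : R) : (j < n)%N -> 0 <= y -> j%:R <= (1 - y) * n%:R ->
  powR y (theta - 1) <= psi n j.
Proof.
move=> jn y0 jy; have n0 : 0 < n%:R :> R by rewrite ltr0n; lia.
apply: le_trans (psi_ge jn); apply: ge0_ler_powR; rewrite ?nnegrE ?subr_ge0 //.
  by rewrite ler_pdivrMr // mul1r ler_nat ltnW.
by rewrite lerBrDr -lerBrDl ler_pdivrMr.
Qed.

End Psi.

(** * First and second moments of sums over cycles *)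

Definition cyc (R : realType) (f : nat -> R) (t : seq nat) : R := \sum_(c <- t) f c.

Lemma perm_invariant_cyc (R : realType) (f : nat -> R) : perm_invariant (cyc f).
Proof. by move=> s t; apply: perm_big. Qed.

Lemma cyc_cons (R : realType) (f : nat -> R) c t : cyc f (c :: t) = f c + cyc f t.
Proof. exact: big_cons. Qed.

Definition pairs (R : realType) (g : nat -> nat -> R) (t : seq nat) : R :=
  \sum_(c <- t) \sum_(d <- t) g c d.

Section Moments.
Variables (R : realType) (theta : R).
Hypothesis theta1 : 1 <= theta.
Local Notation Z := (Zsum theta).
Local Notation c := (Zc theta).
Local Notation psi := (psi theta).
Local Notation E := (Ew theta).

Let theta0 : 0 < theta. Proof. exact: lt_le_trans theta1. Qed.
Let c0 n : 0 < c n := Zc_gt0 theta0 n.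
Let cN0 n : c n != 0. Proof. by rewrite gt_eqF. Qed.

Lemma eq_Ew n F G : (forall t, is_comp n t -> F t = G t) -> E n F = E n G.
Proof. by move=> FG; rewrite /Ew (eq_Zsum _ FG). Qed.

Lemma le_Ew n F G : (forall t, is_comp n t -> F t <= G t) -> E n F <= E n G.
Proof. by move=> FG; rewrite ler_pM2r ?invr_gt0 //; apply: le_Zsum. Qed.

Lemma Ew_ge0 n F : (forall t, is_comp n t -> 0 <= F t) -> 0 <= E n F.
Proof. by move=> F0; rewrite divr_ge0 ?(ltW (c0 n)) //; apply: Zsum_ge0. Qed.

Lemma EwD n F G : E n (fun t => F t + G t) = E n F + E n G.
Proof. by rewrite /Ew ZsumD mulrDl. Qed.

Lemma EwB n F G : E n (fun t => F t - G t) = E n F - E n G.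
Proof. by rewrite /Ew ZsumB mulrBl. Qed.

Lemma EwZ n x F : E n (fun t => x * F t) = x * E n F.
Proof. by rewrite /Ew ZsumZ mulrA. Qed.

Lemma Ew_sum n (I : Type) (r : seq I) (P : pred I) (F : I -> seq nat -> R) :
  E n (fun t => \sum_(i <- r | P i) F i t) = \sum_(i <- r | P i) E n (F i).
Proof. by rewrite /Ew Zsum_sum mulr_suml. Qed.

Lemma Ew_cst n x : E n (fun=> x) = x.
Proof.
by rewrite -[RHS]mulr1 -[X in _ = _ * X](divff (cN0 n)) -EwZ; apply: eq_Ew => t _; rewrite mulr1.
Qed.

Lemma Ew_palm n (Phi : nat -> seq nat -> R) :
  (forall i, perm_invariant (Phi i)) ->
  E n (fun t => \sum_(i <- t) Phi i t) =
  \sum_(1 <= j < n.+1) theta / j%:R * psi n j * E (n - j) (fun t => Phi j (j :: t)).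
Proof.
move=> sym; rewrite /Ew Zsum_palm; last by move=> i s t; apply: sym.
rewrite mulr_suml; apply: eq_bigr => j _; rewrite /@psi.
by move: (j%:R^-1) => u; field; rewrite !cN0.
Qed.

(** The mean number of cycles of length [j]. The indicator is essential: for [j > n] the truncated
    subtraction leaves [psi n j = 1 / c_n], not 0. *)
Definition kmean n j : R := (j <= n)%:R * (theta / j%:R * psi n j).

Lemma kmean_ge0 n j : 0 <= kmean n j.
Proof.
by rewrite mulr_ge0 // mulr_ge0 ?psi_ge0 // divr_ge0 // ltW.
Qed.

Lemma kmean_mono s n j : (s <= n)%N -> kmean s j <= kmean n j.
Proof.
move=> sn; rewrite /kmean; case: (leqP j s) => js; last first.
  by rewrite mul0r; apply: kmean_ge0.
rewrite (leq_trans js sn) !mul1r ler_wpM2l ?divr_ge0 ?(ltW theta0) //.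
exact: psi_mono.
Qed.

Lemma kmean_le n j : kmean n j <= theta / j%:R.
Proof.
rewrite /kmean -[leRHS]mul1r; apply: ler_pM; rewrite ?ler0n //.
- by rewrite mulr_ge0 ?psi_ge0 // divr_ge0 // ltW.
- by case: leqP.
- by rewrite ler_piMr ?psi_le1 // divr_ge0 // ltW.
Qed.

Lemma sum_kmean_trunc s N (F : nat -> R) : (s <= N)%N ->
  \sum_(1 <= j < s.+1) theta / j%:R * psi s j * F j =
  \sum_(1 <= j < N.+1) kmean s j * F j.
Proof.
move=> sN; rewrite (big_nat_trunc _ sN); apply: eq_bigr => j _.
by rewrite /kmean mulrA.
Qed.

Lemma Ew_cyc n (f : nat -> R) : E n (cyc f) = \sum_(1 <= j < n.+1) kmean n j * f j.
Proof.
rewrite (Ew_palm n (Phi := fun j _ => f j)) // (@sum_kmean_trunc n n) //.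
by apply: eq_bigr => j _; rewrite Ew_cst.
Qed.

Lemma Ew_cyc_mono s n (f : nat -> R) : (s <= n)%N -> (forall j, 0 <= f j) ->
  E s (cyc f) <= E n (cyc f).
Proof.
move=> sn f0; rewrite !Ew_cyc -(@sum_kmean_trunc s s) // (@sum_kmean_trunc s n) //.
by apply: ler_sum => j _; apply: ler_wpM2r => //; apply: kmean_mono.
Qed.

(** Mark one cycle: it contributes at most [b], and the mean over the remaining [n - j] points is at
    most the mean over [n] points by monotonicity of [kmean]. *)
Lemma Ew_cyc_sqr n (f : nat -> R) (b : R) :
  (forall j, 0 <= f j) -> (forall j, (1 <= j <= n)%N -> f j <= b) ->
  E n (fun t => cyc f t ^+ 2) <= E n (cyc f) * (E n (cyc f) + b).
Proof.
move=> f0 fb; set M := E n (cyc f).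
rewrite (eq_Ew (G := fun t => \sum_(i <- t) f i * cyc f t)); last first.
  by move=> t _; rewrite -mulr_suml.
rewrite Ew_palm; last first.
  by move=> i s t st; rewrite (perm_invariant_cyc _ st).
rewrite (@sum_kmean_trunc n n) // [X in X * _](Ew_cyc n f) mulr_suml !big_nat.
apply: ler_sum => j jn; rewrite -mulrA; apply: ler_wpM2l; first exact: kmean_ge0.
rewrite EwZ; apply: ler_wpM2l => //.
rewrite (eq_Ew (G := fun t => f j + cyc f t)); last by move=> t _; rewrite cyc_cons.
by rewrite EwD Ew_cst addrC lerD ?fb //; first by apply: Ew_cyc_mono; rewrite ?leq_subr.
Qed.

(* Chebyshev's inequality in a form that needs no case distinction:
   [X I >= M/2 I - 2/M (X - M)^2] holds pointwise. *)
Lemma Ew_cheb n (X I : seq nat -> R) (M : R) :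
  0 < M -> (forall t, is_comp n t -> 0 <= X t) ->
  (forall t, I t = 0 \/ I t = 1) ->
  M / 2 * E n I - 2 / M * (E n (fun t => X t ^+ 2) - 2 * M * E n X + M ^+ 2) <=
  E n (fun t => X t * I t).
Proof.
move=> M0 X0 I01.
have -> : E n (fun t => X t ^+ 2) - 2 * M * E n X + M ^+ 2 =
          E n (fun t => (X t - M) ^+ 2).
  rewrite -[X in _ + X](Ew_cst n) -EwZ -EwB -EwD; apply: eq_Ew => t _; ring.
rewrite -!EwZ -EwB; apply: le_Ew => t tn.
have Mi : 0 < M^-1 by rewrite invr_gt0.
have MM : M * M^-1 = 1 by rewrite divff // gt_eqF.
have sq : 0 <= (X t - M) ^+ 2 by rewrite sqr_ge0.
case: (I01 t) => ->; first by rewrite !mulr0 sub0r oppr_le0 mulr_ge0 // mulr_ge0 // ltW.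
rewrite !mulr1 -subr_ge0.
have -> : X t - (M / 2 - 2 / M * (X t - M) ^+ 2) =
   2 * M^-1 * ((X t - M + M / 4) ^+ 2 + 3 / 16 * M ^+ 2).
  by field; rewrite gt_eqF.
by rewrite mulr_ge0 // ?mulr_ge0 ?(ltW Mi) // addr_ge0 ?sqr_ge0 // mulr_ge0 ?sqr_ge0.
Qed.

Lemma perm_invariant_pairs (g : nat -> nat -> R) : perm_invariant (pairs g).
Proof.
move=> s t st; rewrite /pairs (perm_big _ st) /=; apply: eq_bigr => i _.
exact: perm_big.
Qed.

(** Two marked cycles. The vanishing diagonal of [g] excludes pairing a cycle with itself, which
    would add a sum over single cycles. *)
Lemma Ew_palm2 n (g : nat -> nat -> R) (Phi : seq nat -> R) :
  perm_invariant Phi -> (forall i, g i i = 0) ->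
  E n (fun t => pairs g t * Phi t) =
  \sum_(1 <= i < n.+1) \sum_(1 <= j < n.+1)
    g i j * ((i + j <= n)%:R * (theta / i%:R * (theta / j%:R) * psi n (i + j)) *
    E (n - (i + j)) (fun t => Phi (i :: j :: t))).
Proof.
move=> sym g0.
rewrite (eq_Ew (G := fun t => \sum_(i <- t) cyc (g i) t * Phi t)); last first.
  by move=> t _; rewrite -mulr_suml.
rewrite Ew_palm; last first.
  by move=> i s t st; rewrite (perm_invariant_cyc _ st) (sym _ _ st).
rewrite !big_nat; apply: eq_bigr => i /andP[i1 i2].
rewrite (eq_Ew (G := fun t => \sum_(j <- t) g i j * Phi (i :: t))); last first.
  by move=> t _; rewrite cyc_cons g0 add0r -mulr_suml.
rewrite Ew_palm; last first.
  by move=> j s t st; rewrite (sym (i :: s) (i :: t)) // perm_cons.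
rewrite (@big_nat_trunc _ (n - i) n) ?leq_subr // mulr_sumr.
apply: eq_bigr => j _.
rewrite (_ : (j <= n - i)%N = (i + j <= n)%N); last by lia.
by rewrite EwZ psi_add // subnDA; ring.
Qed.

End Moments.

Arguments eq_Ew {R theta n F} G _.

(** * Avoiding cycle lengths of bounded harmonic weight *)

Section Sums.
Variable (R : realType).

Lemma sum_exp_coeff_le (y : R) N : 0 <= y -> \sum_(0 <= r < N) y ^+ r / r`!%:R <= expR y.
Proof.
move=> y0; have h := @nondecreasing_cvgn_le R (series (exp_coeff y)) _ (is_cvg_series_exp_coeff y) N.
rewrite /expR; apply: h; apply/nondecreasing_seqP => n.
by rewrite !seriesEnat /= big_nat_recr //= lerDl exp_coeff_ge0.
Qed.

Lemma sum_shift (N i : nat) (F : nat -> R) : (i <= N)%N ->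
  \sum_(1 <= j < N.+1) (i + j <= N)%:R * F (i + j)%N =
  \sum_(1 <= u < N.+1) (i < u)%:R * F u.
Proof.
move=> iN; transitivity (\sum_(i.+1 <= u < N.+1) F u).
  rewrite -[i.+1]add1n big_addn subSn // (@big_nat_trunc _ (N - i) N) ?leq_subr //.
  by apply: eq_bigr => j _; rewrite addnC leq_subRL // addnC.
rewrite (big_nat_widenl _ 1) // big_mkcond /=; apply: eq_bigr => u _.
by case: ltnP; rewrite ?mul1r ?mul0r.
Qed.

(** The change of variables behind merging and splitting: a pair [(i, j)] becomes a total
    [u = i + j] together with its part [i]. *)
Lemma sum_pairs_by_sum (N : nat) (F : nat -> nat -> R) :
  \sum_(1 <= i < N.+1) \sum_(1 <= j < N.+1) (i + j <= N)%:R * F i (i + j)%N =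
  \sum_(1 <= u < N.+1) \sum_(1 <= i < u) F i u.
Proof.
transitivity (\sum_(1 <= i < N.+1) \sum_(1 <= u < N.+1) (i < u)%:R * F i u).
  by rewrite !big_nat; apply: eq_bigr => i /andP[_ iN]; rewrite (@sum_shift _ _ (F i)).
rewrite exchange_big /= !big_nat; apply: eq_bigr => u /andP[u1 uN].
rewrite -(prednK u1) (@big_nat_trunc _ u.-1 N); last by lia.
by apply: eq_bigr => i _; congr (_%:R * _); lia.
Qed.

(** Each doubling from [n] to [2n] adds [n] terms, all at least [1/(2n)]. *)
Lemma harmonic_dyadic (m k : nat) : (0 < m)%N ->
  k%:R / 2 <= \sum_(m <= x < m * 2 ^ k) (x.+1%:R^-1 : R).
Proof.
move=> m0; elim: k => [|k IH]; first by rewrite mul0r expn0 muln1 big_geq.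
have km : (0 < m * 2 ^ k)%N by rewrite muln_gt0 m0 expn_gt0.
rewrite (@big_cat_nat _ _ _ (m * 2 ^ k)) /= ?leq_pmulr ?expn_gt0 ?leq_mul ?leq_exp2l //.
rewrite -natr1 mulrDl; apply: lerD => //.
rewrite expnS mulnCA; move: (m * 2 ^ k)%N km => n n0.
apply: le_trans (_ : \sum_(n <= x < 2 * n) ((2 * n)%:R^-1 : R) <= _); last first.
  rewrite !big_nat; apply: ler_sum => x /andP[nx xn].
  by rewrite lef_pV2 ?posrE ?ltr0n ?ler_nat //; lia.
rewrite sumr_const_nat mul1r (_ : (2 * n - n = n)%N); last by lia.
have n0' : n%:R != 0 :> R by rewrite pnatr_eq0 -lt0n.
by rewrite -mulr_natr natrM le_eqVlt; apply/orP; left; apply/eqP; field.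
Qed.

(** If the counting function of [J] exceeded [x/20] at every [x] in [[m, m * 2^k)], summation by
    parts would make the harmonic weight of [J] at least [k/40]. *)
Lemma sparse_scale (J : pred nat) (C : R) (m k s : nat) :
  (0 < m)%N -> (m * 2 ^ k <= s)%N ->
  \sum_(1 <= j < s.+1) (J j)%:R / j%:R <= C -> 40 * C < k%:R ->
  exists2 x, (m <= x <= s)%N & (\sum_(1 <= j < x.+1) (J j)%:R <= (x%:R / 20 : R)).
Proof.
move=> m0 ms JC kC; apply/not_exists2P => h.
have hd := @harmonic_dyadic m k m0.
have mk : (m <= m * 2 ^ k)%N by rewrite leq_pmulr ?expn_gt0.
move: (m * 2 ^ k)%N ms hd mk => N ms hd mk.
pose B x : R := \sum_(1 <= j < x.+1) (J j)%:R.
have B0 x : 0 <= B x by apply: sumr_ge0.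
have abel : \sum_(1 <= j < s.+1) (J j)%:R / j%:R =
    B s / s%:R + \sum_(1 <= x < s) B x / (x%:R * x.+1%:R).
  have BS x : B x.+1 = B x + (J x.+1)%:R by rewrite /B big_nat_recr.
  have Bz : B 0 = 0 by rewrite /B big_geq.
  elim: s {ms JC h} => [|s IH]; first by rewrite Bz !big_geq // mul0r addr0.
  rewrite big_nat_recr // IH BS; case: s {IH} => [|s].
    by rewrite Bz !big_geq // !(mul0r, add0r, addr0) /= add0r.
  have p1 : s.+1%:R != 0 :> R by rewrite pnatr_eq0.
  have p2 : s.+2%:R != 0 :> R by rewrite pnatr_eq0.
  rewrite [in RHS](big_nat_recr s.+1) //= BS; move: p1 p2.
  rewrite -(@natr1 R s.+1); move: (s.+1%:R) => z p1 p2.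
  by field; rewrite p1 p2.
have bad x : (m <= x < N)%N -> x%:R / 20 < B x.
  move=> /andP[mx xs]; have [|/negP] := h x; first by move/negP; rewrite mx /=; lia.
  by rewrite -ltNge.
have : k%:R / 2 / 20 <= C.
  apply: le_trans JC; rewrite abel; apply: ler_wpDl; first by rewrite divr_ge0.
  apply: le_trans (_ : \sum_(m <= x < N) x.+1%:R^-1 / 20 <= _).
    by rewrite -mulr_suml ler_pM2r ?invr_gt0 // hd.
  rewrite [leRHS](@big_cat_nat _ _ _ N) //=; last by lia.
  rewrite [X in _ <= X + _](@big_cat_nat _ _ _ m) //=.
  rewrite -addrA; apply: ler_wpDl; first by apply: sumr_ge0 => x _; rewrite divr_ge0.
  apply: ler_wpDr; first by apply: sumr_ge0 => x _; rewrite divr_ge0.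
  rewrite !big_nat; apply: ler_sum => x mx.
  have x0 : 0 < x%:R :> R by rewrite ltr0n; lia.
  have x1 : 0 < x.+1%:R :> R by rewrite ltr0n.
  rewrite ler_pdivlMr ?mulr_gt0 //; apply: le_trans (ltW (bad _ mx)).
  rewrite le_eqVlt; apply/orP; left; apply/eqP; move: (x.+1%:R) x1 => z z0.
  by field; rewrite gt_eqF.
lra.
Qed.

End Sums.

Section Sieve.
Variables (R : realType) (theta : R).
Hypothesis theta1 : 1 <= theta.
Local Notation Z := (Zsum theta).
Local Notation c := (Zc theta).

Let theta0 : 0 < theta. Proof. exact: lt_le_trans theta1. Qed.
Let c0 n : 0 < c n := Zc_gt0 theta0 n.

Variable J : pred nat.
Definition Zavoid n : R := Z n (fun t => (count J t == 0)%:R).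
Local Notation q := Zavoid.

Lemma Zavoid_ge0 n : 0 <= q n.
Proof. by apply: Zsum_ge0. Qed.

Lemma Zavoid_rec n :
  n%:R * q n = theta * \sum_(1 <= j < n.+1) (~~ J j)%:R * q (n - j).
Proof.
rewrite Zsum_eqrec; congr (_ * _); apply: eq_bigr => j _.
rewrite -ZsumZ; apply: eq_Zsum => t _ /=.
by case: (J j); rewrite /= ?mul0r ?mul1r.
Qed.

Let S x r : R := \sum_(0 <= s < x.+1) Z s (fun t => (count J t == r)%:R).

(** Mark one of the [r + 1] entries in [J]. Its removal turns [s] into [s - j], still at most [x],
    so after summation over all sizes up to [x] the result is bounded by [S x r]; a single size
    would allow no such comparison. *)
Lemma sum_Zsum_count_rec x r (C : R) :
  \sum_(1 <= j < x.+1) (J j)%:R / j%:R <= C ->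
  r.+1%:R * S x r.+1 <= theta * C * S x r.
Proof.
move=> JC; rewrite /S mulr_sumr.
have S0 : 0 <= S x r by apply: sumr_ge0 => s _; apply: Zsum_ge0.
have -> : \sum_(0 <= s < x.+1) r.+1%:R * Z s (fun t => (count J t == r.+1)%:R) =
  \sum_(0 <= s < x.+1) \sum_(1 <= j < x.+1) (j <= s)%:R *
    (theta / j%:R * ((J j)%:R * Z (s - j) (fun t => (count J t == r)%:R))).
  rewrite !big_nat; apply: eq_bigr => s /andP[_ sx].
  rewrite -(@big_nat_trunc _ s x) //.
  pose Phi j t : R := (J j)%:R * (count J t == r.+1)%:R.
  have sym i : perm_invariant (Phi i).
    by move=> u v uv; rewrite /Phi; move/seq.permP: uv => ->.
  rewrite -ZsumZ; transitivity (Z s (fun t => \sum_(i <- t) Phi i t)).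
    apply: eq_Zsum => t _; rewrite -mulr_suml; case: eqP => [<-|]; rewrite ?mulr0 // !mulr1.
    by rewrite -sum1_count natr_sum big_mkcond /=; apply: eq_bigr => i _; case: (J i).
  rewrite Zsum_palm; last by move=> i u v; apply: sym.
  rewrite !big_nat; apply: eq_bigr => j _; congr (_ * _); rewrite -ZsumZ.
  by apply: eq_Zsum => t _; rewrite /Phi /=; case: (J j); rewrite ?mul0r // add1n eqSS.
rewrite exchange_big /=.
apply: le_trans (_ : \sum_(1 <= j < x.+1) theta * ((J j)%:R / j%:R) * S x r <= _); last first.
  by rewrite -mulr_suml -mulr_sumr ler_wpM2r // ler_wpM2l // ltW.
rewrite !big_nat; apply: ler_sum => j /andP[j1 jx].
rewrite (@big_cat_nat _ _ _ j) //=; last by lia.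
rewrite big_nat big1 ?add0r => [|s /andP[_ sj]]; last first.
  by rewrite leqNgt sj mul0r.
rewrite -[X in \sum_(X <= _ < _) _]add0n big_addn.
rewrite -[leRHS]mulrA [in leRHS]mulrC -!mulrA.
under eq_bigr do rewrite leq_addl mul1r addnK.
rewrite -!mulr_sumr.
apply: le_trans (_ : theta / j%:R * ((J j)%:R * S x r) <= _); last first.
  by rewrite le_eqVlt; apply/orP; left; apply/eqP; ring.
apply: ler_wpM2l; first by rewrite divr_ge0 // ltW.
apply: ler_wpM2l => //; rewrite /S [leRHS](@big_cat_nat _ _ _ (x.+1 - j)) //=; last by lia.
by rewrite lerDl; apply: sumr_ge0 => s _; apply: Zsum_ge0.
Qed.

(** Iteration gives [S x r <= (theta C)^r / r! * S x 0], and the sum over [r] is an exponential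
    series. This bounds the avoidance weight from below only on average over the sizes. *)
Lemma sum_Zc_le_avoid x (C : R) :
  \sum_(1 <= j < x.+1) (J j)%:R / j%:R <= C ->
  \sum_(0 <= s < x.+1) c s <= expR (theta * C) * \sum_(0 <= s < x.+1) q s.
Proof.
move=> JC; have C0 : 0 <= C.
  by apply: le_trans JC; apply: sumr_ge0 => j _; rewrite divr_ge0.
have tC : 0 <= theta * C by rewrite mulr_ge0 // ltW.
have S0 r : 0 <= S x r by apply: sumr_ge0 => s _; apply: Zsum_ge0.
have Sr r : S x r <= (theta * C) ^+ r / r`!%:R * S x 0.
  elim: r => [|r IH]; first by rewrite expr0 fact0 divr1 mul1r.
  rewrite -(ler_pM2l (ltr0Sn R r)); apply: le_trans (sum_Zsum_count_rec r JC) _.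
  apply: le_trans (ler_wpM2l tC IH) _.
  rewrite le_eqVlt; apply/orP; left; apply/eqP; rewrite factS natrM exprS.
  have f0 : r`!%:R != 0 :> R by rewrite pnatr_eq0 -lt0n fact_gt0.
  have p0 : r.+1%:R != 0 :> R by rewrite pnatr_eq0.
  by move: (r.+1%:R) p0 => z z0; field; rewrite f0 z0.
have -> : \sum_(0 <= s < x.+1) c s = \sum_(0 <= r < x.+1) S x r.
  rewrite /S exchange_big /= !big_nat; apply: eq_bigr => s /andP[_ sx].
  rewrite -Zsum_sum; apply: eq_Zsum => t /andP[t1 /eqP ts].
  have ct : (count J t < x.+1)%N.
    apply: leq_ltn_trans sx; rewrite -ts.
    elim: t t1 {ts} => //= d t IH /andP[d1 /IH h]; move: d1 h; case: (J d); lia.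
  rewrite (bigD1_seq (count J t)) ?mem_index_iota ?iota_uniq //= eqxx.
  by rewrite big1 ?addr0 // => r /negbTE; rewrite eq_sym => ->.
apply: le_trans (_ : \sum_(0 <= r < x.+1) (theta * C) ^+ r / r`!%:R * S x 0 <= _).
  by apply: ler_sum => r _.
by rewrite -mulr_suml ler_wpM2r ?S0 // sum_exp_coeff_le.
Qed.

End Sieve.

Section SieveLower.
Variables (R : realType) (theta : R).
Hypothesis theta1 : 1 <= theta.
Local Notation c := (Zc theta).

Let theta0 : 0 < theta. Proof. exact: lt_le_trans theta1. Qed.
Let c0 n : 0 < c n := Zc_gt0 theta0 n.

Section Sparse.
Variables (J : pred nat) (y : nat).
Hypothesis y4 : (4 <= y)%N.
Hypothesis Jy : \sum_(1 <= j < (4 * y).+1) (J j)%:R <= (y%:R / 4 : R).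
Local Notation q := (Zavoid theta J).
Let g j : R := (~~ J j)%:R.
Let q0 n : 0 <= q n. Proof. exact: Zavoid_ge0. Qed.

(* An interval in which [J] is sparse is covered by sums of two elements
   outside [J], each element being represented often. *)
Lemma sparse_sumset u : (y <= u <= 4 * y)%N ->
  y%:R / 4 <= \sum_(1 <= i < u) g i * g (u - i).
Proof.
move=> /andP[yu uy].
apply: le_trans (_ : \sum_(1 <= i < u) (1 - (J i)%:R - (J (u - i)%N)%:R : R) <= _); last first.
  apply: ler_sum => i _; rewrite /g; case: (J i); case: (J _) => /=; lra.
rewrite !big_split /= sumr_const_nat !sumrN.
rewrite [X in _ <= _ - X]big_nat_rev /= add1n.
have -> : \sum_(1 <= i < u) (J (u - (u.+1 - i.+1))%N)%:R = \sum_(1 <= i < u) (J i)%:R :> R.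
  by rewrite !big_nat; apply: eq_bigr => i iu; congr (J _)%:R; lia.
have h : \sum_(1 <= i < u) (J i)%:R <= y%:R / 4 :> R.
  apply: le_trans Jy; rewrite [leRHS](@big_cat_nat _ _ _ u) //=; try lia.
  by rewrite lerDl; apply: sumr_ge0.
have h1 : (1 *+ (u - 1) : R) >= y%:R - 1.
  by rewrite lerBlDr natr1 -/(_%:R) ler_nat; lia.
have h2 : 4 <= y%:R :> R by rewrite ler_nat.
lra.
Qed.

(** The recursion is applied twice, with the factors [theta >= 1] dropped, and the two removed parts
    are grouped by their sum. A single step would not do: [s - t] may lie in [J] wherever [q t] is
    large, while sums of two parts outside [J] miss nothing in [[y, 4 * y]]. *)
Lemma Zavoid_two_step s :
  y%:R / 4 * \sum_(y <= u < (4 * y).+1) (u <= s)%:R * q (s - u) <= s%:R ^+ 2 * q s.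
Proof.
have step n : \sum_(1 <= j < n.+1) g j * q (n - j) <= n%:R * q n.
  by rewrite Zavoid_rec // ler_peMl // sumr_ge0 // => j _; rewrite mulr_ge0 // ler0n.
apply: le_trans (_ : \sum_(1 <= i < s.+1) \sum_(1 <= j < s.+1) (i + j <= s)%:R *
   (g i * g (i + j - i)%N * q (s - (i + j))) <= _); last first.
  rewrite expr2 -mulrA; apply: le_trans (ler_wpM2l (ler0n _ _) (step s)).
  rewrite mulr_sumr !big_nat; apply: ler_sum => i /andP[i1 is1].
  apply: le_trans (_ : g i * ((s - i)%:R * q (s - i)) <= _); last first.
    by rewrite [leRHS]mulrCA ler_wpM2l // ?ler0n // ler_wpM2r // ler_nat leq_subr.
  apply: le_trans (ler_wpM2l (ler0n _ _) (step (s - i)%N)).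
  rewrite (@big_nat_trunc _ (s - i) s) ?leq_subr // mulr_sumr !big_nat.
  apply: ler_sum => j _; rewrite addKn subnDA le_eqVlt; apply/orP; left; apply/eqP.
  by rewrite (_ : (j <= s - i)%N = (i + j <= s)%N); [ring|lia].
rewrite (sum_pairs_by_sum s (fun i u => g i * g (u - i)%N * q (s - u))).
rewrite (@big_nat_trunc _ s (s + 4 * y)) ?leq_addr //.
rewrite [leRHS](@big_cat_nat _ _ _ y) //=; try lia.
rewrite [X in _ <= _ + X](@big_cat_nat _ _ _ (4 * y).+1) //=; try lia.
have pos a b : 0 <= \sum_(a <= u < b) (u <= s)%:R * \sum_(1 <= i < u) g i * g (u - i)%N * q (s - u).
  by do 2![apply: sumr_ge0 => ? _; rewrite mulr_ge0 ?ler0n //]; rewrite ?mulr_ge0 ?ler0n.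
apply: ler_wpDl => //; apply: ler_wpDr => //.
rewrite mulr_sumr !big_nat; apply: ler_sum => u yu.
rewrite mulrCA ler_wpM2l ?ler0n // -mulr_suml ler_wpM2r // sparse_sumset //; lia.
Qed.

(** For these [s] all [s - t] with [t <= y] lie in [[y, 4 * y]], so the averaged bound becomes
    pointwise. The constant is [64 = 4 * 16], from [y / 4] and [s^2 <= 16 y^2]. *)
Lemma Zavoid_base s (A : R) : (2 * y <= s <= 4 * y)%N ->
  A <= \sum_(0 <= t < y.+1) q t -> A / (64 * y%:R) <= q s.
Proof.
move=> /andP[ys sy] Aq; have y0 : 0 < y%:R :> R by rewrite ltr0n; lia.
have s0 : 0 < s%:R :> R by rewrite ltr0n; lia.
have := Zavoid_two_step s.
have qs : \sum_(0 <= t < y.+1) q t <= \sum_(y <= u < (4 * y).+1) (u <= s)%:R * q (s - u).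
  rewrite [leRHS](@big_cat_nat _ _ _ s.+1) //=; try lia.
  apply: ler_wpDr; first by apply: sumr_ge0 => u _; rewrite mulr_ge0.
  rewrite [leRHS](@big_cat_nat _ _ _ (s - y)) //=; try lia.
  apply: ler_wpDl; first by apply: sumr_ge0 => u _; rewrite mulr_ge0.
  rewrite -{1}[(s - y)%N]add0n big_addn (_ : (s.+1 - (s - y) = y.+1)%N); last by lia.
  rewrite [leRHS]big_nat_rev /= add0n !big_nat; apply: ler_sum => t ty.
  rewrite (_ : (_ <= s)%N = true) ?mul1r; last by lia.
  by rewrite (_ : (s - (_ + _) = t)%N) //; lia.
move=> h; have {}h := le_trans (ler_wpM2l (divr_ge0 (ltW y0) (ler0n _ 4)) (le_trans Aq qs)) h.
have s4 : s%:R ^+ 2 * q s <= (4 * y%:R) ^+ 2 * q s.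
  by rewrite ler_wpM2r // lerXn2r ?nnegrE ?mulr_ge0 ?ler0n // -natrM ler_nat.
rewrite ler_pdivrMr ?mulr_gt0 //; have {}h := le_trans h s4.
rewrite -(ler_pM2l y0); lra.
Qed.

(** Removing [u] in [[y, 2 * y)] from [s] lands in [[2 * y, z]], where [q] is already bounded
    below. *)
Lemma Zavoid_extend K z s (d : R) : (4 * y <= z)%N -> (z < s <= z + y)%N ->
  (s <= 2 ^ K * y)%N -> 0 <= d ->
  (forall t, (2 * y <= t <= z)%N -> d <= q t) -> d / 4 ^+ K.+1 <= q s.
Proof.
move=> yz /andP[zs sz] sK d0 dq; have y0 : 0 < y%:R :> R by rewrite ltr0n; lia.
have := Zavoid_two_step s.
have qs : y%:R * d <= \sum_(y <= u < (4 * y).+1) (u <= s)%:R * q (s - u).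
  rewrite [leRHS](@big_cat_nat _ _ _ (2 * y)) //=; try lia.
  apply: ler_wpDr; first by apply: sumr_ge0 => u _; rewrite mulr_ge0.
  apply: le_trans (_ : \sum_(y <= u < 2 * y) d <= _).
    by rewrite sumr_const_nat (_ : (2 * y - y = y)%N) ?mulr_natl //; lia.
  rewrite !big_nat; apply: ler_sum => u yu.
  rewrite (_ : (_ <= s)%N = true) ?mul1r; last by lia.
  by apply: dq; lia.
move=> h; have {}h := le_trans (ler_wpM2l (divr_ge0 (ltW y0) (ler0n _ 4)) qs) h.
have s4 : s%:R ^+ 2 * q s <= (2 ^+ K * y%:R) ^+ 2 * q s.
  rewrite ler_wpM2r // lerXn2r ?nnegrE ?mulr_ge0 ?exprn_ge0 ?ler0n //.
  by rewrite -natrX -natrM ler_nat.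
have {}h := le_trans h s4.
have e : (2 ^+ K * y%:R) ^+ 2 = 4 ^+ K * y%:R ^+ 2 :> R.
  by rewrite exprMn -exprM mulnC exprM expr2 -natrM.
rewrite e in h; rewrite exprS ler_pdivrMr; last by rewrite mulr_gt0 ?exprn_gt0.
rewrite -(ler_pM2l (exprn_gt0 2 y0)).
have k0 : 0 < 4 ^+ K :> R by rewrite exprn_gt0.
move: (4 ^+ K) k0 h => k k0 h; lra.
Qed.

(** The range of the pointwise bound grows by [y] at each step, with the loss of a factor [4^(K+1)];
    [2^K] steps reach every admissible [s], and the total loss depends on [K] alone. *)
Lemma Zavoid_range K (A : R) s : (2 * y <= s <= 2 ^ K * y)%N -> 0 <= A ->
  A <= \sum_(0 <= t < y.+1) q t ->
  A / (64 * y%:R) / (4 ^+ K.+1) ^+ (2 ^ K) <= q s.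
Proof.
move=> /andP[ys sK] A0 Aq; have y0 : 0 < y%:R :> R by rewrite ltr0n; lia.
have D0 : 0 <= A / (64 * y%:R) by rewrite divr_ge0 // mulr_ge0.
have K0 : 1 <= 4 ^+ K.+1 :> R by rewrite exprn_ege1 // ler1n.
suff h i t : (2 * y <= t <= 4 * y + i * y)%N -> (t <= 2 ^ K * y)%N ->
    A / (64 * y%:R) / (4 ^+ K.+1) ^+ i <= q t.
  by apply: h => //; rewrite ys; lia.
elim: i t => [|i IH] t /andP[yt ti] tK.
  by rewrite expr0 divr1; apply: Zavoid_base => //; lia.
have [ti'|ti'] := leqP t (4 * y + i * y).
  apply: le_trans (IH t _ tK); last by lia.
  rewrite ler_wpM2l // lef_pV2 ?posrE ?exprn_gt0 ?(lt_le_trans ltr01 K0) //.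
  by rewrite ler_weXn2l.
have e (u v : R) : u / v ^+ i.+1 = u / v ^+ i / v by rewrite exprSr invfM mulrA.
rewrite e; apply: (@Zavoid_extend K (4 * y + i * y)) => //; try lia.
  by rewrite mulr_ge0 // invr_ge0 exprn_ge0 // (le_trans ler01 K0).
by move=> u yu; apply: IH; lia.
Qed.

End Sparse.

Lemma quarter_arith s N x : (32 * N <= s)%N -> (0 < N)%N ->
  (s %/ N <= x <= s)%N ->
  [/\ (4 <= x %/ 4)%N, (4 * (x %/ 4) <= x)%N, (x <= 5 * (x %/ 4))%N,
      (2 * (x %/ 4) <= s)%N & (s <= N * 16 * (x %/ 4))%N].
Proof.
move=> sN N0 /andP[mx xs].
have m32 : (32 <= s %/ N)%N by rewrite leq_divRL.
have sm : (s < (s %/ N).+1 * N)%N by rewrite ltn_ceil.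
move: (s %/ N)%N m32 sm mx => m m32 sm mx; split; try lia.
apply: (leq_trans (ltnW sm)); rewrite mulnC -mulnA leq_mul2l.
by apply/orP; right; clear -m32 mx; lia.
Qed.

Lemma uphalf_arith y : (4 <= y)%N ->
  [/\ (0 < uphalf y)%N, (uphalf y <= y)%N, (y <= 2 * uphalf y)%N &
      (y <= 2 * (y.+1 - uphalf y))%N].
Proof. by move=> y4; split; lia. Qed.

(** Both constants depend on [C] and [theta] only, not on [J]. A scale [y] comparable with [s] at
    which [J] is sparse is found first; the average bound up to [y] is then spread to [s]. *)
Lemma Ew_avoid_lower (C : R) : exists (d : R) (s0 : nat), 0 < d /\
  forall (J : pred nat) s, (s0 <= s)%N ->
    \sum_(1 <= j < s.+1) (J j)%:R / j%:R <= C ->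
    d <= Ew theta s (fun t => (count J t == 0)%:R).
Proof.
pose k := (Num.trunc (40 * C)).+1; pose K := (k + 4)%N.
pose B : R := expR (theta * C); have B0 : 0 < B by apply: expR_gt0.
pose P : R := powR (2 ^+ K.+1) (theta - 1).
have P0 : 0 < P by apply: powR_gt0; rewrite exprn_gt0.
have Q0 : 0 < (4 ^+ K.+1) ^+ (2 ^ K) :> R by rewrite !exprn_gt0.
exists ((2 * B * P * 64 * (4 ^+ K.+1) ^+ (2 ^ K))^-1), (32 * 2 ^ k)%N; split.
  by rewrite invr_gt0 !mulr_gt0.
move=> J s s0 JC; have k0 : (0 < 2 ^ k)%N by rewrite expn_gt0.
have m0 : (0 < s %/ 2 ^ k)%N by rewrite divn_gt0 // (leq_trans _ s0) // leq_pmull.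
have ms : (s %/ 2 ^ k * 2 ^ k <= s)%N by rewrite leq_trunc_div.
have kC : 40 * C < k%:R by rewrite /k; apply: truncnS_gt.
have [x /andP[mx xs] Jx] := sparse_scale m0 ms JC kC.
have [|y4 yx xy ys sK] := @quarter_arith s (2 ^ k) x s0 k0; first by rewrite mx xs.
move: (x %/ 4)%N y4 yx xy ys sK => y y4 yx xy ys sK.
have {}sK : (s <= 2 ^ K * y)%N by rewrite /K expnD.
have Jy : \sum_(1 <= j < (4 * y).+1) (J j)%:R <= (y%:R / 4 : R).
  apply: le_trans (_ : x%:R / 20 <= _).
    apply: le_trans Jx; rewrite [leRHS](@big_cat_nat _ _ _ (4 * y).+1) //=.
    by rewrite lerDl; apply: sumr_ge0.
  have : x%:R <= (5 * y)%:R :> R by rewrite ler_nat.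
  by rewrite natrM; lra.
have ysl : (y <= s)%N by apply: leq_trans ys; rewrite leq_pmull.
have y0 : 0 < y%:R :> R by rewrite ltr0n (leq_trans _ y4).
have Jy' : \sum_(1 <= j < y.+1) (J j)%:R / j%:R <= C.
  apply: le_trans JC; rewrite [leRHS](@big_cat_nat _ _ _ y.+1) //=.
  by rewrite lerDl; apply: sumr_ge0 => j _; rewrite divr_ge0.
have hq := sum_Zc_le_avoid theta1 Jy'.
(* At least half of the sizes up to [y] are at least [y / 2], and there [c] is at least [c s / P],
   since [s] exceeds [y / 2] by a factor of at most [2^(K+1)]. *)
have cs : c s * (y%:R / (2 * P)) <= \sum_(0 <= t < y.+1) c t.
  have [h0 hy yh yh'] := uphalf_arith y4; set h := uphalf y in h0 hy yh yh'.
  have cP : c s <= P * c h.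
    apply: le_trans (Zc_powR_ratio theta1 h0 (leq_trans hy ysl)) _.
    rewrite ler_wpM2r ?(ltW (c0 _)) //; apply: ge0_ler_powR;
      rewrite ?nnegrE ?subr_ge0 ?divr_ge0 ?exprn_ge0 //.
    rewrite ler_pdivrMr ?ltr0n // -natrX -natrM ler_nat expnS.
    by apply: (leq_trans sK); rewrite [(2 * _)%N]mulnC -mulnA leq_mul2l yh orbT.
  apply: le_trans (_ : c h * (y%:R / 2) <= _).
    rewrite (_ : c s * _ = c s / P * (y%:R / 2)); last by field; rewrite gt_eqF.
    by rewrite ler_wpM2r ?divr_ge0 ?(ltW y0) // ler_pdivrMr // mulrC.
  rewrite (@big_cat_nat _ _ _ h) //=; last by rewrite leqW.
  apply: ler_wpDl; first by apply: sumr_ge0 => t _; apply/ltW.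
  apply: le_trans (_ : \sum_(h <= t < y.+1) c h <= _); last first.
    by rewrite !big_nat; apply: ler_sum => t /andP[ht _]; apply: Zc_mono.
  rewrite sumr_const_nat -[leRHS]mulr_natr ler_wpM2l ?(ltW (c0 _)) // ler_pdivrMr //.
  by rewrite -natrM ler_nat mulnC.
have A0 : 0 <= c s * (y%:R / (2 * P)) / B.
  by rewrite !mulr_ge0 ?invr_ge0 ?(ltW B0) ?(ltW (c0 s)) ?mulr_ge0 ?(ltW P0) ?(ltW y0).
have := @Zavoid_range J y y4 Jy K _ s _ A0 _.
move=> /(_ _ _) h; rewrite /Ew ler_pdivlMr //.
apply: le_trans (h _ _); first 1 last.
- by rewrite ys sK.
- by rewrite ler_pdivrMr // [leRHS]mulrC (le_trans cs).
rewrite le_eqVlt; apply/orP; left; apply/eqP; field.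
by rewrite !gt_eqF.
Qed.

End SieveLower.

(** * Merging and splitting cycles *)

Section Moves.
Variables (R : realType) (theta : R).
Hypothesis theta1 : 1 <= theta.
Local Notation E := (Ew theta).
Local Notation psi := (psi theta).
Local Notation kmean := (kmean theta).

Let theta0 : 0 < theta. Proof. exact: lt_le_trans theta1. Qed.

Variables (n q : nat) (A B : pred nat) (G : rel nat) (e : R).
Hypothesis AP : forall i, A i -> (0 < i < q)%N.
Hypothesis BP : forall j, B j -> (q <= j)%N.
Hypothesis ABn : forall i j, A i -> B j -> (i + j <= n)%N.
Hypothesis GP : forall i j, G i j -> A i && B j.
Hypothesis e12 : 0 <= e <= 1 / 2.
Hypothesis psiA : forall i, A i -> 1 - e <= psi n i.
Hypothesis psiAB : forall i j, A i -> B j -> 1 - e <= psi n (i + j).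

(** [W] and [L] are the mean numbers of short and long cycles, [W1] the harmonic weight of the short
    lengths. [K s i j] is the joint mean of the counts for [i <> j] in size [s]; [M] is what the
    mean number of [G]-pairs would be if the counts were uncorrelated. *)
Let g i j : R := (G i j)%:R.
Let fA i : R := (A i)%:R.
Let fB j : R := (B j)%:R.
Let W := E n (cyc fA).
Let L := E n (cyc fB).
Let W1 : R := \sum_(1 <= i < n.+1) fA i / i%:R.
Let M := \sum_(1 <= i < n.+1) \sum_(1 <= j < n.+1) g i j * (kmean n i * kmean n j).
Let K s i j : R := (i + j <= s)%:R * (theta / i%:R * (theta / j%:R) * psi s (i + j)).

Lemma pairs_cons (f : nat -> nat -> R) i t :
  pairs f (i :: t) = f i i + cyc (f i) t + cyc (f^~ i) t + pairs f t.
Proof.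
rewrite /pairs /cyc !big_cons -[RHS]addrA; congr (_ + _).
by rewrite -big_split /=; apply: eq_bigr => j _; rewrite big_cons.
Qed.

Lemma le_cyc (f h : nat -> R) t : (forall i, f i <= h i) -> cyc f t <= cyc h t.
Proof. by move=> fh; apply: ler_sum. Qed.

Lemma cyc_ge0 (f : nat -> R) t : (forall i, 0 <= f i) -> 0 <= cyc f t.
Proof. by move=> f0; apply: sumr_ge0. Qed.

Lemma cyc_big_le t : is_comp n t -> (0 < q)%N ->
  cyc (fun j => (q <= j)%:R) t <= n%:R / q%:R :> R.
Proof.
move=> /andP[_ /eqP tn] q0; rewrite ler_pdivlMr ?ltr0n // mulrC -tn.
elim: t {tn} => [|c t IH]; first by rewrite /cyc big_nil mulr0.
rewrite cyc_cons mulrDr /= natrD; apply: lerD => //.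
by case: leqP => h; rewrite ?mulr1 ?mulr0 ?ler_nat.
Qed.

Let gii i : g i i = 0.
Proof.
rewrite /g; case: (boolP (G i i)) => // /GP /andP[/AP /andP[_ iq] /BP qi].
by move: (leq_ltn_trans qi iq); rewrite ltnn.
Qed.

Let gAB i j : g i j <= fA i * fB j.
Proof. by rewrite /g /fA /fB; case: (boolP (G i j)) => [/GP/andP[-> ->]|_]; rewrite ?mulr1 // mulr_ge0. Qed.

Lemma perm_invariant1 : perm_invariant (fun _ : seq nat => 1 : R).
Proof. by []. Qed.

Lemma Ew_pairs s :
  E s (pairs g) = \sum_(1 <= i < s.+1) \sum_(1 <= j < s.+1) g i j * K s i j.
Proof.
rewrite (eq_Ew (fun t => pairs g t * 1)); last by move=> t _; rewrite mulr1.
rewrite (Ew_palm2 theta1 s perm_invariant1 gii); apply: eq_bigr => i _.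
by apply: eq_bigr => j _; rewrite Ew_cst // mulr1.
Qed.

Lemma pair_kernel_le s i j : (s <= n)%N -> (0 < i)%N -> (0 < j)%N ->
  K s i j <= kmean n i * kmean n j.
Proof.
move=> sn i0 j0; rewrite /K; case: (leqP (i + j) s) => ijs; last first.
  by rewrite mul0r mulr_ge0 // kmean_ge0.
have ijn := leq_trans ijs sn.
have iN := leq_trans (leq_addr j i) ijn; have jN := leq_trans (leq_addl i j) ijn.
rewrite /@kmean iN jN !mul1r.
have ij0 : 0 <= theta / i%:R * (theta / j%:R) by rewrite mulr_ge0 // divr_ge0 // ltW.
apply: le_trans (ler_wpM2l ij0 (psi_mono theta1 ijs sn)) _.
apply: le_trans (ler_wpM2l ij0 (psi_submul theta1 ijn)) _.
by rewrite le_eqVlt; apply/orP; left; apply/eqP; ring.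
Qed.

Lemma Ew_pairs_le s : (s <= n)%N -> E s (pairs g) <= M.
Proof.
move=> sn; have g0 i j : 0 <= g i j * (kmean n i * kmean n j).
  by rewrite mulr_ge0 // mulr_ge0 // kmean_ge0.
rewrite Ew_pairs; apply: le_trans (_ : \sum_(1 <= i < s.+1) \sum_(1 <= j < s.+1)
   g i j * (kmean n i * kmean n j) <= _).
  rewrite !big_nat; apply: ler_sum => i /andP[i1 _].
  rewrite !big_nat; apply: ler_sum => j /andP[j1 _].
  by rewrite ler_wpM2l // pair_kernel_le.
rewrite /M [leRHS](@big_cat_nat _ _ _ s.+1) //=.
apply: ler_wpDr; first by apply: sumr_ge0 => i _; apply: sumr_ge0.
apply: ler_sum => i _; rewrite [leRHS](@big_cat_nat _ _ _ s.+1) //=.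
by rewrite lerDl; apply: sumr_ge0.
Qed.

Lemma Ew_pairs_ge : (1 - e) * M <= E n (pairs g).
Proof.
rewrite Ew_pairs mulr_sumr; apply: ler_sum => i _; rewrite mulr_sumr.
apply: ler_sum => j _; rewrite mulrCA /g; case: (boolP (G i j)) => [/GP/andP[Ai Bj]|_]; last by rewrite !mul0r.
rewrite !mul1r /K (ABn Ai Bj) mul1r mulrC.
apply: le_trans (_ : theta / i%:R * (theta / j%:R) * (1 - e) <= _); last first.
  by rewrite ler_wpM2l ?psiAB // mulr_ge0 // divr_ge0 // ltW.
rewrite ler_wpM2r //; first by case/andP: e12 => h1 h2; lra.
by apply: ler_pM; rewrite ?kmean_ge0 ?kmean_le.
Qed.

(** With a pair [(i, j)] marked, a second pair avoids both cycles ([M]), uses [i] and another long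
    cycle ([L]), uses [j] and another short one ([W]), or is the same pair ([1]). Short and long
    lengths are disjoint, so no other case arises. *)
Lemma Ew_pairs_sqr : E n (fun t => pairs g t ^+ 2) <= M * (M + L + W + 1).
Proof.
have A0 i : 0 <= fA i by [].
have B0 i : 0 <= fB i by [].
rewrite (eq_Ew (fun t => pairs g t * pairs g t)) //.
have [N NE] : {N | N = M + L + W + 1} by exists (M + L + W + 1).
rewrite -NE (Ew_palm2 theta1 n (@perm_invariant_pairs _ g) gii) /M mulr_suml !big_nat.
apply: ler_sum => i /andP[i1 _]; rewrite mulr_suml !big_nat; apply: ler_sum => j /andP[j1 _].
rewrite -[leRHS]mulrA; case: (boolP (G i j)) => [Gij|nG]; last first.
  by rewrite (_ : g i j = 0) ?mul0r // /g (negbTE nG).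
have g1 : g i j = 1 by rewrite /g Gij.
rewrite g1 !mul1r.
have Kij : 0 <= K n i j.
  by rewrite /K mulr_ge0 // mulr_ge0 ?psi_ge0 // mulr_ge0 // divr_ge0 // ltW.
have := pair_kernel_le (leqnn n) i1 j1; rewrite /K => Kle.
have /andP[Ai Bj] := GP Gij; have /andP[_ iq] := AP Ai; have qj := BP Bj.
have Bi : B i = false by apply/negP => /BP; rewrite leqNgt iq.
have Aj : A j = false by apply/negP => /AP/andP[_]; rewrite ltnNge qj.
have sn : (n - (i + j) <= n)%N by rewrite leq_subr.
apply: ler_pM => //.
  by apply: Ew_ge0 => // t _; do 2![apply: sumr_ge0 => ? _].
apply: le_trans (_ : E (n - (i + j)) (fun t => pairs g t + cyc fB t + cyc fA t + 1) <= _).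
  apply: le_Ew => // t _; rewrite !pairs_cons !cyc_cons !gii.
  have gBi : g^~ i =1 (fun=> 0).
    by move=> d; apply/eqP; rewrite eq_le ler0n andbT (le_trans (gAB _ _)) // /fB Bi mulr0.
  have gAj : g j =1 (fun=> 0).
    by move=> d; apply/eqP; rewrite eq_le ler0n andbT (le_trans (gAB _ _)) // /fA Aj mul0r.
  have cz f : f =1 (fun=> 0) -> cyc f t = 0 :> R.
    by move=> fz; rewrite /cyc big1 // => d _; rewrite fz.
  rewrite (cz _ gBi) (cz _ gAj) (gBi j).
  have h1 : cyc (g i) t <= cyc fB t.
    by apply: le_cyc => d; apply: le_trans (gAB _ _) _; rewrite ler_piMl // /fA lern1 leq_b1.
  have h2 : cyc (g^~ j) t <= cyc fA t.
    by apply: le_cyc => d; apply: le_trans (gAB _ _) _; rewrite ler_piMr // /fB lern1 leq_b1.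
  have h3 : g i j <= 1 by rewrite /g lern1 leq_b1.
  lra.
rewrite NE !EwD Ew_cst // lerD2r.
by do 2?[apply: lerD]; [exact: Ew_pairs_le|exact: (Ew_cyc_mono theta1)..].
Qed.

Lemma W1_le_W : theta * W1 <= 2 * W.
Proof.
rewrite /W Ew_cyc // /W1 !mulr_sumr !big_nat; apply: ler_sum => i /andP[i1 i2].
rewrite /fA; case: (boolP (A i)) => [Ai|_]; last by rewrite mul0r !mulr0.
rewrite mulr1 /@kmean -ltnS i2 mul1r mul1r mulrCA ler_peMr //.
  by rewrite divr_ge0 // ltW.
by case/andP: e12 => h1 h2; have := psiA Ai; lra.
Qed.

Lemma W_le_W1 : W <= theta * W1.
Proof.
rewrite /W Ew_cyc // /W1 !mulr_sumr; apply: ler_sum => i _.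
by rewrite [fA i / _]mulrC mulrA ler_wpM2r // kmean_le.
Qed.

Variables (I low : seq nat -> bool) (p0 l0 : R).
Hypothesis Isym : perm_invariant I.
Hypothesis lsym : perm_invariant low.
Hypothesis q0 : (0 < q)%N.
Hypothesis p0E : p0 <= E n (fun t => (I t)%:R).
Hypothesis l0E : E n (fun t => (low t)%:R) <= l0.

Let Isym' : perm_invariant (fun t => (I t)%:R : R).
Proof. by move=> s t /Isym ->. Qed.
Let lsym' : perm_invariant (fun t => (low t)%:R : R).
Proof. by move=> s t /lsym ->. Qed.
Let I01 t : (I t)%:R = 0 :> R \/ (I t)%:R = 1 :> R.
Proof. by case: (I t); [right|left]. Qed.

(** Replacing cycles [i], [j] by one of length [i + j] changes the weight [theta^2 / (i j)] to
    [theta / (i + j)], and [1/j <= 2/(i + j)] because [i < q <= j]. The sum over [i] gives [W1], and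
    at most [n/q] cycles are long enough to be a merged one. *)
Lemma merge_move :
  (forall i j t, G i j -> I [:: i, j & t] -> low ((i + j)%N :: t)) ->
  E n (fun t => pairs g t * (I t)%:R) <= 4 * W * (n%:R / q%:R * l0).
Proof.
move=> mv; pose f u : R := (q <= u)%:R.
pose el u : R := E (n - u) (fun t => (low (u :: t))%:R).
have el0 u : 0 <= el u by apply: Ew_ge0.
have W10 : 0 <= W1 by apply: sumr_ge0 => i _; rewrite divr_ge0.
rewrite (Ew_palm2 theta1 n Isym' gii).
apply: le_trans (_ : \sum_(1 <= i < n.+1) \sum_(1 <= j < n.+1) (i + j <= n)%:R *
   (2 * theta * (fA i / i%:R) * (kmean n (i + j) * f (i + j)%N * el (i + j)%N)) <= _).
  rewrite !big_nat; apply: ler_sum => i /andP[i1 _].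
  rewrite !big_nat; apply: ler_sum => j /andP[j1 _].
  rewrite /g; case: (boolP (G i j)) => [Gij|_]; last first.
    rewrite mul0r mulr_ge0 // mulr_ge0 //.
      by rewrite mulr_ge0 ?divr_ge0 // mulr_ge0 // ltW.
    by rewrite mulr_ge0 // mulr_ge0 // kmean_ge0.
  have /andP[Ai Bj] := GP Gij; have /andP[_ iq] := AP Ai; have qj := BP Bj.
  rewrite mul1r (ABn Ai Bj) !mul1r /@kmean (ABn Ai Bj) mul1r /fA Ai mul1r /f.
  rewrite (leq_trans qj (leq_addl _ _)) mulr1.
  rewrite [leRHS](_ : _ = theta / i%:R * (theta * (2 / (i + j)%:R)) * psi n (i + j) *
    el (i + j)%N); last by ring.
  have ti k : 0 <= theta / k%:R by rewrite divr_ge0 // ltW.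
  apply: ler_pM.
  - by apply: mulr_ge0; [exact: mulr_ge0|exact: psi_ge0].
  - exact: Ew_ge0.
  - apply: ler_wpM2r; first exact: psi_ge0.
    apply: ler_wpM2l => //; apply: ler_wpM2l; first exact: ltW.
    have ij2 : (i + j <= 2 * j)%N by rewrite mul2n -addnn leq_add2r (leq_trans (ltnW iq) qj).
    by rewrite ler_pdivlMr ?ltr0n ?addn_gt0 ?i1 // mulrC ler_pdivrMr ?ltr0n // -natrM ler_nat.
  - apply: le_Ew => // t _; case: (boolP (I _)) => // It.
    by rewrite (mv _ _ _ Gij It).
rewrite (sum_pairs_by_sum n (fun i u => 2 * theta * (fA i / i%:R) * (kmean n u * f u * el u))).
apply: le_trans (_ : 2 * theta * W1 * E n (fun t => cyc f t * (low t)%:R) <= _).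
  rewrite (eq_Ew (fun t => \sum_(u <- t) f u * (low t)%:R)); last first.
    by move=> t _; rewrite -mulr_suml.
  rewrite Ew_palm //; last by move=> u s t st; rewrite (lsym st).
  rewrite (@sum_kmean_trunc _ _ n n) // mulr_sumr !big_nat; apply: ler_sum => u /andP[u1 un].
  rewrite EwZ -/(el u).
  rewrite [leRHS](_ : _ = 2 * theta * W1 * (kmean n u * f u * el u)); last by ring.
  rewrite -[leLHS]mulr_suml -mulr_sumr; apply: ler_wpM2r.
    by apply: mulr_ge0 => //; apply: mulr_ge0 => //; apply: kmean_ge0.
  apply: ler_wpM2l; first by rewrite mulr_ge0 // ltW.
  rewrite /W1 [leRHS](@big_cat_nat _ _ _ u) //=; last exact: ltnW.
  by rewrite lerDl; apply: sumr_ge0 => i _; rewrite divr_ge0.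
have lE0 : 0 <= E n (fun t => (low t)%:R) by apply: Ew_ge0.
have fl : E n (fun t => cyc f t * (low t)%:R) <= n%:R / q%:R * l0.
  apply: le_trans (ler_wpM2l _ l0E); last by rewrite divr_ge0.
  rewrite -EwZ; apply: le_Ew => // t tn; rewrite ler_wpM2r //.
  exact: cyc_big_le.
have e0 : 0 <= E n (fun t => cyc f t * (low t)%:R).
  by apply: Ew_ge0 => // t _; rewrite mulr_ge0 // cyc_ge0.
apply: ler_pM => //.
  by apply: mulr_ge0 => //; apply: mulr_ge0 => //; apply: ltW.
have := W1_le_W; lra.
Qed.

(** By Chebyshev the event [I] carries about [M p0 / 4] pairs up to terms linear in [W] and [L],
    while merging allows at most [W] of them. As [M >= kappa W L] with [L] large, [W] cannot be
    large. *)
Lemma merge_bound (kappa : R) : 0 < kappa -> 0 < p0 -> 16 * e <= p0 ->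
  kappa * W * L <= M -> 1 <= L -> 32 <= kappa * p0 * L -> n%:R / q%:R * l0 <= 1 / 4 ->
  (forall i j t, G i j -> I [:: i, j & t] -> low ((i + j)%N :: t)) ->
  kappa * p0 * W <= 32.
Proof.
move=> k0 pp ep WLM L1 L32 ql mv; rewrite leNgt; apply/negP => W32.
have mb := merge_move mv.
have W0 : 0 < W.
  rewrite ltNge; apply/negP => Wn; move: W32; rewrite ltNge => /negP; apply.
  by apply: le_trans (_ : 0 <= _) => //; rewrite mulr_ge0_le0 // mulr_ge0 // ltW.
have L0 : 0 < L by lra.
have M0 : 0 < M by apply: lt_le_trans WLM; apply: mulr_gt0 => //; apply: mulr_gt0.
have pos : forall t, is_comp n t -> 0 <= pairs g t.
  by move=> t _; do 2![apply: sumr_ge0 => ? _].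
have := Ew_cheb theta1 M0 pos I01; set V1 := E n (pairs g).
have := Ew_pairs_ge; have := Ew_pairs_sqr; rewrite -/V1.
set V2 := E n (fun t => pairs g t ^+ 2) => h2 h1 h.
have {}h := le_trans h mb.
have V2e : V2 - 2 * M * V1 + M ^+ 2 <= M * (2 * e * M + (L + W + 1)).
  have : 2 * M * ((1 - e) * M) <= 2 * M * V1 by rewrite ler_pM2l // mulr_gt0.
  rewrite expr2; lra.
have h3 : 2 / M * (V2 - 2 * M * V1 + M ^+ 2) <= 2 * (2 * e * M + (L + W + 1)).
  by rewrite -mulrA ler_pM2l // ler_pdivrMl.
have h4 : M / 2 * p0 <= M / 2 * E n (fun t => (I t)%:R).
  by rewrite ler_pM2l // divr_gt0.
have h5 : M * p0 / 4 - 2 * (L + W + 1) <= 4 * W * (n%:R / q%:R * l0).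
  have : M * (16 * e) <= M * p0 by rewrite ler_pM2l.
  lra.
have h6 : 4 * W * (n%:R / q%:R * l0) <= W.
  rewrite [leLHS](_ : _ = W * (4 * (n%:R / q%:R * l0))); last by ring.
  rewrite ger_pMr //; lra.
have h7 : kappa * W * L * p0 <= M * p0 by rewrite ler_pM2r.
have h8 : 32 * W <= kappa * W * L * p0.
  by rewrite [leRHS](_ : _ = kappa * p0 * L * W) ?ler_pM2r //; ring.
have h9 : 32 * L < kappa * W * L * p0.
  by rewrite [ltRHS](_ : _ = kappa * p0 * W * L) ?ltr_pM2r //; ring.
have h10 : 1 <= L \/ L < 1 by case: (leP 1 L); [left|right].
lra.
Qed.

(** The ways of splitting a cycle of length [u]. The weight [1/i] keeps the weight [theta / (i + j)]
    of the whole cycle, divided by [i], below that of the two pieces. *)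
Let F u : R := \sum_(1 <= i < u) g i (u - i) / i%:R.

Lemma split_weight : E n (cyc F) =
  \sum_(1 <= i < n.+1) \sum_(1 <= j < n.+1) g i j / i%:R * kmean n (i + j).
Proof.
rewrite Ew_cyc // (eq_bigr (fun u => \sum_(1 <= i < u) g i (u - i) / i%:R * kmean n u)).
  rewrite -(sum_pairs_by_sum n (fun i u => g i (u - i)%N / i%:R * kmean n u)).
  apply: eq_bigr => i _; apply: eq_bigr => j _; rewrite addKn /g.
  case: (boolP (G i j)) => [/GP/andP[Ai Bj]|_]; last by rewrite !mul0r mulr0.
  by rewrite (ABn Ai Bj) mul1r.
by move=> u _; rewrite mulrC mulr_suml.
Qed.

Lemma split_move :
  (forall i j t, G i j -> I ((i + j)%N :: t) -> low [:: i, j & t]) ->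
  E n (fun t => cyc F t * (I t)%:R) <= E n (fun t => pairs g t * (low t)%:R).
Proof.
move=> mv; pose el u : R := E (n - u) (fun t => (I (u :: t))%:R).
rewrite (eq_Ew (fun t => \sum_(u <- t) F u * (I t)%:R)); last first.
  by move=> t _; rewrite -mulr_suml.
rewrite Ew_palm //; last by move=> u s t st; rewrite (Isym st).
rewrite (@sum_kmean_trunc _ _ n n) //.
rewrite (eq_bigr (fun u => \sum_(1 <= i < u) g i (u - i) / i%:R * (kmean n u * el u))); last first.
  by move=> u _; rewrite EwZ -/(el u) /F -!mulr_suml; ring.
rewrite -(sum_pairs_by_sum n (fun i u => g i (u - i)%N / i%:R * (kmean n u * el u))).
rewrite (Ew_palm2 theta1 n lsym' gii) !big_nat; apply: ler_sum => i /andP[i1 _].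
rewrite !big_nat; apply: ler_sum => j /andP[j1 _]; rewrite addKn /g.
case: (boolP (G i j)) => [Gij|_]; last by rewrite !mul0r mulr0.
have /andP[Ai Bj] := GP Gij.
rewrite /@kmean (ABn Ai Bj) !mul1r /el.
have ti k : 0 <= theta / k%:R by rewrite divr_ge0 // ltW.
rewrite [leLHS](_ : _ = i%:R^-1 * (theta / (i + j)%:R) * psi n (i + j) *
  E (n - (i + j)) (fun t => (I ((i + j)%N :: t))%:R)); last by ring.
apply: ler_pM.
- by apply: mulr_ge0; [apply: mulr_ge0|exact: psi_ge0].
- exact: Ew_ge0.
- apply: ler_wpM2r; first exact: psi_ge0.
  apply: ler_pM => //; first by rewrite ler_peMl.
  apply: ler_wpM2l; first exact: ltW.
  by rewrite lef_pV2 ?posrE ?ltr0n ?addn_gt0 ?j1 ?orbT // ler_nat leq_addl.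
- apply: le_Ew => // t _; case: (boolP (I _)) => // It.
  by rewrite (mv _ _ _ Gij It).
Qed.

(** At most [n/q] cycles are long. The inequality [2 x y <= ga x^2 + y^2 / ga] then separates the
    number of short cycles from the rare event, about whose dependence nothing is known. *)
Lemma pairs_low_le (ga : R) : 0 < ga ->
  E n (fun t => pairs g t * (low t)%:R) <=
  n%:R / q%:R / 2 * (ga * (W * (W + 1)) + l0 / ga).
Proof.
move=> ga0; pose f u : R := (q <= u)%:R.
have gi0 : 0 < ga^-1 by rewrite invr_gt0.
have nq : 0 <= n%:R / q%:R / 2 :> R by rewrite !divr_ge0.
apply: le_trans (_ : n%:R / q%:R / 2 *
   (ga * E n (fun t => cyc fA t ^+ 2) + ga^-1 * E n (fun t => (low t)%:R)) <= _); last first.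
  apply: ler_wpM2l => //; apply: lerD; last by rewrite [leRHS]mulrC ler_pM2l.
  rewrite ler_pM2l //; apply: Ew_cyc_sqr => // j _; by rewrite /fA lern1 leq_b1.
rewrite -!EwZ -EwD -EwZ; apply: le_Ew => // t tn.
have A0 : 0 <= cyc fA t by apply: cyc_ge0.
apply: le_trans (_ : cyc fA t * (n%:R / q%:R) * (low t)%:R <= _).
  rewrite ler_wpM2r //; apply: le_trans (_ : cyc fA t * cyc f t <= _).
    rewrite /pairs /cyc mulr_suml; apply: ler_sum => i _; rewrite mulr_sumr.
    apply: ler_sum => j _; apply: le_trans (gAB _ _) _; apply: ler_wpM2l => //.
    by rewrite /fB /f; case: (boolP (B j)) => // /BP ->.
  by rewrite ler_wpM2l // cyc_big_le.
rewrite [leLHS](_ : _ = n%:R / q%:R / 2 * (2 * (cyc fA t * (low t)%:R))); last by field; rewrite pnatr_eq0 -lt0n.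
apply: ler_wpM2l => //.
have gg : ga * ga^-1 = 1 by rewrite divff // gt_eqF.
have sq : 0 <= ga * (cyc fA t - ga^-1 * (low t)%:R) ^+ 2 by rewrite mulr_ge0 ?sqr_ge0 // ltW.
rewrite -subr_ge0; apply: le_trans sq _; rewrite le_eqVlt; apply/orP; left; apply/eqP.
by case: (low t) => /=; field; rewrite gt_eqF.
Qed.

Lemma split_bound (kappa : R) : (0 < n)%N -> 0 < kappa -> 0 < p0 ->
  kappa * W1 * L <= E n (cyc F) -> 0 < L -> 6 <= kappa * p0 * L ->
  (n%:R / q%:R * theta) ^+ 2 * l0 <= 1 / 2 ->
  (forall i j t, G i j -> I ((i + j)%N :: t) -> low [:: i, j & t]) ->
  W1 <= 1.
Proof.
move=> n0 k0 pp WLM L0 L6 ql mv; rewrite leNgt; apply/negP => W11.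
have W0 : 0 <= W by apply: Ew_ge0 => // t _; apply: cyc_ge0.
set M' := E n (cyc F) in WLM *.
have W10 : 0 < W1 by lra.
have M0 : 0 < M' by apply: lt_le_trans WLM; apply: mulr_gt0 => //; apply: mulr_gt0.
have F0 u : 0 <= F u by apply: sumr_ge0 => i _; rewrite divr_ge0.
have pos : forall t, is_comp n t -> 0 <= cyc F t by move=> t _; apply: cyc_ge0.
have FW u : (1 <= u <= n)%N -> F u <= W1.
  move=> /andP[u1 un]; rewrite /W1 [leRHS](@big_cat_nat _ _ _ u) //=; last exact: leqW.
  apply: ler_wpDr; first by apply: sumr_ge0 => i _; rewrite divr_ge0.
  apply: ler_sum => i _; rewrite ler_wpM2r ?invr_ge0 // (le_trans (gAB _ _)) //.
  by rewrite ler_piMr // /fB lern1 leq_b1.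
have V2 := Ew_cyc_sqr theta1 F0 FW; rewrite -/M' in V2.
have := Ew_cheb theta1 M0 pos I01; rewrite -/M'.
set V := E n (fun t => cyc F t ^+ 2) in V2 *.
have nq0 : 0 < n%:R / q%:R :> R by rewrite divr_gt0 // ltr0n.
(* This value of [ga] makes the first term [W / (2 theta)], at most [W1 / 2]; the second term is
   left to the smallness of [l0]. *)
have ga0 : 0 < (n%:R / q%:R * theta * (W + 1))^-1.
  by rewrite invr_gt0; apply: mulr_gt0; [apply: mulr_gt0|lra].
move=> h; have {}h := le_trans h (le_trans (split_move mv) (pairs_low_le ga0)).
have h3 : 2 / M' * (V - 2 * M' * M' + M' ^+ 2) <= 2 * W1.
  rewrite -mulrA ler_pM2l // ler_pdivrMl // expr2; lra.
have h4 : M' / 2 * p0 <= M' / 2 * E n (fun t => (I t)%:R).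
  by rewrite ler_pM2l // divr_gt0.
have h5 : kappa * W1 * L * p0 <= M' * p0 by rewrite ler_pM2r.
have h6 : 6 * W1 <= kappa * W1 * L * p0.
  by rewrite [leRHS](_ : _ = kappa * p0 * L * W1) ?ler_pM2r //; ring.
have h7 : n%:R / q%:R / 2 * ((n%:R / q%:R * theta * (W + 1))^-1 * (W * (W + 1)) +
     l0 / (n%:R / q%:R * theta * (W + 1))^-1) =
     W / theta / 2 + (n%:R / q%:R * theta) ^+ 2 * l0 * ((W + 1) / theta) / 2.
  move: (n%:R / q%:R) nq0 => x x0; have Wp : W + 1 != 0 by rewrite gt_eqF //; lra.
  by field; rewrite Wp !gt_eqF.
rewrite h7 in h.
have h8 : W / theta <= W1 by rewrite ler_pdivrMr // mulrC W_le_W1.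
have h9 : (W + 1) / theta <= W1 + 1.
  by rewrite mulrDl lerD // ler_pdivrMr // mul1r.
have h10 : (n%:R / q%:R * theta) ^+ 2 * l0 * ((W + 1) / theta) <= 1 / 2 * (W1 + 1).
  apply: le_trans (_ : 1 / 2 * ((W + 1) / theta) <= _).
    by rewrite ler_wpM2r // divr_ge0 ?(ltW theta0) //; lra.
  apply: ler_wpM2l h9; lra.
lra.
Qed.

End Moves.

(** The mean number of cycles with length in the window [[q, q * 2^k)] and satisfying [P]. It is the
    measure in which most [j] is meant below. *)
Definition refmass (R : realType) (theta : R) (n q k : nat) (P : pred nat) : R :=
  \sum_(1 <= j < n.+1) kmean theta n j * ((q <= j < q * 2 ^ k)%N && P j)%:R.

(** * Additivity on most pairs of lengths *)

Section AdditiveMost.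
Variables (R : realType) (theta : R).
Hypothesis theta1 : 1 <= theta.
Local Notation E := (Ew theta).
Local Notation psi := (psi theta).
Local Notation kmean := (kmean theta).
Local Notation refmass := (refmass theta).

Let theta0 : 0 < theta. Proof. exact: lt_le_trans theta1. Qed.

Lemma nat_ge (x : R) : exists N : nat, (0 < N)%N /\ x <= N%:R.
Proof. by exists (Num.trunc x).+1; split=> //; apply/ltW/truncnS_gt. Qed.

Lemma psi_near1 (e : R) : 0 < e < 1 -> exists2 y : R, 0 < y <= 1 & forall n m : nat,
  (m < n)%N -> m%:R <= y * n%:R -> 1 - e <= psi n m.
Proof.
(* The root of order [theta], rather than [theta - 1], avoids a separate case [theta = 1]; it
   suffices because [(theta - 1)/theta <= 1]. *)
move=> /andP[e0 e1]; pose z := powR (1 - e) theta^-1.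
have a0 : 0 < 1 - e by lra.
have z0 : 0 < z by rewrite powR_gt0.
have z1 : z < 1.
  have e1' : 1 - e < 1 by lra.
  have := gt0_ltr_powR _ _ _ e1'; rewrite -/z powR1; apply;
    rewrite ?nnegrE ?invr_gt0 //; lra.
exists (1 - z) => [|n m mn mz]; first by apply/andP; split; lra.
apply: le_trans (psi_ge_frac theta1 mn (ltW z0) mz).
rewrite /z -powRrM -[leLHS](powRr1 (ltW a0)); apply: ger_powR; first lra.
by rewrite mulrC ler_pdivrMr // mul1r; lra.
Qed.

Lemma refmassU n q k (P P' P'' : pred nat) :
  (forall j, P j -> P' j || P'' j) ->
  refmass n q k P <= refmass n q k P' + refmass n q k P''.
Proof.
move=> PP; rewrite -big_split /=; apply: ler_sum => j _; rewrite -mulrDr.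
apply: ler_wpM2l; first exact: kmean_ge0.
rewrite -natrD ler_nat; case: (boolP (P j)) => [/PP|_]; last by rewrite andbF.
by case: (P' j); case: (P'' j); case: (q <= j < _)%N.
Qed.

Lemma refmass_ge n q k : (0 < q)%N -> (q * 2 ^ k <= n)%N ->
  (forall m, (m <= q * 2 ^ k)%N -> 1 / 2 <= psi n m) ->
  k%:R / 4 <= refmass n q k predT.
Proof.
move=> q0 qn hpsi; have hd := @harmonic_dyadic R q k q0.
apply: le_trans (_ : \sum_(q <= x < q * 2 ^ k) x.+1%:R^-1 / 2 <= _).
  by rewrite -mulr_suml; lra.
have qq : (q <= q * 2 ^ k)%N by rewrite leq_pmulr // expn_gt0.
rewrite /@refmass; move: (q * 2 ^ k)%N qn hpsi qq => N qn hpsi qq.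
rewrite [leRHS](@big_cat_nat _ _ _ q) //=; last by rewrite (leq_trans qq) // leqW.
have pos j : 0 <= kmean n j * ((q <= j < N)%N && true)%:R.
  by rewrite mulr_ge0 // kmean_ge0.
apply: ler_wpDl; first by apply: sumr_ge0.
rewrite [leRHS](@big_cat_nat _ _ _ N) //=; last exact: leqW.
apply: ler_wpDr; first by apply: sumr_ge0.
rewrite !big_nat; apply: ler_sum => j /andP[qj jN].
have j0 : (0 < j)%N by apply: leq_trans qj.
rewrite qj jN mulr1 /@kmean (leq_trans (ltnW jN) qn) mul1r.
have h1 := hpsi j (ltnW jN).
apply: le_trans (_ : j%:R^-1 * (1 / 2) <= _).
  by rewrite mul1r ler_wpM2r // lef_pV2 ?posrE ?ltr0n // ler_nat.
by apply: ler_pM; rewrite ?invr_ge0 ?divr_ge0 ?ler_peMl ?invr_ge0.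
Qed.

Lemma refmass_predT n q k :
  E n (cyc (fun j => ((q <= j < q * 2 ^ k)%N)%:R)) = refmass n q k predT.
Proof. by rewrite Ew_cyc //; apply: eq_bigr => j _; rewrite andbT. Qed.

Section OneSign.
Variables (n q k : nat) (b : nat -> int) (kappa : R) (sgn : rel int).
Let bad j i := sgn (b (i + j)%N) (b i + b j).
Let L := refmass n q k predT.
Let A i := (0 < i < q)%N && (kappa * L < refmass n q k (bad^~ i))%R.
Let B j := (q <= j < q * 2 ^ k)%N.
Let G i j := A i && B j && bad j i.

Lemma pair_weight_ge :
  kappa * E n (cyc (fun i => (A i)%:R)) * L <=
  \sum_(1 <= i < n.+1) \sum_(1 <= j < n.+1) (G i j)%:R * (kmean n i * kmean n j).
Proof.
rewrite Ew_cyc // mulrAC mulr_sumr; apply: ler_sum => i _.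
case: (boolP (A i)) => [Ai|nA]; last first.
  rewrite !mulr0; apply: sumr_ge0 => j _.
  by rewrite mulr_ge0 // mulr_ge0 // kmean_ge0.
have /andP[_ /ltW kL] := Ai.
rewrite mulr1 mulrC; apply: le_trans (ler_wpM2l (kmean_ge0 theta1 n i) kL) _.
rewrite mulr_sumr; apply: ler_sum => j _.
by rewrite le_eqVlt; apply/orP; left; apply/eqP; rewrite /G Ai /B /=; ring.
Qed.

(** The factor [1/4] pays for [1/(i + j) >= 1/(2 j)] and for [psi >= 1/2]. *)
Lemma split_weight_ge : (q * 2 ^ k + q <= n)%N ->
  (forall m, (m <= q * 2 ^ k + q)%N -> 1 / 2 <= psi n m) ->
  kappa / 4 * (\sum_(1 <= i < n.+1) (A i)%:R / i%:R) * L <=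
  \sum_(1 <= i < n.+1) \sum_(1 <= j < n.+1) (G i j)%:R / i%:R * kmean n (i + j).
Proof.
move=> qn hpsi; rewrite mulrAC mulr_sumr; apply: ler_sum => i _.
case: (boolP (A i)) => [Ai|nA]; last first.
  rewrite mul0r mulr0; apply: sumr_ge0 => j _.
  by rewrite mulr_ge0 // ?kmean_ge0 // divr_ge0.
have /andP[/andP[i0 iq] /ltW kL] := Ai.
rewrite mul1r [leLHS](_ : _ = i%:R^-1 / 4 * (kappa * L)); last by ring.
apply: le_trans (ler_wpM2l _ kL) _; first by rewrite divr_ge0.
rewrite mulr_sumr; apply: ler_sum => j _.
rewrite /G Ai /=; change ((q <= j < q * 2 ^ k)%N) with (B j).
case: (boolP (B j)) => [/andP[qj jq]|_] /=; last by rewrite !(mulr0, mul0r).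
rewrite [leLHS](_ : _ = (bad j i)%:R / i%:R * (kmean n j / 4)); last by ring.
apply: ler_wpM2l; first by rewrite divr_ge0.
have ijn : (i + j <= q * 2 ^ k + q)%N by rewrite addnC leq_add // ltnW.
have ij0 : 0 < (i + j)%:R :> R by rewrite ltr0n addn_gt0 i0.
have j0 : 0 < j%:R :> R by rewrite ltr0n (leq_trans _ qj) // (leq_ltn_trans _ iq).
have ij2 : (i + j <= 2 * j)%N by rewrite mul2n -addnn leq_add2r (leq_trans (ltnW iq) qj).
rewrite {2}/@kmean (leq_trans ijn qn) mul1r.
apply: le_trans (_ : theta / (i + j)%:R * (1 / 2) <= _); last first.
  by rewrite ler_wpM2l ?hpsi // divr_ge0 // ltW.
apply: le_trans (_ : theta / j%:R / 4 <= _).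
  by rewrite ler_pM2r // kmean_le.
rewrite [leLHS](_ : _ = theta * (j%:R^-1 / 4)); last by ring.
rewrite [leRHS](_ : _ = theta * ((i + j)%:R^-1 / 2)); last by ring.
apply: ler_wpM2l; first exact: ltW.
have : (2 * j%:R)^-1 <= (i + j)%:R^-1 :> R.
  by rewrite lef_pV2 ?posrE ?mulr_gt0 // -natrM ler_nat.
rewrite invfM; lra.
Qed.

End OneSign.

Lemma additive_most (p0 kappa : R) : 0 < p0 <= 1 -> 0 < kappa <= 1 ->
  exists (Q k : nat) (l0 C1 : R), [/\ (0 < Q)%N, 0 < l0 &
  forall n (b : nat -> int) (y0 : int), (Q <= n)%N ->
  p0 <= E n (fun t => (hsum b t == y0)%:R) ->
  E n (fun t => (hsum b t < y0)%R%:R) <= l0 ->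
  let q := (n %/ Q)%N in let rm := refmass n q k in
  [/\ (q * 2 ^ k + q <= n)%N,
      forall m, (m <= q * 2 ^ k + q)%N -> 1 / 2 <= psi n m,
      theta <= kappa * rm predT &
      \sum_(1 <= i < n.+1) ((0 < i < q)%N &&
          (kappa * rm predT < rm (fun j => b (i + j)%N != b i + b j))%R)%:R / i%:R
        <= C1]].
Proof.
move=> /andP[pp p1] /andP[k0 k1].
have kp0 : 0 < kappa * p0 by rewrite mulr_gt0.
have e01 : 0 < p0 / 16 < 1 by apply/andP; split; lra.
have [y /andP[y0 y1] hy] := psi_near1 e01.
(* The window mean is at least [k/4]. The first summand secures [theta <= kappa * L], the second the
   lower bound 32 for [kappa / 2 * p0 * L] in the merge argument. *)
have [k [_ kL]] := nat_ge (4 * (theta / kappa + 64 / (kappa * p0))).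
have [Q [Q0 QL]] := nat_ge (2 ^+ k.+2 / y).
have Qp : 0 < Q%:R :> R by rewrite ltr0n.
have Q1 : 1 <= Q%:R :> R by rewrite ler1n.
(* Since [n/q <= 2 Q], this [l0] gives [(n/q * theta)^2 * l0 <= 1/2], as splitting requires. In the
   last constant [128 / (kappa * p0)] comes from merges and 1 from splits. *)
exists Q, k, ((8 * (Q%:R * theta) ^+ 2)^-1), (128 / (kappa * p0) + 1); split=> //.
  by rewrite invr_gt0 mulr_gt0 // exprn_gt0 // mulr_gt0.
move=> n b y00 Qn pE lE q rm.
have q0 : (0 < q)%N by rewrite divn_gt0.
have qp : 0 < q%:R :> R by rewrite ltr0n.
have qQn : (q * Q <= n)%N by rewrite leq_trunc_div.
have nqQ : (n < q.+1 * Q)%N by rewrite ltn_ceil.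
have n0 : (0 < n)%N by apply: leq_trans Qn.
have small m : (m <= q * 2 ^ k + q)%N -> (m < n)%N /\ m%:R <= y * n%:R.
  move=> mq; have mr : m%:R <= q%:R * 2 ^+ k.+1 :> R.
    rewrite -natrX -natrM ler_nat; apply: leq_trans mq _.
    by rewrite expnS mul2n -addnn mulnDr leq_add2l leq_pmulr // expn_gt0.
  have yQ : q%:R * 2 ^+ k.+2 <= y * n%:R.
    apply: le_trans (_ : y * (q%:R * Q%:R) <= _).
      by rewrite [leRHS]mulrCA ler_pM2l // [leRHS]mulrC -ler_pdivrMr.
    by rewrite ler_pM2l // -natrM ler_nat.
  rewrite exprS in yQ.
  have x0 : 0 < q%:R * 2 ^+ k.+1 :> R by rewrite mulr_gt0 // exprn_gt0.
  have yn : y * n%:R <= n%:R by rewrite ler_piMl.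
  by rewrite -(ltr_nat R); split; lra.
have qn : (q * 2 ^ k + q < n)%N by case: (small (q * 2 ^ k + q)%N).
have hpsi m : (m <= q * 2 ^ k + q)%N -> 1 - p0 / 16 <= psi n m.
  by move=> /small[]; apply: hy.
have hpsi2 m : (m <= q * 2 ^ k + q)%N -> 1 / 2 <= psi n m.
  by move=> /hpsi; apply: le_trans; lra.
have rmk : theta / kappa + 64 / (kappa * p0) <= rm predT.
  apply: le_trans (_ : k%:R / 4 <= _); first by rewrite ler_pdivlMr // mulrC.
  apply: refmass_ge => // [|m mq]; first by apply: leq_trans (ltnW qn); rewrite leq_addr.
  by apply: hpsi2; apply: leq_trans mq _; rewrite leq_addr.
have tk0 : 0 < theta / kappa by rewrite divr_gt0.
have kp64 : 0 < 64 / (kappa * p0) by rewrite divr_gt0.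
have L0 : 0 < rm predT by lra.
have L64 : 64 <= kappa * p0 * rm predT by rewrite -ler_pdivrMl // mulrC; lra.
have Lt : theta <= kappa * rm predT by rewrite -ler_pdivrMl // mulrC; lra.
have L1 : 1 <= rm predT.
  have tk : theta <= theta / kappa by rewrite ler_pdivlMr // ler_piMr // ltW.
  by apply: (le_trans theta1); apply: (le_trans tk); apply: le_trans rmk; rewrite lerDl ltW.
split=> //; first exact: ltnW.
pose I := fun t => hsum b t == y00; pose low := fun t => hsum b t < y00.
have Isym : perm_invariant I by move=> s t st; rewrite /I (perm_invariant_hsum b st).
have lsym : perm_invariant low by move=> s t st; rewrite /low (perm_invariant_hsum b st).
have nQ : n%:R / q%:R <= 2 * Q%:R :> R.
  rewrite ler_pdivrMr // -!natrM ler_nat; apply: leq_trans (ltnW nqQ) _.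
  by rewrite [leqRHS]mulnAC leq_mul2r mul2n -addnn -addn1 leq_add2l q0 orbT.
have nq0 : 0 <= n%:R / q%:R :> R by rewrite divr_ge0.
pose B j := (q <= j < q * 2 ^ k)%N.
pose bm j i := b (i + j)%N < b i + b j; pose bp j i := b (i + j)%N > b i + b j.
pose Am i := (0 < i < q)%N && (kappa / 2 * rm predT < rm (bm^~ i))%R.
pose Ap i := (0 < i < q)%N && (kappa / 2 * rm predT < rm (bp^~ i))%R.
have rmB : E n (cyc (fun j => (B j)%:R)) = rm predT by apply: refmass_predT.
have l0q : (8 * (Q%:R * theta) ^+ 2)^-1 <= 1 / (8 * Q%:R) :> R.
  rewrite div1r lef_pV2 ?posrE ?mulr_gt0 ?exprn_gt0 ?mulr_gt0 // ler_pM2l // expr2.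
  have Qt : Q%:R <= Q%:R * theta by rewrite ler_peMr // ltW.
  apply: le_trans Qt _; rewrite ler_peMr ?mulr_ge0 // ?(ltW theta0) //.
  by rewrite (le_trans Q1) // ler_peMr // ltW.
have AB i j : (0 < i < q)%N -> B j -> (i + j <= q * 2 ^ k + q)%N.
  by move=> /andP[_ iq] /andP[_ jq]; rewrite addnC leq_add // ltnW.
have kh : 0 < kappa / 2 by rewrite divr_gt0.
have Wm : \sum_(1 <= i < n.+1) (Am i)%:R / i%:R <= 128 / (kappa * p0).
  have AP i : Am i -> (0 < i < q)%N by case/andP.
  have BP j : B j -> (q <= j)%N by case/andP.
  have e12 : 0 <= p0 / 16 <= 1 / 2 by apply/andP; split; lra.
  have psiA i : Am i -> 1 - p0 / 16 <= psi n i.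
    by move=> /AP /andP[_ iq]; apply: hpsi; rewrite (leq_trans (ltnW iq)) // leq_addl.
  have ABn i j : Am i -> B j -> (i + j <= n)%N.
    by move=> /AP iq Bj; rewrite (leq_trans (AB i j iq Bj)) // ltnW.
  have psiAB i j : Am i -> B j -> 1 - p0 / 16 <= psi n (i + j).
    by move=> /AP iq Bj; apply: hpsi; apply: AB.
  pose G i j := Am i && B j && bm j i.
  have GP i j : G i j -> Am i && B j by case/andP.
  have := @merge_bound R theta theta1 n q Am B G (p0 / 16) AP BP ABn GP e12 psiA psiAB
    I low p0 _ Isym lsym q0 pE lE (kappa / 2) kh pp _ _ _ _ _ _.
  have W1W := W1_le_W theta1 e12 psiA.
  rewrite rmB => h; have {}h : kappa / 2 * p0 * E n (cyc (fun i => (Am i)%:R)) <= 32.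
    apply: h => //; first lra.
    - exact: (@pair_weight_ge n q k b (kappa / 2) <%R).
    - by lra.
    - apply: le_trans (_ : 2 * Q%:R * (1 / (8 * Q%:R)) <= _).
        by apply: ler_pM => //; rewrite invr_ge0 mulr_ge0 // sqr_ge0.
      by rewrite le_eqVlt; apply/orP; left; apply/eqP; field; rewrite gt_eqF.
    - move=> i j t /andP[_ Gij]; rewrite /I /low /hsum !big_cons => /eqP <-.
      by rewrite addrA ltrD2r.
  set W := E n _ in W1W h; set W1 := (X in X <= _).
  have W1W' : theta * W1 <= 2 * W by [].
  have W10 : 0 <= W1 by apply: sumr_ge0 => i _; rewrite divr_ge0.
  rewrite ler_pdivlMr // mulrC.
  have tW : W1 <= 2 * W by apply: le_trans W1W'; rewrite ler_peMl.
  have : kappa * p0 * W1 <= kappa * p0 * (2 * W) by rewrite ler_pM2l.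
  lra.
have Wp : \sum_(1 <= i < n.+1) (Ap i)%:R / i%:R <= (1 : R).
  have AP i : Ap i -> (0 < i < q)%N by case/andP.
  have BP j : B j -> (q <= j)%N by case/andP.
  have ABn i j : Ap i -> B j -> (i + j <= n)%N.
    by move=> /AP iq Bj; rewrite (leq_trans (AB i j iq Bj)) // ltnW.
  pose G i j := Ap i && B j && bp j i.
  have GP i j : G i j -> Ap i && B j by case/andP.
  have k8 : 0 < kappa / 2 / 4 by rewrite divr_gt0.
  have := @split_bound R theta theta1 n q Ap B G AP BP ABn GP
    I low p0 _ Isym lsym q0 pE lE (kappa / 2 / 4) n0 k8 pp _ _ _ _ _.
  rewrite rmB (split_weight theta1 ABn GP); apply.
  - exact: (@split_weight_ge n q k b (kappa / 2) (fun x y => y < x) (ltnW qn) hpsi2).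
  - by [].
  - by lra.
  - apply: le_trans (_ : (2 * Q%:R * theta) ^+ 2 * (8 * (Q%:R * theta) ^+ 2)^-1 <= _).
      apply: ler_wpM2r; first by rewrite invr_ge0 mulr_ge0 // sqr_ge0.
      rewrite lerXn2r ?nnegrE ?mulr_ge0 // ?(ltW theta0) //.
      by rewrite ler_pM2r.
    rewrite le_eqVlt; apply/orP; left; apply/eqP.
    by field; rewrite !gt_eqF.
  - move=> i j t /andP[_ Gij]; rewrite /I /low /hsum !big_cons => /eqP <-.
    by rewrite addrA ltrD2r.
(* If additivity fails for more than a share [kappa] of the window, one of the two strict
   inequalities holds for more than a share [kappa / 2]. *)
apply: le_trans (lerD Wm Wp); rewrite -big_split /=; apply: ler_sum => i _.
rewrite -mulrDl ler_wpM2r ?invr_ge0 // -natrD ler_nat.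
case: (boolP (_ && _)) => // /andP[iq kr]; rewrite /Am /Ap iq /=.
case: ltP => //= h1; case: ltP => //= h2.
move: kr; rewrite ltNge => /negP; case.
apply: le_trans (_ : rm (bm^~ i) + rm (bp^~ i) <= _).
  by apply: refmassU => j; rewrite neq_lt.
lra.
Qed.

End AdditiveMost.

(** * From approximate additivity to linearity *)

Lemma le_sum_subrange (R : numDomainType) (f : nat -> R) (m n a b : nat) :
  (forall x, 0 <= f x) -> (m <= a)%N -> (b <= n)%N ->
  \sum_(a <= x < b) f x <= \sum_(m <= x < n) f x.
Proof.
move=> f0 ma bn; have [ab|ba] := leqP a b; last first.
  by rewrite [leLHS]big_geq ?sumr_ge0 // ltnW.
rewrite [leRHS](@big_cat_nat _ _ _ a) //=; last exact: leq_trans bn.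
rewrite [X in _ <= _ + X](@big_cat_nat _ _ _ b) //=.
by apply: ler_wpDl; rewrite ?sumr_ge0 //; apply: ler_wpDr; rewrite ?sumr_ge0.
Qed.

Section Linear.
Variables (R : realType) (theta : R).
Hypothesis theta1 : 1 <= theta.
Local Notation E := (Ew theta).
Local Notation psi := (psi theta).
Local Notation kmean := (kmean theta).

Let theta0 : 0 < theta. Proof. exact: lt_le_trans theta1. Qed.

Section Fixed.
Variables (n q k : nat) (b : nat -> int) (kappa : R).
Local Notation rm := (refmass theta n q k).
Let N := (q * 2 ^ k)%N.
Hypothesis Nqn : (N + q <= n)%N.
Hypothesis hpsi : forall m, (m <= N + q)%N -> 1 / 2 <= psi n m.
Hypothesis Lt : theta <= kappa * rm predT.
Hypothesis kappa0 : 0 < kappa.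

Let L0 : 0 < rm predT.
Proof. by rewrite -(pmulr_rgt0 _ kappa0); apply: lt_le_trans Lt. Qed.

Lemma kmean_shift d j : (d < q)%N -> (q <= j)%N -> (d + j <= N + q)%N ->
  kmean n j <= 4 * kmean n (d + j).
Proof.
move=> dq qj djN; have j0 : (0 < j)%N := leq_trans (leq_ltn_trans (leq0n d) dq) qj.
have jp : 0 < j%:R :> R by rewrite ltr0n.
have djp : 0 < (d + j)%:R :> R by rewrite ltr0n addn_gt0 j0 orbT.
have dj2 : (d + j <= 2 * j)%N by rewrite mul2n -addnn leq_add2r (leq_trans (ltnW dq) qj).
apply: le_trans (kmean_le theta1 n j) _.
rewrite {1}/@kmean (leq_trans djN Nqn) mul1r.
apply: le_trans (_ : 4 * (theta / (d + j)%:R * (1 / 2)) <= _); last first.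
  apply: ler_wpM2l => //; apply: ler_wpM2l; first exact: divr_ge0 (ltW theta0) (ltW djp).
  exact: hpsi.
rewrite [leRHS](_ : _ = theta * (2 * (d + j)%:R^-1)); last by move: ((d + j)%:R^-1) => u; field.
apply: ler_wpM2l; first exact: ltW.
have : (2 * j%:R)^-1 <= (d + j)%:R^-1 :> R.
  by rewrite lef_pV2 ?posrE ?mulr_gt0 // -natrM ler_nat.
rewrite invfM; lra.
Qed.

(** Weights in the window change by a factor of at most 4 under a shift by [d < q]. At most [d]
    indices leave it at the top, each of weight at most [theta / q]; their total [theta] is within
    [kappa] times the window mass. *)
Lemma refmass_shift d (P : pred nat) : (d < q)%N ->
  rm (fun j => P (d + j)%N) <= 4 * rm P + kappa * rm predT.
Proof.
move=> dq; pose B j := (q <= j < N)%N; pose f u := 4 * (kmean n u * (B u && P u)%:R).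
have f0 u : 0 <= f u by rewrite mulr_ge0 // mulr_ge0 // kmean_ge0.
have q0 : (0 < q)%N := leq_ltn_trans (leq0n d) dq.
have qp : 0 < q%:R :> R by rewrite ltr0n.
have dn : (d <= n)%N by rewrite (leq_trans (ltnW dq)) // (leq_trans _ Nqn) // leq_addl.
have Nn : (N <= n)%N by rewrite (leq_trans _ Nqn) // leq_addr.
have qN : (q <= N)%N by rewrite leq_pmulr // expn_gt0.
apply: le_trans (_ : \sum_(1 <= j < n.+1) ((d + j <= n)%:R * f (d + j)%N +
    (theta / q%:R) * (N - d <= j < N)%:R) <= _).
  apply: ler_sum => j _; change ((q <= j < q * 2 ^ k)%N) with (B j).
  case: (boolP (B j && P (d + j)%N)) => [/andP[/andP[qj jN] Pj]|_]; last first.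
    by rewrite mulr0 addr_ge0 // mulr_ge0 // divr_ge0 // ltW.
  rewrite mulr1; have jp : 0 < j%:R :> R by rewrite ltr0n (leq_trans q0).
  have [Ndj|djN] := leqP N (d + j).
    apply: ler_wpDl; first by rewrite mulr_ge0.
    rewrite leq_subLR Ndj jN mulr1; apply: le_trans (kmean_le theta1 n j) _.
    apply: ler_wpM2l; first exact: ltW.
    by rewrite lef_pV2 ?posrE // ler_nat.
  apply: ler_wpDr; first by rewrite mulr_ge0 // divr_ge0 // ltW.
  rewrite (leq_trans (ltnW djN) Nn) mul1r /f Pj /B (leq_trans qj (leq_addl _ _)) djN mulr1.
  by apply: kmean_shift => //; rewrite (leq_trans (ltnW djN)) // leq_addr.
rewrite big_split /=; apply: lerD.
  rewrite (sum_shift f dn) /refmass mulr_sumr; apply: ler_sum => u _.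
  by case: (d < u)%N; rewrite ?mul0r ?mul1r // f0.
apply: le_trans Lt; rewrite -mulr_sumr.
have Nd : (0 < N - d)%N by rewrite subn_gt0 (leq_trans dq).
have le1 : \sum_(1 <= j < n.+1) ((N - d <= j < N)%:R : R) <= d%:R.
  rewrite (@big_cat_nat _ _ _ (N - d)) //=; last by rewrite (leq_trans (leq_subr _ _)) // leqW.
  rewrite big_nat big1 ?add0r => [|j /andP[_ jd]]; last by rewrite leqNgt jd.
  rewrite (@big_cat_nat _ _ _ N) ?leq_subr //=; last exact: leqW.
  rewrite [X in _ + X]big_nat [X in _ + X]big1 ?addr0 => [|j /andP[Nj _]]; last first.
    by rewrite ltnNge Nj andbF.
  apply: le_trans (_ : \sum_(N - d <= j < N) (1 : R) <= _).
    by apply: ler_sum => j _; case: (_ && _).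
  by rewrite sumr_const_nat subKn // (leq_trans (ltnW dq)).
apply: le_trans (ler_wpM2l _ le1) _; first by rewrite divr_ge0 // ltW.
by rewrite mulrAC ler_pdivrMr // ler_pM2l // ler_nat ltnW.
Qed.

(** On the window, a step of [d] adds [x] up to a share [c] of exceptions. Thus [x] replaces the
    value of [b] at [d] and can exist even when [b d] itself is exceptional. *)
Definition shifts_by c d x := rm (fun j => b (d + j)%N != b j + x) <= c * rm predT.

Lemma shifts_by_add c1 c2 d d' x x' : (d < q)%N ->
  shifts_by c1 d x -> shifts_by c2 d' x' ->
  shifts_by (c1 + 4 * c2 + kappa) (d' + d) (x + x').
Proof.
move=> dq T1 T2; pose P j := b (d' + j)%N != b j + x'.
apply: le_trans (_ : rm (fun j => b (d + j)%N != b j + x) + rm (fun j => P (d + j)%N) <= _).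
  apply: (refmassU theta1) => j; rewrite /P addnA -negb_and; apply: contra => /andP[/eqP e1 /eqP e2].
  by rewrite e2 e1 addrA.
rewrite 2!mulrDl -addrA; apply: lerD => //; apply: le_trans (refmass_shift P dq) _.
by rewrite lerD2r; apply: le_trans (ler_wpM2l (ler0n _ 4) T2) _; rewrite mulrA.
Qed.

Lemma shifts_by_sub c1 c2 d d' x x' : (d < q)%N ->
  shifts_by c1 (d' + d) x -> shifts_by c2 d' x' ->
  shifts_by (c1 + 4 * c2 + kappa) d (x - x').
Proof.
move=> dq T1 T2; pose P j := b (d' + j)%N != b j + x'.
apply: le_trans (_ : rm (fun j => b (d' + d + j)%N != b j + x) + rm (fun j => P (d + j)%N) <= _).
  apply: (refmassU theta1) => j; rewrite /P addnA -negb_and; apply: contra => /andP[/eqP e1 /eqP e2].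
  by rewrite addrA -e1 e2 addrK.
rewrite 2!mulrDl -addrA; apply: lerD => //; apply: le_trans (refmass_shift P dq) _.
by rewrite lerD2r; apply: le_trans (ler_wpM2l (ler0n _ 4) T2) _; rewrite mulrA.
Qed.

Lemma shifts_by_inj c1 c2 d x x' : c1 + c2 < 1 ->
  shifts_by c1 d x -> shifts_by c2 d x' -> x = x'.
Proof.
move=> c12 T1 T2; apply/eqP; apply: contraTT c12 => xx; rewrite -leNgt.
rewrite -(ler_pM2r L0) mul1r mulrDl; apply: le_trans (lerD T1 T2).
apply: (refmassU theta1) => j _; rewrite -negb_and; apply: contra xx => /andP[/eqP -> ].
by rewrite (inj_eq (addrI _)).
Qed.

Variable C1 : R.
Let bad i := (0 < i < q)%N && ~~ shifts_by kappa i (b i).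
Hypothesis badC : \sum_(1 <= i < n.+1) (bad i)%:R / i%:R <= C1.

(** If [i] or [i + d] were bad for every [i] in [[d, d * 2^K)], then, as [i + d <= 2 (i + 1)] there,
    the harmonic sum over this range, at least [K/2], would be at most [C1 + 2 * C1]. *)
Lemma good_pair K d : 6 * C1 < K%:R -> (0 < d)%N -> (d * 2 ^ K.+1 <= q)%N ->
  exists i, [/\ (0 < i)%N, (i + d < q)%N, ~~ bad i & ~~ bad (i + d)].
Proof.
move=> KC d0 dq; apply: contrapT => no; have dK : (d * 2 ^ K + d <= q)%N.
  by rewrite (leq_trans _ dq) // expnS mul2n -addnn mulnDr leq_add2l leq_pmulr // expn_gt0.
have {}no i : (d <= i < d * 2 ^ K)%N -> bad i || bad (i + d).
  move=> /andP[di iK]; apply: contraPT (no) => /norP[gi gid] []; exists i; split=> //.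
    exact: leq_trans di.
  by apply: leq_trans dK; rewrite ltn_add2r.
have qn : (q <= n)%N by rewrite (leq_trans _ Nqn) // leq_addl.
have pos j : 0 <= (bad j)%:R / j%:R :> R by rewrite divr_ge0.
have hd := @harmonic_dyadic R d K d0.
have h1 : \sum_(d <= x < d * 2 ^ K) (bad x)%:R / x%:R <= C1.
  apply: le_trans badC; apply: le_sum_subrange => //.
  by rewrite (leq_trans (leq_addr d _)) // (leq_trans dK) // leqW.
have h2 : \sum_(d <= x < d * 2 ^ K) (bad (x + d))%:R / (x + d)%:R <= C1.
  have -> : \sum_(d <= x < d * 2 ^ K) (bad (x + d))%:R / (x + d)%:R =
      \sum_(d + d <= x < d * 2 ^ K + d) (bad x)%:R / x%:R :> R.
    by rewrite big_addn addnK.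
  apply: le_trans badC; apply: le_sum_subrange => //; first by rewrite addn_gt0 d0.
  by rewrite (leq_trans dK) // leqW.
have : \sum_(d <= x < d * 2 ^ K) (x.+1%:R^-1 : R) <= C1 + 2 * C1.
  apply: le_trans (lerD h1 (ler_wpM2l (ler0n _ 2) h2)).
  rewrite mulr_sumr -big_split /= !big_nat; apply: ler_sum => x dx.
  have /andP[dx' _] := dx; have x0 : 0 < x%:R :> R by rewrite ltr0n (leq_trans d0).
  have le1 : x.+1%:R^-1 <= x%:R^-1 :> R by rewrite lef_pV2 ?posrE // ler_nat.
  have le2 : x.+1%:R^-1 <= 2 * (x + d)%:R^-1 :> R.
    rewrite -[leLHS]mul1r; apply: le_trans (_ : 2 * (2 * x.+1%:R)^-1 <= _).
      by rewrite invfM mulrA divff.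
    rewrite ler_pM2l // lef_pV2 ?posrE ?mulr_gt0 ?ltr0n ?addn_gt0 ?d0 ?orbT //.
    by rewrite -natrM ler_nat mul2n -addnn leq_add // leqW.
  case/orP: (no _ dx) => ->.
    by rewrite mul1r; apply: ler_wpDr => //; rewrite mulr_ge0.
  by rewrite mul1r; apply: ler_wpDl.
lra.
Qed.

(** Every [d] up to [D] is a difference of two good indices and hence shifts by some value with
    error [6 * kappa]. Uniqueness of shift values forces linearity in [d], and also equality with
    [b i] at a good [i]. *)
Lemma linear_on_good K : 6 * C1 < K%:R -> (2 ^ K.+1 <= q)%N -> 40 * kappa <= 1 ->
  exists lam : int, forall i, (0 < i <= q %/ 2 ^ K.+1)%N -> ~~ bad i -> b i = lam * i%:Z.
Proof.
move=> KC Kq kap; set D := (q %/ 2 ^ K.+1)%N.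
have Dq d : (d <= D)%N -> (d * 2 ^ K.+1 <= q)%N.
  by move=> dD; rewrite (leq_trans _ (leq_trunc_div q (2 ^ K.+1))) // leq_mul2r dD orbT.
have D1 : (0 < D)%N by rewrite divn_gt0 // expn_gt0.
have Dlt d : (d <= D)%N -> (d < q)%N.
  move=> /Dq; case: d => [|d] dq; first by apply: leq_trans Kq; rewrite expn_gt0.
  by apply: leq_trans dq; rewrite -[X in (X < _)%N]muln1 ltn_pmul2l // -(expn0 2) ltn_exp2l.
have good i : (0 < i < q)%N -> ~~ bad i -> shifts_by kappa i (b i).
  by move=> iq; rewrite /bad iq /= negbK.
have ex d : (0 < d <= D)%N -> exists x : int, shifts_by (6 * kappa) d x.
  move=> /andP[d0 dD]; have [i [i0 idq gi gid]] := good_pair KC d0 (Dq _ dD).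
  exists (b (i + d)%N - b i); have -> : 6 * kappa = kappa + 4 * kappa + kappa by ring.
  apply: (@shifts_by_sub _ _ d i); first exact: Dlt.
    by apply: good => //; rewrite addn_gt0 i0.
  by apply: good => //; rewrite i0 (leq_ltn_trans (leq_addr d i)).
have [lam T1] := ex 1%N D1.
have Td d : (0 < d <= D)%N -> shifts_by (6 * kappa) d (lam * d%:Z).
  elim: d => // -[_ _|d IH dD]; first by rewrite mulr1.
  have dD' : (0 < d.+1 <= D)%N by rewrite (leq_trans _ (andP dD).2).
  have [x Tx] := ex _ dD.
  (* The composed shift has error [31 * kappa]; with the [6 * kappa] of [x] this is still below 1,
     so both values agree. The error is thereby reset to [6 * kappa] at each step. *)
  have T := shifts_by_add (Dlt _ (andP dD').2) (IH dD') T1; rewrite add1n in T.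
  have -> // : lam * d.+2%:Z = x.
  have e : lam * d.+2%:Z = lam * d.+1%:Z + lam by rewrite -[d.+2]addn1 PoszD mulrDr mulr1.
  rewrite e; apply: shifts_by_inj T Tx; lra.
exists lam => i /andP[i0 iD] gi.
apply: (@shifts_by_inj kappa (6 * kappa) i); first lra.
  by apply: good => //; rewrite i0 Dlt.
by apply: Td; rewrite i0.
Qed.

End Fixed.

(** All lengths above [D] are counted as exceptional: each weighs at most [1/(D + 1)], and
    [n/(D + 1)] is bounded since [Q] and [K] are fixed. *)
Lemma eventually_linear (p0 : R) : 0 < p0 <= 1 ->
  exists (N0 : nat) (l0 C : R), 0 < l0 /\
  forall n (b : nat -> int) (y0 : int), (N0 <= n)%N ->
  p0 <= E n (fun t => (hsum b t == y0)%:R) ->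
  E n (fun t => (hsum b t < y0)%R%:R) <= l0 ->
  exists lam : int, \sum_(1 <= j < n.+1) (b j != lam * j%:Z)%:R / j%:R <= C.
Proof.
move=> p01; have k01 : 0 < (1 / 40 : R) <= 1 by apply/andP; split; lra.
have [Q [k [l0 [C1 [Q0 l00 h]]]]] := additive_most theta1 p01 k01.
have [K [_ KC]] := nat_ge (6 * C1 + 1); have {}KC : 6 * C1 < K%:R by lra.
exists (Q * 2 ^ K.+1)%N, l0, (C1 + (2 * Q * 2 ^ K.+1)%:R); split=> // n b y0 nN pE lE.
have nQ : (Q <= n)%N by apply: leq_trans nN; rewrite leq_pmulr // expn_gt0.
have [qn hpsi Lt badC] := h n b y0 nQ pE lE.
set q := (n %/ Q)%N in qn hpsi Lt badC.
have qK : (2 ^ K.+1 <= q)%N by rewrite leq_divRL // mulnC.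
have badC' : \sum_(1 <= i < n.+1)
    ((0 < i < q)%N && ~~ shifts_by n q k b (1 / 40) i (b i))%:R / i%:R <= C1.
  apply: le_trans badC; apply: ler_sum => i _; rewrite ler_wpM2r ?invr_ge0 // ler_nat.
  case: (0 < i < q)%N => //=.
  rewrite (_ : (fun j => b (i + j)%N != b i + b j) = (fun j => b (i + j)%N != b j + b i)).
    by rewrite /shifts_by -ltNge.
  by apply/funext => j; rewrite addrC.
have kap : 40 * (1 / 40) <= 1 :> R by lra.
have k0 : 0 < 1 / 40 :> R by lra.
have [lam hl] := linear_on_good qn hpsi Lt k0 badC' KC qK kap.
exists lam; set D := (q %/ 2 ^ K.+1)%N in hl.
have D1 : 0 < D.+1%:R :> R by rewrite ltr0n.
apply: le_trans (_ : C1 + \sum_(1 <= j < n.+1) D.+1%:R^-1 <= _).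
  apply: le_trans (lerD badC' (lexx _)); rewrite -big_split /= !big_nat.
  apply: ler_sum => j /andP[j0 jn]; have [jD|Dj] := leqP j D.
    apply: ler_wpDr; first by rewrite invr_ge0.
    rewrite ler_wpM2r ?invr_ge0 // ler_nat; case: eqP => //= bj.
    by case: (boolP (_ && _)) => // gj; case: bj; apply: hl => //; rewrite j0.
  apply: ler_wpDl; first by rewrite divr_ge0.
  apply: le_trans (_ : j%:R^-1 <= _).
    by rewrite ler_piMl ?invr_ge0 // lern1 leq_b1.
  by rewrite lef_pV2 ?posrE ?ltr0n // ler_nat.
rewrite lerD2l sumr_const_nat subn1 /= -[leLHS]mulr_natl ler_pdivrMr // -natrM ler_nat.
have qD : (q < D.+1 * 2 ^ K.+1)%N by rewrite ltn_ceil // expn_gt0.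
have nq : (n < q.+1 * Q)%N by rewrite ltn_ceil.
apply: leq_trans (ltnW nq) _; apply: leq_trans (leq_mul qD (leqnn Q)) _.
rewrite [leqRHS](_ : _ = (2 * (D.+1 * 2 ^ K.+1 * Q))%N); first by rewrite leq_pmull.
by move: (2 ^ K.+1)%N D.+1 => u v; ring.
Qed.

End Linear.

(** * The weights of nonzero and of negative coefficients *)

Section Concentrated.
Variables (R : realType) (theta : R).
Hypothesis theta1 : 1 <= theta.
Local Notation E := (Ew theta).
Local Notation psi := (psi theta).

Let theta0 : 0 < theta. Proof. exact: lt_le_trans theta1. Qed.

Lemma hsum_avoid (b : nat -> int) (lam : int) t :
  count (fun j => b j != lam * j%:Z) t = 0%N -> hsum b t = lam * (sumn t)%:Z.
Proof.
rewrite /hsum; elim: t => [|c t IH] /=; first by rewrite big_nil mulr0.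
rewrite big_cons; case: eqP => //= -> ct.
by rewrite IH // PoszD mulrDr.
Qed.

Lemma hsum_one (b : nat -> int) t :
  count (fun j => b j != 0) t = 1%N ->
  \sum_(c <- t) ((b c < 0)%R%:R : R) = (hsum b t < 0)%R%:R.
Proof.
rewrite /hsum; elim: t => //= c t IH; rewrite !big_cons; case: eqP => [->|_] /=.
  by rewrite add0n => /IH; rewrite /= !add0r.
rewrite add1n => -[c0]; rewrite -/(hsum b t) (@hsum_avoid b 0) ?mul0r ?addr0.
  rewrite big1_seq ?addr0 // => i /andP[_ it]; case: (b i =P 0) => [->|/eqP bi].
    by rewrite ltxx.
  have : has (fun j => b j != 0) t by apply/hasP; exists i.
  by rewrite has_count c0.
by rewrite -[RHS]c0; apply: eq_count => i; rewrite mul0r.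
Qed.

Variable a : nat -> nat -> int.
Let Pr n (A : seq nat -> bool) := E n (fun t => (A t)%:R).
Variables (y0 : int) (p0 : R).
Hypothesis p01 : 0 < p0 <= 1.
Hypothesis at_y0 : exists n0 : nat, forall n, (n0 <= n)%N ->
  p0 <= Pr n (fun t => hsum (a n) t == y0).
Hypothesis below_y0 : forall e : R, 0 < e -> exists n0 : nat, forall n, (n0 <= n)%N ->
  Pr n (fun t => hsum (a n) t < y0) <= e.
Hypothesis below_0 : forall e : R, 0 < e -> exists n0 : nat, forall n, (n0 <= n)%N ->
  Pr n (fun t => hsum (a n) t < 0) <= e.
Hypothesis tight : forall e : R, 0 < e -> exists K n0 : nat, forall n, (n0 <= n)%N ->
  Pr n (fun t => K%:Z < hsum (a n) t) <= e.

Lemma nonzero_weight_bounded : exists (C : R) (n0 : nat), forall n, (n0 <= n)%N ->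
  \sum_(1 <= j < n.+1) (a n j != 0)%:R / j%:R <= C.
Proof.
have [N0 [l0 [C [l00 lin]]]] := eventually_linear theta1 p01.
have [d [s0 [d0 av]]] := Ew_avoid_lower theta1 C.
have [n1 h1] := at_y0; have [n2 h2] := below_y0 l00.
have d2 : 0 < d / 2 by rewrite divr_gt0.
have [n3 h3] := below_0 d2; have [K [n4 h4]] := tight d2.
(* The bound [K.+1 <= n] puts [lam * n] above the tightness level [K] as soon as [lam >= 1]. *)
exists C, (maxn N0 (maxn s0 (maxn n1 (maxn n2 (maxn n3 (maxn n4 K.+1)))))).
move=> n; rewrite !geq_max => /and5P[nN ns nn1 nn2 /and3P[nn3 nn4 nK]].
have [lam hlam] := lin n (a n) y0 nN (h1 n nn1) (h2 n nn2).
have hav := av _ n ns hlam.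
have big (A : seq nat -> bool) :
    (forall t, hsum (a n) t = lam * n%:Z -> A t) -> Pr n A <= d / 2 -> False.
  move=> hA Pd; suff : d <= d / 2 by lra.
  apply: le_trans Pd; apply: le_trans hav _; apply: le_Ew => // t /andP[_ /eqP tn].
  rewrite ler_nat; case: eqP => // ct; rewrite hA //.
  by rewrite (hsum_avoid ct) tn.
suff lam0 : lam = 0.
  by apply: le_trans hlam; rewrite le_eqVlt; apply/orP; left; apply/eqP;
     apply: eq_bigr => j _; rewrite lam0 mul0r.
have n0 : 0 < n%:Z by rewrite ltz_nat; apply: leq_trans nK.
have l1 : 0 <= lam.
  rewrite leNgt; apply/negP => ln; apply: (big _ _ (h3 n nn3)) => t ->.
  by rewrite pmulr_llt0.
apply/eqP; rewrite eq_le l1 andbT leNgt; apply/negP => lp.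
apply: (big _ _ (h4 n nn4)) => t ->.
apply: lt_le_trans (_ : n%:Z <= _); first by rewrite ltz_nat.
by rewrite ler_peMl // ?ltW // -gtz0_ge1.
Qed.

Lemma negative_weight_to0 : forall e : R, 0 < e -> exists n0 : nat, forall n, (n0 <= n)%N ->
  \sum_(1 <= j < n.+1) (a n j < 0)%R%:R / j%:R * psi n j <= e.
Proof.
move=> e e0; have [C [n1 hC]] := nonzero_weight_bounded.
have [d [s0 [d0 av]]] := Ew_avoid_lower theta1 C.
have e2 : 0 < e / 2 * d by rewrite mulr_gt0 // divr_gt0.
have [n2 h2] := below_0 e2.
have [N [N0 hN]] := nat_ge (2 * (s0%:R + 1) / e + s0%:R).
exists (maxn n1 (maxn n2 (maxn N s0.+1))) => n; rewrite !geq_max => /and4P[nn1 nn2 nN ns].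
pose J j := a n j != 0.
have sp : 0 < (n - s0)%:R :> R by rewrite ltr0n subn_gt0.
have key : d * \sum_(1 <= j < n.+1) (j <= n - s0)%:R * ((a n j < 0)%R%:R / j%:R * psi n j) <= e / 2 * d.
  apply: le_trans (h2 n nn2).
  (* Summed over the cycles, [Phi] counts negative ones on the event that exactly one cycle has a
     nonzero coefficient; there it equals the indicator of [h < 0]. *)
  pose Phi j t : R := (a n j < 0)%R%:R * (count J t == 1)%:R.
  have Ps j : perm_invariant (Phi j).
    by move=> s t /seq.permP st; rewrite /Phi st.
  apply: le_trans (_ : E n (fun t => \sum_(c <- t) Phi c t) <= _); last first.
    apply: le_Ew => // t _; rewrite -mulr_suml; case: eqP => [ct|_]; last by rewrite mulr0.
    by rewrite mulr1 hsum_one.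
  rewrite Ew_palm // mulr_sumr !big_nat; apply: ler_sum => j /andP[j0 jn].
  have jp : 0 < j%:R :> R by rewrite ltr0n.
  rewrite (eq_Ew (fun t => (a n j < 0)%R%:R * (count J t == 0)%:R)); last first.
    by move=> t _; rewrite /Phi /= /J; case: ltgtP => aj; rewrite ?mul0r.
  have tj : 0 <= theta / j%:R * psi n j by rewrite mulr_ge0 ?psi_ge0 // divr_ge0 // ltW.
  rewrite EwZ; case: (a n j < 0)%R; last first.
    by rewrite !mul0r !mulr0.
  rewrite !mul1r; case: leqP => js; last first.
    by rewrite mul0r mulr0 mulr_ge0 // Ew_ge0.
  rewrite mul1r mulrC; apply: ler_pM => //.
  - by rewrite mulr_ge0 ?invr_ge0 ?psi_ge0.
  - exact: ltW.
  - rewrite ler_wpM2r ?psi_ge0 // ler_peMl // invr_ge0 ltW //.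
  - apply: av; first by move: js; rewrite !leq_subRL ?(ltnW ns) // addnC.
    apply: le_trans (hC n nn1); apply: le_sum_subrange => //; last by rewrite ltnS leq_subr.
rewrite mulrC ler_pM2r // in key.
(* For [j > n - s0] the rest of the permutation is too short for the avoidance bound; these [s0]
   terms are at most [1/(n - s0)] each. *)
apply: le_trans (_ : \sum_(1 <= j < n.+1) ((j <= n - s0)%:R * ((a n j < 0)%R%:R / j%:R * psi n j)
   + (n - s0 < j)%:R * (n - s0)%:R^-1) <= _).
  rewrite !big_nat; apply: ler_sum => j /andP[j0 jn].
  have jp : 0 < j%:R :> R by rewrite ltr0n.
  case: leqP => js; first by rewrite mul1r mul0r addr0.
  rewrite mul0r add0r mul1r -[leRHS]mulr1; apply: ler_pM.
  - by rewrite divr_ge0.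
  - exact: psi_ge0.
  - apply: le_trans (_ : j%:R^-1 <= _).
      by rewrite ler_piMl ?invr_ge0 ?lern1 ?leq_b1.
    by rewrite lef_pV2 ?posrE // ler_nat ltnW.
  - exact: psi_le1.
rewrite big_split /=; have -> : e = e / 2 + e / 2 by lra.
apply: lerD key _; rewrite -mulr_suml ler_pdivrMr //.
have -> : \sum_(1 <= j < n.+1) ((n - s0 < j)%:R : R) = s0%:R.
  rewrite (@big_cat_nat _ _ _ (n - s0).+1) //=; last by rewrite ltnS leq_subr.
  rewrite big_nat big1 ?add0r => [|j /andP[_ jn]]; last by rewrite ltnNge -ltnS jn.
  rewrite big_nat (eq_bigr (fun=> 1)) => [|j /andP[jn _]]; last by rewrite jn.
  by rewrite -big_nat sumr_const_nat subSS subKn // ltnW.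
rewrite natrB 1?ltnW //; have : N%:R <= n%:R :> R by rewrite ler_nat.
have : 2 * (s0%:R + 1) / e + s0%:R <= n%:R :> R by apply: le_trans hN _; rewrite ler_nat.
move=> h _; have {}h : 2 * (s0%:R + 1) / e <= n%:R - s0%:R by lra.
rewrite ler_pdivrMr // in h; lra.
Qed.

End Concentrated.

(** * Uniform closeness of [psi] to the power *)

Lemma expR_div_small (R : realType) (x d : R) : 0 <= x -> 0 < d ->
  exists k0 : nat, (0 < k0)%N /\ forall k, (k0 <= k)%N -> expR (x / k%:R) <= 1 + d.
Proof.
move=> x0 d0; have [k0 [k00 hk0]] := nat_ge (2 * (x / d) + 2 * x).
exists k0; split=> // k kk.
have kp : 0 < k%:R :> R by rewrite ltr0n (leq_trans k00).
have xd0 : 0 <= x / d by rewrite divr_ge0 // ltW.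
have hk : 2 * (x / d) + 2 * x <= k%:R by apply: le_trans hk0 _; rewrite ler_nat.
have y0 : 0 <= x / k%:R by rewrite divr_ge0.
have y12 : x / k%:R <= 1 / 2 by rewrite ler_pdivrMr //; lra.
have yd : 2 * (x / k%:R) <= d.
  rewrite mulrA ler_pdivrMr // -ler_pdivrMl // mulrC -mulrA; lra.
move: (x / k%:R) y0 y12 yd => y y0 y12 yd.
have h : 1 - y <= expR (- y) by apply: expR_ge1Dx.
have : expR y * (1 - y) <= 1.
  by rewrite -[leRHS](expRxMexpNx_1 y) ler_pM2l ?expR_gt0.
rewrite -ler_pdivlMr; last by lra.
move=> h'; apply: le_trans h' _; rewrite ler_pdivrMr; last by lra.
have : 0 <= d * (1 / 2 - y) by rewrite mulr_ge0 // ?(ltW d0) //; lra.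
lra.
Qed.

Section PsiUpper.
Variables (R : realType) (theta : R).
Hypothesis theta1 : 1 <= theta.
Local Notation c := (Zc theta).
Local Notation psi := (psi theta).
Local Notation e := (theta - 1).

Let theta0 : 0 < theta. Proof. exact: lt_le_trans theta1. Qed.
Let c0 n : 0 < c n := Zc_gt0 theta0 n.
Let e0 : 0 <= e. Proof. by rewrite subr_ge0. Qed.
Local Notation C := (e * (1 + e)).

(** The exponential correction is chosen to telescope. Its constant [C = theta (theta - 1)] comes
    from [e/k - e/(theta + k) = e theta / (k (theta + k))] with [e = theta - 1]. *)
Lemma ratio_powR_le k : (0 < k)%N ->
  k.+1%:R / (theta + k%:R) <=
  powR (k%:R / k.+1%:R) e * expR (C / k%:R - C / k.+1%:R).
Proof.
move=> k0; have kp : 0 < k%:R :> R by rewrite ltr0n.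
have Kp : 0 < k.+1%:R :> R by rewrite ltr0n.
have tk : 0 < theta + k%:R by rewrite addr_gt0.
have h1 : expR (- (e / k%:R)) <= powR (k%:R / k.+1%:R) e.
  have -> : - (e / k%:R) = - k%:R^-1 * e by rewrite mulNr mulrC.
  rewrite expRM; apply: ge0_ler_powR; rewrite ?nnegrE ?expR_ge0 ?divr_ge0 //.
  rewrite expRN -[leRHS]invrK lef_pV2 ?posrE ?expR_gt0 ?invr_gt0 ?divr_gt0 //.
  apply: le_trans (expR_ge1Dx _); rewrite invf_div -natr1 mulrDl divff ?gt_eqF //.
  by rewrite mul1r.
have h2 : k.+1%:R / (theta + k%:R) <= expR (- (e / (theta + k%:R))).
  apply: le_trans (expR_ge1Dx _); rewrite -natr1 le_eqVlt; apply/orP; left; apply/eqP.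
  by field; rewrite gt_eqF.
apply: le_trans h2 _; apply: le_trans (ler_wpM2r (expR_ge0 _) h1).
rewrite -expRD ler_expR.
have -> : C / k%:R - C / k.+1%:R = C / (k%:R * k.+1%:R).
  by rewrite -natr1; field; rewrite natr1 !gt_eqF.
rewrite -subr_ge0.
have -> : - (e / k%:R) + C / (k%:R * k.+1%:R) - - (e / (theta + k%:R)) =
   C * e / (k%:R * k.+1%:R * (theta + k%:R)).
  by rewrite -natr1; field; rewrite natr1 !gt_eqF.
apply: divr_ge0; last by rewrite mulr_ge0 // ltW.
by apply: mulr_ge0 => //; apply: mulr_ge0 => //; apply: addr_ge0.
Qed.

Lemma Zc_ratio_le k n : (0 < k)%N -> (k <= n)%N ->
  c k <= powR (k%:R / n%:R) e * expR (C / k%:R - C / n%:R) * c n.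
Proof.
move=> k0 kn; rewrite -(subnK kn); elim: (n - k)%N => [|d IH].
  by rewrite add0n divff ?pnatr_eq0 ?gtn_eqF // powR1 subrr expR0 !mul1r.
rewrite addSn; set m := (d + k)%N in IH *.
have m0 : (0 < m)%N by rewrite /m addn_gt0 k0 orbT.
have mp : 0 < m%:R :> R by rewrite ltr0n.
apply: le_trans IH _.
have -> : (k%:R / m.+1%:R : R) = (k%:R / m%:R) * (m%:R / m.+1%:R).
  by rewrite mulrA divfK // gt_eqF.
rewrite [X in _ <= X * _ * _]powRM ?divr_ge0 //.
have -> : C / k%:R - C / m.+1%:R = (C / k%:R - C / m%:R) + (C / m%:R - C / m.+1%:R) by ring.
rewrite [X in _ <= _ * X * _]expRD.
set x := powR (k%:R / m%:R) e; set y := powR (m%:R / m.+1%:R) e.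
set u := expR (C / k%:R - C / m%:R); set v := expR (C / m%:R - C / m.+1%:R).
rewrite [leRHS](_ : _ = x * u * (y * v * c m.+1)); last by ring.
apply: ler_wpM2l; first by rewrite mulr_ge0 ?powR_ge0 ?expR_ge0.
apply: le_trans (ler_wpM2r (ltW (c0 _)) (ratio_powR_le m0)).
rewrite ZcS_div // le_eqVlt; apply/orP; left; apply/eqP.
have Mp : m.+1%:R != 0 :> R by rewrite pnatr_eq0.
by move: (m.+1%:R) Mp => z z0; field; rewrite z0 gt_eqF // addr_gt0.
Qed.

(** Let [k = n - j]. For large [k] the correction factor is at most [1 + d]; for bounded [k] the
    corrected power itself tends to 0 when [theta > 1]. The error is additive because for bounded
    [k] the ratio need not approach 1. *)
Lemma psi_powR_close (d : R) : 0 < d -> exists n0 : nat, forall n j, (n0 <= n)%N -> (j < n)%N ->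
  psi n j <= powR (1 - j%:R / n%:R) e + d.
Proof.
move=> d0; have C0 : 0 <= C by rewrite mulr_ge0 // addr_ge0.
have [k0 [k00 small]] := expR_div_small C0 d0.
have [n0 hn0] : exists n0 : nat, forall n, (n0 <= n)%N -> forall k, (0 < k < k0)%N ->
    powR (k%:R / n%:R) e * expR (C / k%:R) <= powR (k%:R / n%:R) e + d.
  have [e00|ep] := leP e 0.
    (* For [theta = 1] the power does not decay, but the correction constant is 0. *)
    exists 0%N => n _ k _; have -> : e = 0 by apply/eqP; rewrite eq_le e00 e0.
    by rewrite mul0r mul0r expR0 mulr1 lerDl ltW.
  pose z := powR (d / expR C) e^-1.
  have z0 : 0 < z by rewrite powR_gt0 // divr_gt0 // expR_gt0.
  have [N [N0 hN]] := nat_ge (k0%:R / z).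
  exists N => n Nn k /andP[k1 kk0].
  have np : 0 < n%:R :> R by rewrite ltr0n (leq_trans N0).
  have kkp : 0 < k%:R :> R by rewrite ltr0n.
  apply: ler_wpDl; first exact: powR_ge0.
  apply: le_trans (_ : d / expR C * expR C <= _); last by rewrite divfK // gt_eqF // expR_gt0.
  apply: ler_pM; rewrite ?powR_ge0 ?expR_ge0 //.
    have -> : d / expR C = powR z e.
      by rewrite /z -powRrM mulVf ?gt_eqF // powRr1 // divr_ge0 ?expR_ge0 // ltW.
    apply: ge0_ler_powR => //; rewrite ?nnegrE ?divr_ge0 ?(ltW z0) //.
    rewrite ler_pdivrMr //; apply: le_trans (_ : k0%:R <= _); first by rewrite ler_nat ltnW.
    rewrite mulrC -ler_pdivrMr //; apply: le_trans hN _; by rewrite ler_nat.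
  by rewrite ler_expR ler_pdivrMr // ler_peMr // ler1n.
exists n0 => n j nn jn.
have k1 : (0 < n - j)%N by rewrite subn_gt0.
have np : 0 < n%:R :> R by rewrite ltr0n (leq_ltn_trans _ jn).
have -> : 1 - j%:R / n%:R = (n - j)%:R / n%:R :> R.
  by rewrite natrB 1?ltnW // mulrBl divff // gt_eqF.
have kkp : 0 < (n - j)%:R :> R by rewrite ltr0n.
apply: le_trans (_ : powR ((n - j)%:R / n%:R) e * expR (C / (n - j)%:R) <= _).
  rewrite ler_pdivrMr //; apply: le_trans (Zc_ratio_le k1 (leq_subr _ _)) _.
  rewrite ler_pM2r // ler_wpM2l ?powR_ge0 // ler_expR lerBlDr lerDl.
  by rewrite divr_ge0.
have [kk|kk] := leqP k0 (n - j); last by apply: hn0 => //; rewrite k1.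
apply: le_trans (ler_wpM2l (powR_ge0 _ _) (small _ kk)) _.
rewrite mulrDr mulr1 lerD2l ler_piMl ?(ltW d0) //.
rewrite -[leRHS](powRr0 ((n - j)%:R / n%:R)); apply: ger_powR => //.
by rewrite divr_gt0 //= ler_pdivrMr // mul1r ler_nat leq_subr.
Qed.

End PsiUpper.

(** * Factorial moments *)

Section FallingFactorial.
Local Open Scope nat_scope.

Lemma ffactD x y k :
  (x + y) ^_ k = \sum_(0 <= s < k.+1) 'C(k, s) * (x ^_ s * y ^_ (k - s)).
Proof.
rewrite -bin_ffact -binomial.Vandermonde big_distrl /= big_mkord; apply: eq_bigr => s _.
have sk : s <= k by rewrite -ltnS.
by rewrite -(bin_fact sk) -!bin_ffact; ring.
Qed.

Lemma ffact_le_expn x r : x ^_ r <= x ^ r.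
Proof. by elim: r => // r IH; rewrite ffactnSr expnSr leq_mul // leq_subr. Qed.

Lemma bin_le_exp2 n k : 'C(n, k) <= 2 ^ n.
Proof.
elim: n k => [|n IH] [|k] //; first by rewrite bin0 expn_gt0.
by rewrite binS expnS mul2n -addnn leq_add.
Qed.

Definition nsum (b : nat -> nat) (t : seq nat) : nat := \sum_(c <- t) b c.

Lemma perm_invariant_nsum b : perm_invariant (nsum b).
Proof. by move=> s t; apply: perm_big. Qed.

(** Write [H_(l) = H (H - 1)_(l-1)] and let [c] be the cycle supplying the first factor. Vandermonde
    for [H - 1 = (b_c - 1) + (H - b_c)] assigns [r - 1] of the other factors to [c], which produces
    the binomials of [Upsilon]. *)
Lemma ffact_nsum b l t : 0 < l ->
  (nsum b t) ^_ l = \sum_(c <- t) \sum_(1 <= r < l.+1)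
    'C(l.-1, r.-1) * (b c ^_ r * (nsum b t - b c) ^_ (l - r)).
Proof.
case: l => // l _; rewrite ffactnS {1}/nsum big_distrl /= !big_seq.
apply: eq_bigr => c ct; rewrite big_add1 /=.
have bH : b c <= nsum b t.
  by rewrite /nsum (big_rem c) //= leq_addr.
case: (posnP (b c)) => [->|b0].
  by rewrite mul0n big_nat big1 // => r _; rewrite ffactnS mul0n mul0n muln0.
have -> : (nsum b t).-1 = (b c).-1 + (nsum b t - b c) by lia.
rewrite ffactD big_distrr /= !big_nat; apply: eq_bigr => r _.
by rewrite ffactnS subSS; ring.
Qed.

End FallingFactorial.

Section Expansion.
Variables (R : realType) (theta : R).
Hypothesis theta1 : 1 <= theta.
Local Notation Z := (Zsum theta).
Local Notation c := (Zc theta).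
Local Notation psi := (psi theta).
Local Notation E := (Ew theta).

Let theta0 : 0 < theta. Proof. exact: lt_le_trans theta1. Qed.
Let c0 n : 0 < c n := Zc_gt0 theta0 n.

Variables (n : nat) (b : nat -> nat).

(* [u] cycles absorb the [l] factors of the falling factorial; [w] weighs
   their total length. *)
Fixpoint fexpand (u l : nat) (w : nat -> R) : R :=
  if u is u'.+1 then
    \sum_(1 <= r < l.+1) 'C(l.-1, r.-1)%:R *
      \sum_(1 <= j < n.+1) (b j ^_ r)%:R / j%:R *
        fexpand u' (l - r) (fun J => w (j + J)%N)
  else (l == 0%N)%:R * w 0%N.

Lemma eq_fexpand u l (w w' : nat -> R) : w =1 w' -> fexpand u l w = fexpand u l w'.
Proof. by move=> /funext ->. Qed.

Lemma le_fexpand u l (w w' : nat -> R) : (forall J, w J <= w' J) ->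
  fexpand u l w <= fexpand u l w'.
Proof.
elim: u l w w' => [|u IH] l w w' ww /=; first by rewrite ler_wpM2l.
apply: ler_sum => r _; rewrite ler_wpM2l //; apply: ler_sum => j _.
by apply: ler_wpM2l; [rewrite divr_ge0|apply: IH].
Qed.

Lemma fexpandD u l (w w' : nat -> R) :
  fexpand u l (fun J => w J + w' J) = fexpand u l w + fexpand u l w'.
Proof.
elim: u l w w' => [|u IH] l w w' /=; first by rewrite mulrDr.
rewrite -big_split /=; apply: eq_bigr => r _; rewrite -[RHS]mulrDr -big_split /=.
by under eq_bigr do rewrite IH mulrDr.
Qed.

Lemma fexpandZ u l x (w : nat -> R) : fexpand u l (fun J => x * w J) = x * fexpand u l w.
Proof.
elim: u l w => [|u IH] l w /=; first by rewrite mulrCA.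
rewrite mulr_sumr; apply: eq_bigr => r _.
under eq_bigr do rewrite IH mulrCA.
by rewrite -mulr_sumr mulrCA.
Qed.

Lemma fexpand_gt u l w : (l < u)%N -> fexpand u l w = 0.
Proof.
elim: u l w => // u IH l w lu /=; rewrite big_nat big1 // => r /andP[r1 rl].
rewrite big1 ?mulr0 // => j _; rewrite IH ?mulr0 //.
by apply: leq_trans (ltnSE lu); rewrite ltn_subrL r1 (leq_trans r1).
Qed.

Lemma fexpand_ge0 u l (w : nat -> R) : (forall J, 0 <= w J) -> 0 <= fexpand u l w.
Proof.
elim: u l w => [|u IH] l w w0 /=; first by rewrite mulr_ge0.
apply: sumr_ge0 => r _; rewrite mulr_ge0 //; apply: sumr_ge0 => j _.
by apply: mulr_ge0; [rewrite divr_ge0|apply: IH].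
Qed.

Lemma Zsum_ffact_rec s l (F : nat -> R) : (0 < l)%N ->
  Z s (fun t => (nsum b t ^_ l)%:R * F (size t)) =
  \sum_(1 <= r < l.+1) 'C(l.-1, r.-1)%:R * \sum_(1 <= j < s.+1)
    theta / j%:R * (b j ^_ r)%:R *
      Z (s - j) (fun t => (nsum b t ^_ (l - r))%:R * F (size t).+1).
Proof.
move=> l0; pose Phi i t : R := (\sum_(1 <= r < l.+1) 'C(l.-1, r.-1)%:R *
   ((b i ^_ r)%:R * ((nsum b t - b i) ^_ (l - r))%:R)) * F (size t).
have Ps i : perm_invariant (Phi i).
  by move=> u v uv; rewrite /Phi (perm_invariant_nsum b uv) (perm_size uv).
transitivity (Z s (fun t => \sum_(i <- t) Phi i t)).
  apply: eq_Zsum => t _; rewrite -mulr_suml ffact_nsum // natr_sum; congr (_ * _).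
  apply: eq_bigr => i _; rewrite natr_sum; apply: eq_bigr => r _.
  by rewrite !natrM.
rewrite Zsum_palm; last by move=> i u v; apply: Ps.
under [in RHS]eq_bigr do rewrite mulr_sumr.
rewrite exchange_big /=; apply: eq_bigr => j _.
transitivity (theta / j%:R * \sum_(1 <= r < l.+1) 'C(l.-1, r.-1)%:R * (b j ^_ r)%:R *
   Z (s - j) (fun t => (nsum b t ^_ (l - r))%:R * F (size t).+1)).
  congr (_ * _); under [in RHS]eq_bigr do rewrite -ZsumZ.
  rewrite -Zsum_sum; apply: eq_Zsum => t _; rewrite /Phi mulr_suml; apply: eq_bigr => r _.
  have -> : (nsum b (j :: t) - b j)%N = nsum b t by rewrite /nsum big_cons addKn.
  by rewrite /= !mulrA.
by rewrite mulr_sumr; apply: eq_bigr => r _; ring.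
Qed.

Lemma Zsum_ffact_rec_shift J l (F : nat -> R) : (0 < l)%N ->
  (J <= n)%:R * Z (n - J) (fun t => (nsum b t ^_ l)%:R * F (size t)) =
  \sum_(1 <= r < l.+1) 'C(l.-1, r.-1)%:R * \sum_(1 <= j < n.+1)
    theta * ((b j ^_ r)%:R / j%:R) * ((J + j <= n)%:R *
      Z (n - (J + j)) (fun t => (nsum b t ^_ (l - r))%:R * F (size t).+1)).
Proof.
move=> l0; rewrite Zsum_ffact_rec // mulr_sumr; apply: eq_bigr => r _.
rewrite mulrCA; congr (_ * _); rewrite (@big_nat_trunc _ (n - J) n) ?leq_subr // mulr_sumr.
apply: eq_bigr => j _; rewrite subnDA.
have [Jn|nJ] := leqP J n; last first.
  by rewrite mul0r leqNgt (leq_trans nJ (leq_addr _ _)) mul0r mulr0.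
by rewrite leq_subRL // mul1r; move: (_%:R) (Z _ _) (j%:R^-1) => x y z; ring.
Qed.

(** [J] is the total length already marked. Each marked cycle absorbs [r >= 1] factors, so the
    induction on [l] stops after at most [l] markings. *)
Lemma Zsum_ffact_fexpand l J :
  (J <= n)%:R * Z (n - J) (fun t => (nsum b t ^_ l)%:R) =
  \sum_(0 <= u < l.+1) theta ^+ u *
    fexpand u l (fun K => (J + K <= n)%:R * c (n - (J + K))).
Proof.
elim/ltn_ind: l J => -[|l] IH J.
  rewrite big_nat1 /= expr0 !mul1r addn0; congr (_ * _).
rewrite big_nat_recl // /= !mul0r mulr0 add0r.
have e m s : Z s (fun t => (nsum b t ^_ m)%:R) =
    Z s (fun t => (nsum b t ^_ m)%:R * 1).
  by apply: eq_Zsum => t _; rewrite mulr1.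
rewrite e (Zsum_ffact_rec_shift J (fun=> 1)) //.
transitivity (\sum_(0 <= u < l.+1) \sum_(1 <= r < l.+2) 'C(l, r.-1)%:R *
  \sum_(1 <= j < n.+1) theta * ((b j ^_ r)%:R / j%:R) * (theta ^+ u *
    fexpand u (l.+1 - r) (fun K => (J + j + K <= n)%:R * c (n - (J + j + K))))).
  rewrite exchange_big /= !big_nat; apply: eq_bigr => r /andP[r1 rl].
  rewrite -mulr_sumr exchange_big /=; congr (_ * _); apply: eq_bigr => j _.
  rewrite -mulr_sumr -e IH; last by rewrite ltn_subrL r1.
  congr (_ * _); rewrite [RHS](@big_cat_nat _ _ _ (l.+1 - r).+1) //=; last by rewrite ltn_subrL r1.
  rewrite [X in _ + X]big_nat [X in _ + X]big1 ?addr0 // => u /andP[lu _].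
  by rewrite fexpand_gt // mulr0.
apply: eq_bigr => u _; rewrite mulr_sumr; apply: eq_bigr => r _.
rewrite mulrCA; congr (_ * _); rewrite mulr_sumr; apply: eq_bigr => j _.
rewrite exprS; under [in RHS]eq_fexpand do rewrite addnA.
by ring.
Qed.

(** When the marked cycles use up all [n] points they form the whole permutation, which then has
    exactly [u] cycles. *)
Lemma fexpand_full_le u l J :
  theta ^+ u * fexpand u l (fun K => (J + K == n)%N%:R) <=
  (J <= n)%:R * Z (n - J) (fun t => (nsum b t ^_ l)%:R * (size t == u)%:R).
Proof.
elim: u l J => [|u IH] l J.
  have -> : fexpand 0 l (fun K => (J + K == n)%N%:R) = (l == 0%N)%:R * (J == n)%:R.
    by rewrite /fexpand addn0.
  rewrite expr0 mul1r; case: (J =P n) => [->|_]; last first.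
    by rewrite mulr0 mulr_ge0 // Zsum_ge0 // => t _; rewrite mulr_ge0.
  rewrite leqnn mul1r mulr1 subnn Zsum0 /= mulr1 /nsum big_nil.
  by case: l => [|l]; rewrite ?ffactn0 // ffactnS mul0n.
case: l => [|l].
  by rewrite /= big_geq // mulr0 mulr_ge0 // Zsum_ge0 // => t _; rewrite mulr_ge0.
rewrite (Zsum_ffact_rec_shift J (fun s => (s == u.+1)%:R)) //= mulr_sumr.
apply: ler_sum => r _; rewrite mulrCA ler_wpM2l // mulr_sumr; apply: ler_sum => j _.
have -> : theta ^+ u.+1 * ((b j ^_ r)%:R / j%:R *
     fexpand u (l.+1 - r) (fun K => (J + (j + K) == n)%N%:R)) =
   theta * ((b j ^_ r)%:R / j%:R) * (theta ^+ u *
     fexpand u (l.+1 - r) (fun K => (J + j + K == n)%N%:R)).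
  rewrite exprS; under [in RHS]eq_fexpand do rewrite -addnA.
  by ring.
apply: ler_wpM2l; first by rewrite mulr_ge0 ?divr_ge0 // ltW.
exact: IH.
Qed.

End Expansion.

(** * Uniform bounds and the replacement of [psi] by the power *)

Lemma expn_le_base e m n : (m <= n)%N -> (m ^ e <= n ^ e)%N.
Proof. by case: e => // e mn; rewrite leq_exp2r. Qed.

Section MomentKernel.
Variables (R : realType) (theta : R).
Hypothesis theta1 : 1 <= theta.
Local Notation c := (Zc theta).
Local Notation psi := (psi theta).
Local Notation E := (Ew theta).

Let theta0 : 0 < theta. Proof. exact: lt_le_trans theta1. Qed.
Let c0 n : 0 < c n := Zc_gt0 theta0 n.

(** Each of the [u] layers has at most [l0] values of [r], a binomial at most [2^l0], a falling
    factorial at most [m^l0] and harmonic weight at most [C]. *)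
Lemma fexpand1_le n b u l l0 m (C : R) : (l <= l0)%N -> (0 < m)%N ->
  (forall j, (b j <= m)%N) ->
  \sum_(1 <= j < n.+1) (b j != 0%N)%:R / j%:R <= C ->
  fexpand n b u l (fun=> 1 : R) <= ((l0 * (2 ^ l0 * m ^ l0))%:R * C) ^+ u.
Proof.
move=> ll0 m0 bm bC; have C0 : 0 <= C.
  by apply: le_trans bC; apply: sumr_ge0 => j _; rewrite divr_ge0.
elim: u l ll0 => [|u IH] l ll0 /=; first by rewrite mulr1 expr0 lern1 leq_b1.
set A := _ * C; have A0 : 0 <= A by rewrite mulr_ge0.
apply: le_trans (_ : \sum_(1 <= r < l.+1) (2 ^ l0)%:R * ((m ^ l0)%:R * C * A ^+ u) <= _).
  rewrite !big_nat; apply: ler_sum => r /andP[r1 rl].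
  have S0 : 0 <= \sum_(1 <= j < n.+1) (b j ^_ r)%:R / j%:R *
      fexpand n b u (l - r) (fun=> 1 : R).
    by apply: sumr_ge0 => j _; rewrite mulr_ge0 ?divr_ge0 // fexpand_ge0.
  apply: ler_pM => //.
    rewrite ler_nat; apply: leq_trans (bin_le_exp2 _ _) _; rewrite leq_exp2l //.
    by rewrite (leq_trans (leq_pred l)).
  apply: le_trans (_ : \sum_(1 <= j < n.+1) (b j != 0%N)%:R / j%:R * ((m ^ l0)%:R * A ^+ u) <= _).
    rewrite !big_nat; apply: ler_sum => j /andP[j1 jn].
    rewrite [leRHS](_ : _ = (b j != 0%N)%:R * (m ^ l0)%:R / j%:R * A ^+ u); last by ring.
    apply: ler_pM; rewrite ?divr_ge0 ?fexpand_ge0 //.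
      rewrite ler_wpM2r ?invr_ge0 // -natrM ler_nat.
      case: (posnP (b j)) => [->|b0].
        by case: r r1 {S0 rl} => // r _; rewrite ffactnS mul0n.
      rewrite /= mul1n; apply: leq_trans (ffact_le_expn _ _) _.
      apply: leq_trans (expn_le_base r (bm j)) _; apply: leq_pexp2l => //.
      by rewrite -ltnS (leq_trans rl) // ltnS.
    by apply: IH; rewrite (leq_trans (leq_subr _ _)).
  rewrite -mulr_suml [leRHS](_ : _ = C * ((m ^ l0)%:R * A ^+ u)); last by ring.
  by rewrite ler_wpM2r // mulr_ge0 // exprn_ge0.
rewrite sumr_const_nat subn1 /= exprS -[leLHS]mulr_natl.
rewrite [leRHS](_ : _ = l0%:R * ((2 ^ l0)%:R * ((m ^ l0)%:R * C * A ^+ u))); last first.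
  by rewrite {1}/A !natrM; ring.
apply: ler_wpM2r; last by rewrite ler_nat.
by rewrite !mulr_ge0 // exprn_ge0.
Qed.

Lemma Ew_ffact n b l : E n (fun t => (nsum b t ^_ l)%:R) =
  \sum_(0 <= u < l.+1) theta ^+ u * fexpand n b u l (fun K => (K <= n)%:R * psi n K).
Proof.
have := @Zsum_ffact_fexpand R theta n b l 0; rewrite mul1r subn0 => h.
rewrite /Ew h mulr_suml; apply: eq_bigr => u _; rewrite -mulrA; congr (_ * _).
rewrite mulrC -fexpandZ; apply: eq_fexpand => K; rewrite add0n /@psi.
by rewrite mulrC mulrA.
Qed.

(** Chebyshev for the number of cycles, whose mean grows with [log n] while its variance is at most
    the mean. *)
Lemma few_cycles l (d : R) : 0 < d -> exists n0 : nat, forall n, (n0 <= n)%N ->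
  E n (fun t => (size t <= l)%N%:R) <= d.
Proof.
move=> d0; pose eta := powR (1 / 2 : R) (theta - 1).
have eta0 : 0 < eta by rewrite powR_gt0 // divr_gt0.
have [k [k0 hk]] := nat_ge (2 * (2 * l%:R + 4 / d) / eta).
exists (2 * 2 ^ k)%N => n kn.
pose M : R := E n (cyc (fun=> 1 : R)).
have kp : (0 < 2 ^ k)%N by rewrite expn_gt0.
have M1 : 2 * l%:R + 4 / d <= M.
  apply: le_trans (_ : k%:R / 2 * eta <= _).
    by rewrite ler_pdivrMr // in hk; lra.
  rewrite /M Ew_cyc //.
  have hd := @harmonic_dyadic R 1 k isT; rewrite mul1n in hd.
  apply: le_trans (ler_wpM2r (ltW eta0) hd) _; rewrite mulr_suml.
  apply: le_trans (_ : \sum_(1 <= j < 2 ^ k) kmean theta n j * 1 <= _); last first.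
    apply: le_sum_subrange => // [j|]; first by rewrite mulr1 kmean_ge0.
    by apply: leq_trans (leq_trans _ kn) _ => //; rewrite leq_pmull.
  rewrite !big_nat; apply: ler_sum => j /andP[j1 jk].
  have jn : (2 * j <= n)%N by rewrite (leq_trans _ kn) // leq_mul2l ltnW.
  have jn' : (j < n)%N by apply: leq_trans jn; rewrite mul2n -addnn -addn1 leq_add2l.
  rewrite mulr1 /kmean (ltnW jn') mul1r; apply: ler_pM.
  - by rewrite invr_ge0.
  - exact: ltW.
  - apply: le_trans (_ : j%:R^-1 <= _); last by rewrite ler_peMl.
    by rewrite lef_pV2 ?posrE ?ltr0n // ler_nat.
  - apply: psi_ge_frac => //; have : (2 * j)%:R <= n%:R :> R by rewrite ler_nat.
    by rewrite natrM; lra.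
have d4 : 0 < 4 / d by rewrite divr_gt0.
have l0 : 0 <= l%:R :> R by [].
have M0 : 0 < M by lra.
have V : E n (fun t => cyc (fun=> 1 : R) t ^+ 2) <= M * (M + 1).
  by apply: Ew_cyc_sqr => //.
have pos : forall t, is_comp n t -> 0 <= cyc (fun=> 1 : R) t.
  by move=> t _; apply: cyc_ge0.
have I01 (t : seq nat) : (size t <= l)%N%:R = 0 :> R \/ (size t <= l)%N%:R = 1 :> R.
  by case: leqP; [right|left].
have := Ew_cheb theta1 M0 pos I01; rewrite -/M.
set P := E n (fun t => (size t <= l)%N%:R); set V2 := E n _ in V *.
have XI : E n (fun t => cyc (fun=> 1 : R) t * (size t <= l)%N%:R) <= l%:R * P.
  rewrite -EwZ; apply: le_Ew => // t _; case: leqP => tl; last by rewrite !mulr0.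
  by rewrite !mulr1 /cyc big_const_seq iter_addr_0 count_predT ler_nat.
move=> h; have {}h := le_trans h XI.
have h2 : 2 / M * (V2 - 2 * M * M + M ^+ 2) <= 2.
  by rewrite -mulrA -[leRHS]mulr1 ler_pM2l // ler_pdivrMl // expr2; lra.
have P0 : 0 <= P by apply: Ew_ge0.
have : (M / 2 - l%:R) * P <= 2 by lra.
move=> h3; have h4 : 2 / d * P <= 2.
  apply: le_trans h3; apply: ler_wpM2r => //; lra.
by rewrite -ler_pdivlMl ?divr_gt0 // invf_div divfK in h4.
Qed.

(** For [l > 0] and [b = b_j(m)] this is [Upsilon_n(l,m)]. Total length [n] is excluded here,
    whereas the exact moment includes it. *)
Definition kernel_sum n b l : R := \sum_(0 <= u < l.+1) theta ^+ u *
  fexpand n b u l (fun K => (K < n)%:R * powR (1 - K%:R / n%:R) (theta - 1)).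

Lemma moment_bounded l m (C : R) : (0 < m)%N -> exists K : R, forall n b,
  (forall j, (b j <= m)%N) ->
  \sum_(1 <= j < n.+1) (b j != 0%N)%:R / j%:R <= C ->
  \sum_(0 <= u < l.+1) theta ^+ u * fexpand n b u l (fun=> 1 : R) <= K.
Proof.
move=> m0; exists (\sum_(0 <= u < l.+1) theta ^+ u * ((l * (2 ^ l * m ^ l))%:R * C) ^+ u).
move=> n b bm bC; apply: ler_sum => u _; rewrite ler_wpM2l ?exprn_ge0 ?(ltW theta0) //.
exact: fexpand1_le.
Qed.

Lemma Ew_ffact_bounded l m (C : R) : (0 < m)%N -> exists K : R, forall n b,
  (forall j, (b j <= m)%N) ->
  \sum_(1 <= j < n.+1) (b j != 0%N)%:R / j%:R <= C ->
  E n (fun t => (nsum b t ^_ l)%:R) <= K.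
Proof.
move=> m0; have [K hK] := moment_bounded l C m0; exists K => n b bm bC.
rewrite Ew_ffact; apply: le_trans (hK n b bm bC); apply: ler_sum => u _.
rewrite ler_wpM2l ?exprn_ge0 ?(ltW theta0) //; apply: le_fexpand => J.
by case: leqP => _; rewrite ?mul0r // mul1r psi_le1.
Qed.

Lemma moment_kernel_close l m (C d : R) : (0 < m)%N -> 0 < d ->
  exists n0 : nat, forall n b, (n0 <= n)%N -> (forall j, (b j <= m)%N) ->
  \sum_(1 <= j < n.+1) (b j != 0%N)%:R / j%:R <= C ->
  `|kernel_sum n b l - E n (fun t => (nsum b t ^_ l)%:R)| <= d.
Proof.
move=> m0 d0; have [K hK] := moment_bounded l C m0.
pose K1 := `|K| + 1; have K10 : 0 < K1 by rewrite ltr_wpDl.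
have Kd : 0 < d / 2 / K1 by rewrite !divr_gt0.
have [n1 h1] := psi_powR_close theta1 Kd.
pose S : R := ((m * l) ^ l)%:R; have S0 : 0 <= S by [].
have Sd : 0 < d / 2 / (S + 1) by rewrite !divr_gt0 // ltr_wpDl.
have [n2 h2] := few_cycles l Sd.
exists (maxn n1 n2) => n b; rewrite geq_max => /andP[nn1 nn2] bm bC.
pose w0 J : R := (J < n)%:R * powR (1 - J%:R / n%:R) (theta - 1).
pose w1 J : R := (J <= n)%:R * psi n J.
have w01 J : w0 J <= w1 J.
  rewrite /w0 /w1; case: (ltnP J n) => Jn.
    by rewrite (ltnW Jn) !mul1r psi_ge.
  by rewrite mul0r mulr_ge0 // psi_ge0.
(* Two errors: a uniform one, multiplied by a bounded sum, and the missing term at total length [n],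
   which is controlled by the rarity of permutations with at most [l] cycles. *)
have w10 J : w1 J <= w0 J + (d / 2 / K1 * 1 + (c n)^-1 * (J == n)%N%:R).
  rewrite /w0 /w1; case: (ltngtP J n) => Jn /=.
  - by rewrite !mul1r mulr0 addr0 mulr1 h1.
  - by rewrite !mul0r mulr0 addr0 mulr1 add0r ltW.
  - rewrite Jn mul0r add0r !mulr1 mul1r /@psi subnn Zc0 mul1r lerDr; exact: ltW.
rewrite Ew_ffact distrC ger0_norm; last first.
  rewrite subr_ge0; apply: ler_sum => u _.
  by rewrite ler_wpM2l ?exprn_ge0 ?(ltW theta0) //; apply: le_fexpand.
rewrite lerBlDl; apply: le_trans (_ : \sum_(0 <= u < l.+1) theta ^+ u * (fexpand n b u l w0 +
   (d / 2 / K1 * fexpand n b u l (fun=> 1 : R) + (c n)^-1 * fexpand n b u l (fun K => (K == n)%N%:R))) <= _).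
  apply: ler_sum => u _; rewrite ler_wpM2l ?exprn_ge0 ?(ltW theta0) //.
  by rewrite -!fexpandZ -!fexpandD; apply: le_fexpand.
under eq_bigr do rewrite !mulrDr.
rewrite !big_split /= lerD2l.
rewrite [leRHS](_ : d = d / 2 + d / 2); last by lra.
apply: lerD.
  under eq_bigr do rewrite mulrCA.
  rewrite -mulr_sumr; apply: le_trans (_ : d / 2 / K1 * K1 <= _); last by rewrite divfK // gt_eqF.
  apply: (ler_wpM2l (ltW Kd)); apply: le_trans (hK n b bm bC) _.
  by rewrite (le_trans (ler_norm K)) // lerDl.
under eq_bigr do rewrite mulrCA.
rewrite -mulr_sumr mulrC ler_pdivrMr //.
apply: le_trans (_ : \sum_(0 <= u < l.+1)
    Zsum theta n (fun t => (nsum b t ^_ l)%:R * (size t == u)%:R) <= _).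
  apply: ler_sum => u _; have := fexpand_full_le theta1 n b u l 0.
  by rewrite mul1r subn0.
rewrite -Zsum_sum; apply: le_trans (_ : Zsum theta n (fun t => S * (size t <= l)%N%:R) <= _).
  apply: le_Zsum => // t _; rewrite -mulr_sumr.
  have -> : \sum_(0 <= u < l.+1) ((size t == u)%:R : R) = (size t <= l)%N%:R.
    case: leqP => tl.
      rewrite (bigD1_seq (size t)) ?mem_index_iota ?iota_uniq //= eqxx big1 ?addr0 // => i.
      by rewrite eq_sym => /negbTE ->.
    rewrite big_nat big1 // => u ul; case: eqP => // e.
    by move: ul; rewrite -e /= ltnNge tl.
  case: leqP => tl; last by rewrite !mulr0.
  rewrite !mulr1 ler_nat; apply: leq_trans (ffact_le_expn _ _) _; apply: expn_le_base.
  apply: (@leq_trans (m * size t)); last by rewrite leq_mul2l tl orbT.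
  rewrite /nsum; elim: {tl} t => [|i t IH]; first by rewrite big_nil.
  by rewrite big_cons /= mulnS leq_add.
rewrite ZsumZ -ler_pdivrMr // -mulrA.
apply: le_trans (ler_wpM2l S0 (h2 n nn2)) _.
rewrite mulrA ler_pdivrMr; last by rewrite ltr_wpDl.
by rewrite mulrC ler_wpM2l ?divr_ge0 ?(ltW d0) // lerDl.
Qed.

End MomentKernel.

(** * The multiple sums of [Upsilon] in recursive form *)

Section PeelFfun.
Variable T : finType.

Definition ffcons u (x : T) (g : {ffun 'I_u -> T}) : {ffun 'I_u.+1 -> T} :=
  [ffun i => if unlift ord0 i is Some k then g k else x].

Lemma ffcons0 u x (g : {ffun 'I_u -> T}) : ffcons x g ord0 = x.
Proof. by rewrite ffunE unlift_none. Qed.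

Lemma ffconsS u x (g : {ffun 'I_u -> T}) i : ffcons x g (lift ord0 i) = g i.
Proof. by rewrite ffunE liftK. Qed.

Lemma sum_ffcons (V : nmodType) u (F : {ffun 'I_u.+1 -> T} -> V) :
  \sum_f F f = \sum_x \sum_g F (ffcons x g).
Proof.
rewrite pair_bigA /= (reindex (fun p : T * {ffun 'I_u -> T} => ffcons p.1 p.2)) //=.
exists (fun f => (f ord0, [ffun i => f (lift ord0 i)])).
  move=> [x g] _ /=; rewrite ffcons0; congr (_, _); apply/ffunP => i.
  by rewrite ffunE ffconsS.
move=> f _; apply/ffunP => i /=; rewrite ffunE; case: (unliftP ord0 i) => [k ->|->] //.
by rewrite ffunE.
Qed.

Lemma forall_ord_recl u (P : pred 'I_u.+1) :
  [forall i, P i] = P ord0 && [forall i, P (lift ord0 i)].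
Proof.
apply/forallP/andP => [h|[h0 /forallP hS] i].
  by split; [exact: h|apply/forallP => i; exact: h].
by case: (unliftP ord0 i) => [k ->|->].
Qed.

Lemma sum_ffun0 (V : nmodType) (F : {ffun 'I_0 -> T} -> V) :
  \sum_f F f = F (ffun0 (card_ord 0)).
Proof.
rewrite (big_pred1 (ffun0 (card_ord 0))) // => f; apply/esym/eqP/ffunP.
by case.
Qed.

End PeelFfun.

Section UpsilonExpand.
Variables (R : realType) (n m L : nat) (b : nat -> nat).
Hypothesis bm : forall j, (b j <= m)%N.

Let Q (u l : nat) (w : nat -> R) : R :=
  \sum_(r : {ffun 'I_u -> 'I_L})
    ([forall i, (1 <= r i <= m)%N] && (\sum_(i < u) (r i : nat) == l)%N)%:R *
    ((\prod_(i < u) 'C(l - \sum_(k < u | (k < i)%N) (r k : nat) - 1, (r i).-1))%:R *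
     \sum_(j : {ffun 'I_u -> 'I_n}) [forall i, (1 <= j i)%N]%:R *
       ((\prod_(i < u) (b (j i)) ^_ (r i))%:R / (\prod_(i < u) (j i : nat))%:R *
        w (\sum_(i < u) (j i : nat))%N)).

Lemma ffun_sum_fexpand u l w : (l < L)%N -> (forall J, (n <= J)%N -> w J = 0) ->
  Q u l w = fexpand n b u l w.
Proof.
elim: u l w => [|u IH] l w lL wn.
  rewrite /Q sum_ffun0 sum_ffun0 !big_ord0 /= eq_sym.
  have all0 (P : pred 'I_0) : [forall i, P i] = true by apply/forallP => -[].
  by rewrite !all0 /= !mul1r invr1 mul1r.
have sumS (T : finType) (x : T) (g : {ffun 'I_u -> T}) (v : T -> nat) :
    (\sum_(i < u.+1) v (ffcons x g i) = v x + \sum_(i < u) v (g i))%N.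
  by rewrite big_ord_recl ffcons0; congr addn; apply: eq_bigr => i _; rewrite ffconsS.
(* From the second indicator bracket on, this is the summand for [u] coordinates with [l - r0] for
   [l] and the weight shifted by [j0]. *)
pose core r0 j0 (r : {ffun 'I_u -> 'I_L}) (j : {ffun 'I_u -> 'I_n}) : R :=
  ((1 <= r0 <= m) && (r0 <= l))%N%:R * ('C(l.-1, r0.-1)%:R * ((1 <= j0)%N%:R *
    ((b j0 ^_ r0)%:R / j0%:R *
      (([forall i, (1 <= r i <= m)%N] && (\sum_(i < u) (r i : nat) == l - r0)%N)%:R *
      ((\prod_(i < u) 'C(l - r0 - \sum_(k < u | (k < i)%N) (r k : nat) - 1, (r i).-1))%:R *
       ([forall i, (1 <= j i)%N]%:R *
       ((\prod_(i < u) (b (j i)) ^_ (r i))%:R / (\prod_(i < u) (j i : nat))%:R *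
        w (j0 + \sum_(i < u) (j i : nat))%N))))))).

rewrite /Q sum_ffcons /=.
transitivity (\sum_(r0 < L) \sum_(j0 < n) \sum_(r : {ffun 'I_u -> 'I_L})
    \sum_(j : {ffun 'I_u -> 'I_n}) core r0 j0 r j).
  apply: eq_bigr => r0 _; rewrite [RHS]exchange_big /=; apply: eq_bigr => r _.
  rewrite sum_ffcons /= 2!mulr_sumr; apply: eq_bigr => j0 _.
  rewrite 2!mulr_sumr; apply: eq_bigr => j _.
  have e1 : [forall i, (1 <= ffcons r0 r i <= m)%N] =
      (1 <= r0 <= m)%N && [forall i, (1 <= r i <= m)%N].
    by rewrite forall_ord_recl ffcons0; congr andb; apply: eq_forallb => i; rewrite ffconsS.
  have e2 : [forall i, (1 <= ffcons j0 j i)%N] = (1 <= j0)%N && [forall i, (1 <= j i)%N].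
    by rewrite forall_ord_recl ffcons0; congr andb; apply: eq_forallb => i; rewrite ffconsS.
  have e3 : (\prod_(i < u.+1) b (ffcons j0 j i) ^_ (ffcons r0 r i) =
      b j0 ^_ r0 * \prod_(i < u) b (j i) ^_ (r i))%N.
    by rewrite big_ord_recl !ffcons0; congr muln; apply: eq_bigr => i _; rewrite !ffconsS.
  have e4 : (\prod_(i < u.+1) (ffcons j0 j i : nat) = j0 * \prod_(i < u) (j i : nat))%N.
    by rewrite big_ord_recl ffcons0; congr muln; apply: eq_bigr => i _; rewrite ffconsS.
  have e5 : (\prod_(i < u.+1) 'C(l - \sum_(k < u.+1 | (k < i)%N) (ffcons r0 r k : nat) - 1,
        (ffcons r0 r i).-1) = 'C(l.-1, r0.-1) *
      \prod_(i < u) 'C(l - r0 - \sum_(k < u | (k < i)%N) (r k : nat) - 1, (r i).-1))%N.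
    rewrite big_ord_recl ffcons0 big_pred0 // subn0 subn1; congr muln.
    apply: eq_bigr => i _; rewrite ffconsS big_mkcond big_ord_recl ffcons0 /= subnDA.
    rewrite [in RHS]big_mkcond; congr (binomial (_ - _ - _ - _) _).
    by apply: eq_bigr => k _; rewrite ffconsS.
  have e6 : (r0 + \sum_(i < u) (r i : nat) == l)%N =
      (r0 <= l)%N && (\sum_(i < u) (r i : nat) == l - r0)%N.
    case: leqP => r0l; first by rewrite -{1}(subnKC r0l) eqn_add2l.
    by rewrite gtn_eqF // (leq_trans r0l) // leq_addr.
  rewrite /core e1 e2 e3 e4 e5 (sumS _ r0 r (@nat_of_ord L)) (sumS _ j0 j (@nat_of_ord n)) e6.
  rewrite -!mulnb !natrM invfM.
  move: (w _) (_^-1) (_^-1) => ww x1 x2; ring.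
transitivity (\sum_(0 <= r < L) ((1 <= r <= m) && (r <= l))%N%:R * ('C(l.-1, r.-1)%:R *
   \sum_(0 <= j < n) (1 <= j)%N%:R * ((b j ^_ r)%:R / j%:R * Q u (l - r) (fun J => w (j + J)%N)))).
  rewrite big_mkord; apply: eq_bigr => r0 _; rewrite big_mkord 2!mulr_sumr.
  apply: eq_bigr => j0 _; rewrite /Q 4!mulr_sumr; apply: eq_bigr => r _.
  by rewrite 6!mulr_sumr; apply: eq_bigr => j _.
have w0 l' w' : (forall J, w' J = 0) -> fexpand n b u l' w' = 0.
  move=> w'0; rewrite (eq_fexpand n b u l' (w' := fun J => 0 * w' J)) => [|J].
    by rewrite fexpandZ mul0r.
  by rewrite mul0r.
rewrite /= (@big_cat_nat _ _ _ 1) //=; last by rewrite (leq_trans _ lL).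
rewrite big_nat1 mul0r add0r (@big_cat_nat _ _ _ l.+1) //=.
rewrite [X in _ + X]big_nat [X in _ + X]big1 ?addr0; last first.
  by move=> r /andP[lr _]; rewrite [(r <= l)%N]leqNgt lr andbF mul0r.
rewrite !big_nat; apply: eq_bigr => r /andP[r1 rl].
rewrite r1 (rl : (r <= l)%N) andbT /=; case: (leqP r m) => rm; last first.
  rewrite mul0r big1 ?mulr0 // => j _.
  by rewrite ffact_small ?mul0r // (leq_ltn_trans (bm j)).
rewrite mul1r; congr (_ * _); case: (posnP n) => [n0|n0].
  by rewrite n0 !big_geq.
rewrite big_ltn // ltnn mul0r add0r big_nat_recr //= [fexpand n b u (l - r) (fun J => w (n + J)%N)]w0; last first.
  by move=> J; rewrite wn // leq_addr.
rewrite mulr0 addr0 !big_nat; apply: eq_bigr => j /andP[j1 _].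
rewrite j1 mul1r IH // => [|J nJ]; first by rewrite (leq_ltn_trans (leq_subr _ _)).
by rewrite wn // (leq_trans nJ) // leq_addl.
Qed.

End UpsilonExpand.

Lemma Upsilon_kernel_sum (R : realType) (theta : R) a n l m : (0 < l)%N ->
  Upsilon theta a n l m = kernel_sum theta n (bj a n m) l.
Proof.
move=> l0; rewrite /kernel_sum big_ltn //= eqn0Ngt l0 mul0r mulr0 add0r.
have bm j : (bj a n m j <= m)%N by rewrite /bj; case: (a n j) => // k; rewrite geq_minr.
apply: eq_bigr => u _; congr (_ * _).
rewrite -(@ffun_sum_fexpand R n m l.+1 _ bm) //; last first.
  by move=> J nJ; rewrite ltnNge nJ mul0r.
rewrite big_mkcond /=; apply: eq_bigr => r _; case: (_ && _); rewrite ?mul0r ?mul1r //.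
congr (_ * _); rewrite big_mkcond /=; apply: eq_bigr => j _.
case: [forall i, _]; rewrite /= ?mul0r // mul1r.
by case: ltnP => _; rewrite ?mul0r ?mulr0 // mul1r.
Qed.

(** * Passage to the limit *)

Section WeakLimit.
Variables (R : realType) (p : nat -> R).

Lemma FY_series k x : (k%:R - 1 < x <= k%:R) -> FY p x = series p k.
Proof.
case/andP=> kx xk; apply: (@lim_near_cst R^o) => //; near=> n.
have kn : (k <= n)%N by near: n; exists k.
rewrite /series /= (big_cat_nat (n := k)) //= [X in _ + X]big_nat [X in _ + X]big1 ?addr0.
  rewrite !big_nat; apply: eq_bigr => i /andP[_ ik].
  by rewrite (le_lt_trans _ kx) // lerBrDr natr1 ler_nat.
move=> i /andP[ki _]; case: ifP => // ix.
by have := lt_le_trans ix xk; rewrite ltr_nat ltnNge ki.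
Unshelve. all: by end_near. Qed.

(** [F_Y] is constant on [(k - 1, k]], so midpoints are continuity points, and at them [h < x] means
    [h < k]. Weak convergence is used only there. *)
Lemma FY_continuous k : {for k%:R - 2^-1, continuous (FY p)}.
Proof.
rewrite /prop_for /continuous_at.
have -> : FY p (k%:R - 2^-1) = series p k by apply: FY_series; apply/andP; split; lra.
apply: (@cvg_near_cst _ R^o) => //; near=> y; apply/FY_series/andP.
have /andP[] : k%:R - 1 < y < k%:R.
  near: y; have := near_in_itvoo (a := k%:R - 1) (b := k%:R) (x := k%:R - 2^-1 : R).
  rewrite in_itv /=.
  by move=> -[|U U0 US]; [apply/andP; split; lra|exists U => // y /US; rewrite /= in_itv].
by move=> ? ?; split => //; apply: ltW.
Unshelve. all: by end_near. Qed.

Lemma Tn_Ew (theta : R) a n k : 0 < theta ->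
  Tn theta a n (k%:R - 2^-1) = Ew theta n (fun t => (hsum (a n) t < k%:Z)%R%:R).
Proof.
move=> theta0; rewrite -(ewens_Ew theta0); last first.
  by move=> s t st; rewrite (perm_invariant_hsum _ st).
congr (_ / _); apply: eq_bigl => s; rewrite hfun_ctype /=.
move: (hsum _ _) => x; apply/idP/idP => [xk|].
  rewrite -(ltr_int R); apply: lt_le_trans xk _; rewrite lerBlDr lerDl; lra.
rewrite -lezD1 -(ler_int R) rmorphD /= => xk.
by rewrite ltrBrDr (lt_le_trans _ xk) // ltrD2l; lra.
Qed.

Lemma Ew_hsum_lt (theta : R) a : 0 < theta ->
  (forall x : R, {for x, continuous (FY p)} -> Tn theta a n x @[n --> \oo] --> FY p x) ->
  forall (k : nat) (e : R), 0 < e -> exists n0 : nat, forall n, (n0 <= n)%N ->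
    `|series p k - Ew theta n (fun t => (hsum (a n) t < k%:Z)%R%:R)| <= e.
Proof.
move=> theta0 weak k e e0; have := weak _ (@FY_continuous k).
rewrite (FY_series (k := k)); last by apply/andP; split; lra.
move/cvgrPdist_le => /(_ _ e0)[n0 _ H]; exists n0 => n n0n.
by rewrite -Tn_Ew //; apply: (H n n0n).
Qed.

End WeakLimit.

Section ConvergenceInLaw.
Variables (R : realType) (theta : R) (a : nat -> nat -> int) (p : nat -> R).
Hypothesis theta1 : 1 <= theta.
Hypothesis p_ge0 : forall k, 0 <= p k.
Hypothesis p_sum1 : series p n @[n --> \oo] --> (1 : R).
Hypothesis cvg_law : forall (k : nat) (e : R), 0 < e ->
  exists n0 : nat, forall n, (n0 <= n)%N ->
    `|series p k - Ew theta n (fun t => (hsum (a n) t < k%:Z)%R%:R)| <= e.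

Lemma series_tail (e : R) : 0 < e -> exists k : nat, forall i, (k <= i)%N -> 1 - series p i <= e.
Proof.
move=> e0; move/cvgrPdist_le : p_sum1 => /(_ _ e0)[k _ H].
by exists k => i ki; apply: le_trans (ler_norm _) (H i ki).
Qed.

Lemma series_le1 k : series p k <= 1.
Proof.
rewrite -(cvg_lim _ p_sum1) //; apply: nondecreasing_cvgn_le; last exact: cvgP p_sum1.
by apply: nondecreasing_series => i _ _.
Qed.

Lemma Ew_hsum_gt n (k : nat) : Ew theta n (fun t => (k%:Z < hsum (a n) t)%R%:R) =
  1 - Ew theta n (fun t => (hsum (a n) t < k.+1%:Z)%R%:R).
Proof.
rewrite -[X in X - _](Ew_cst theta1 n) -EwB; apply: eq_Ew => t _.
by rewrite -addn1 PoszD ltzD1 ltNge; case: (_ <= _); rewrite ?subr0 ?subrr.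
Qed.

Lemma exists_atom : exists y0 : nat, 0 < p y0 /\ series p y0 = 0.
Proof.
have [k pk] : exists k, 0 < p k.
  apply/not_existsP => p0; have {}p0 k : p k = 0.
    by apply/eqP; rewrite eq_le p_ge0 andbT leNgt; apply/negP/p0.
  have : series p n @[n --> \oo] --> (0 : R).
    by apply: (@cvg_near_cst _ R^o) => //; apply: nearW => n; rewrite /series /= big1.
  by move/(cvg_unique _ p_sum1) => /(_ (@Rhausdorff R))/eqP; rewrite oner_eq0.
case: (ex_minnP (ex_intro (fun k => 0 < p k) k pk)) => y0 py0 ymin.
exists y0; split => //; rewrite /series /= big_nat big1 // => i /= iy.
apply/eqP; rewrite eq_le p_ge0 andbT leNgt; apply/negP => /ymin.
by rewrite leqNgt iy.
Qed.

Lemma law_below_eps (k : nat) (e : R) : series p k = 0 -> 0 < e ->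
  exists n0 : nat, forall n, (n0 <= n)%N ->
    Ew theta n (fun t => (hsum (a n) t < k%:Z)%R%:R) <= e.
Proof.
move=> pk /(cvg_law k)[n0 H]; exists n0 => n /H; rewrite pk sub0r normrN.
exact/le_trans/ler_norm.
Qed.

Lemma law_tight (e : R) : 0 < e -> exists K n0 : nat, forall n, (n0 <= n)%N ->
  Ew theta n (fun t => (K%:Z < hsum (a n) t)%R%:R) <= e.
Proof.
move=> e0; have e20 : 0 < e / 2 by rewrite divr_gt0.
have [K tailK] := series_tail e20; have [n0 H] := cvg_law K.+1 e20.
exists K, n0 => n /H; rewrite Ew_hsum_gt ler_norml => /andP[_].
by have := tailK K.+1 (leqnSn _); lra.
Qed.

(** The least atom of [Y] is taken. [P(h = y0)] is a difference of two probabilities, each within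
    [p y0 / 4] of its limit, which leaves at least [p y0 / 2]. *)
Lemma law_atom : exists (y0 : nat) (p0 : R), [/\ 0 < p0 <= 1, series p y0 = 0 &
  exists n0 : nat, forall n, (n0 <= n)%N ->
    p0 <= Ew theta n (fun t => (hsum (a n) t == y0)%:R)].
Proof.
have [y0 [py0 sy0]] := exists_atom; exists y0, (p y0 / 2).
have p4 : 0 < p y0 / 4 by rewrite divr_gt0.
have sy1 : series p y0.+1 = p y0.
  by move: sy0; rewrite /series /= => sy0; rewrite big_nat_recr //= sy0 add0r.
have py1 : p y0 <= 1 by rewrite -sy1 series_le1.
split => //; first by apply/andP; split; lra.
have [n0 H0] := cvg_law y0 p4; have [n1 H1] := cvg_law y0.+1 p4.
exists (maxn n0 n1) => n; rewrite geq_max => /andP[/H0 h0 /H1 h1].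
have -> : Ew theta n (fun t => (hsum (a n) t == y0)%:R) =
    Ew theta n (fun t => (hsum (a n) t < y0.+1%:Z)%R%:R) -
    Ew theta n (fun t => (hsum (a n) t < y0%:Z)%R%:R).
  rewrite -EwB; apply: eq_Ew => t _; rewrite -addn1 PoszD ltzD1.
  by case: ltgtP => _; rewrite ?subr0 ?subrr.
move: h0 h1; rewrite sy0 sy1 !ler_norml => /andP[? ?] /andP[? ?]; lra.
Qed.

Lemma law_below0 (e : R) : 0 < e -> exists n0 : nat, forall n, (n0 <= n)%N ->
  Ew theta n (fun t => (hsum (a n) t < 0)%R%:R) <= e.
Proof. by apply: law_below_eps; rewrite /series /= big_geq. Qed.

Lemma law_nonzero_weight : exists (C : R) (n0 : nat), forall n, (n0 <= n)%N ->
  \sum_(1 <= j < n.+1) (a n j != 0)%:R / j%:R <= C.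
Proof.
have [y0 [p0 [p01 sy0 aty0]]] := law_atom.
apply: (nonzero_weight_bounded theta1 p01 aty0) => [e||]; first exact: law_below_eps.
- exact: law_below0.
- exact: law_tight.
Qed.

Lemma law_negative_weight (e : R) : 0 < e -> exists n0 : nat, forall n, (n0 <= n)%N ->
  \sum_(1 <= j < n.+1) (a n j < 0)%R%:R / j%:R * psi theta n j <= e.
Proof.
have [y0 [p0 [p01 sy0 aty0]]] := law_atom.
apply: (negative_weight_to0 theta1 p01 aty0) => [d||]; first exact: law_below_eps.
- exact: law_below0.
- exact: law_tight.
Qed.

Lemma negative_weight_cvg0 :
  (\sum_(1 <= j < n) (if a n j <= -1 then 1 else 0) / j%:R *
     powR (1 - j%:R / n%:R) (theta - 1)) @[n --> \oo] --> (0 : R).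
Proof.
apply/cvgrPdist_le => e e0; have [n0 H] := law_negative_weight e0.
exists (maxn n0 1) => // n /=; rewrite geq_max => /andP[n0n n1].
rewrite sub0r normrN ger0_norm; last first.
  by rewrite sumr_ge0 // => j _; rewrite mulr_ge0 ?powR_ge0 // divr_ge0 //; case: ifP.
apply: le_trans (H n n0n); rewrite [leRHS]big_nat_recr //= -[leLHS]addr0 lerD //; last first.
  by apply: mulr_ge0; [apply: divr_ge0|apply: psi_ge0].
rewrite !big_nat; apply: ler_sum => j /andP[_ jn].
rewrite (_ : (a n j <= -1) = (a n j < 0)); last by rewrite -ltzD1 addNr.
case: (a n j < 0); last by rewrite !mul0r.
by rewrite ler_wpM2l ?psi_ge // divr_ge0.
Qed.

End ConvergenceInLaw.

(** * Truncated factorial moments *)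

Lemma leq_ffact (x y l : nat) : (x <= y)%N -> (x ^_ l <= y ^_ l)%N.
Proof.
by move=> xy; rewrite !ffact_prod; apply: leq_prod => i _; apply: leq_sub2r.
Qed.

(** For [x > k] one has [x_(l+1) = x_(l) (x - l) >= (k - l) x_(l)]: the next factorial moment pays
    for the truncation at [k]. *)
Lemma ffact_minn_le (x k l : nat) : (l < k)%N ->
  ((k - l) * x ^_ l <= (k - l) * minn x k ^_ l + x ^_ l.+1)%N.
Proof.
move=> lk; case: (leqP x k) => [_|kx]; first exact: leq_addr.
by rewrite ffactnSr mulnC (leq_trans _ (leq_addl _ _)) // leq_mul2l leq_sub2r ?orbT // ltnW.
Qed.

Lemma nsum_hsum_ge0 a n m t : (forall c, c \in t -> 0 <= a n c :> int) ->
  (nsum (bj a n m) t)%:Z <= hsum (a n) t.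
Proof.
rewrite /nsum /hsum; elim: t => [|c t IH] a0; first by rewrite !big_nil.
rewrite !big_cons PoszD; apply: lerD; last by apply: IH => d dt; rewrite a0 ?inE ?dt ?orbT.
have := a0 c (mem_head _ _); rewrite /bj; case: (a n c) => // x _.
by rewrite lez_nat geq_minl.
Qed.

Lemma nsum_hsum a n m t : (forall c, c \in t -> 0 <= a n c :> int) -> hsum (a n) t <= m%:Z ->
  (nsum (bj a n m) t)%:Z = hsum (a n) t.
Proof.
rewrite /nsum /hsum; elim: t => [|c t IH] a0; first by rewrite !big_nil.
have tpos : forall d, d \in t -> 0 <= a n d by move=> d dt; rewrite a0 ?inE ?dt ?orbT.
have t0 : 0 <= \sum_(d <- t) a n d.
  by rewrite big_seq; apply: sumr_ge0 => d /tpos.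
rewrite !big_cons PoszD => hm; have cpos := a0 c (mem_head _ _).
rewrite IH //; last by apply: le_trans hm; rewrite lerDr.
have {hm t0} : a n c <= m%:Z by apply: le_trans hm; rewrite lerDl.
move: cpos; rewrite /bj; case: (a n c) => // x _; rewrite lez_nat => xm.
by rewrite (minn_idPl xm).
Qed.

Section Truncation.
Variables (R : realType) (l : nat).
Hypothesis l0 : (0 < l)%N.

Definition fstep (i : nat) : R := (i.+1 ^_ l)%:R - (i ^_ l)%:R.

(* This is the falling factorial [min(max(x, 0), k)_(l)] in summed form: its average
   is then a combination of the tail probabilities of [x]. *)
Definition ftrunc (k : nat) (x : int) : R := \sum_(0 <= i < k) fstep i * (i%:Z < x)%R%:R.

Lemma fstep_ge0 i : 0 <= fstep i.
Proof. by rewrite subr_ge0 ler_nat leq_ffact. Qed.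

Lemma sum_fstep k : \sum_(0 <= i < k) fstep i = (k ^_ l)%:R.
Proof. by rewrite (telescope_sumr (fun i => (i ^_ l)%:R)) // (ffact_small l0) subr0. Qed.

Lemma ftrunc_nat k (x : nat) : ftrunc k x = (minn x k ^_ l)%:R.
Proof.
elim: k => [|k IH]; first by rewrite /ftrunc big_geq // minn0 (ffact_small l0).
rewrite /ftrunc big_nat_recr //= -/(ftrunc k x) IH ltz_nat.
case: ltnP => kx; last by rewrite mulr0 addr0 !(minn_idPl _) // leqW.
by rewrite mulr1 !(minn_idPr _) ?(ltnW kx) // /fstep subrKC.
Qed.

Variable p : nat -> R.

(** Summation by parts, with [1 - series p i.+1 = P(Y > i)]. *)
Lemma sum_fstep_tail k :
  \sum_(0 <= i < k) fstep i * (1 - series p i.+1) =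
  series (fun j => p j * (j ^_ l)%:R) k + (k ^_ l)%:R * (1 - series p k).
Proof.
rewrite /series /=; elim: k => [|k IH]; first by rewrite !big_geq // (ffact_small l0) mul0r addr0.
rewrite big_nat_recr //= IH [in RHS]big_nat_recr //= [in RHS]big_nat_recr //=.
rewrite /fstep [in LHS]big_nat_recr //=.
by move: (\sum_(0 <= i < k) p i) (\sum_(0 <= i < k) p i * _) => S T; ring.
Qed.

Hypothesis p_ge0 : forall k, 0 <= p k.
Hypothesis p_sum1 : series p n @[n --> \oo] --> (1 : R).
Variable alpha : R.
Hypothesis moment : cvgn (series (fun k => p k * powR k%:R alpha)).
Hypothesis l_alpha : l%:R <= alpha.

Let pl j : R := p j * (j ^_ l)%:R.

Lemma is_cvg_EfallY : cvgn (series pl).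
Proof.
apply: (series_le_cvg (v_ := fun k => p k * powR k%:R alpha)) => // j.
- by rewrite mulr_ge0.
- by rewrite mulr_ge0 ?powR_ge0.
rewrite ler_wpM2l //; case: j => [|j]; first by rewrite (ffact_small l0) powR_ge0.
apply: (@le_trans _ _ (j.+1%:R ^+ l)).
  rewrite -natrX ler_nat ffact_prod -[X in (_ <= _ ^ X)%N](card_ord l) -prod_nat_const.
  by apply: leq_prod => i _; apply: leq_subr.
by rewrite -powR_mulrn ?ler0n // ler_powR // ler1n.
Qed.

Lemma series_le_EfallY k : series pl k <= EfallY p l.
Proof.
apply: nondecreasing_cvgn_le is_cvg_EfallY _.
by apply: nondecreasing_series => i _ _; rewrite mulr_ge0.
Qed.

(** The boundary term [k_(l) P(Y >= k)] is at most the tail of the series for the factorial moment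
    from [k] on. *)
Lemma sum_fstep_tail_le k : \sum_(0 <= i < k) fstep i * (1 - series p i.+1) <= EfallY p l.
Proof.
rewrite sum_fstep_tail -lerBrDl.
have : (k ^_ l)%:R * (series p n - series p k) @[n --> \oo] --> (k ^_ l)%:R * (1 - series p k).
  by apply: cvgMr; apply: cvgB => //; apply: cvg_cst.
move=> H; rewrite -(cvg_lim _ H) //; apply: limr_le; first exact: cvgP H.
exists k => // N /= kN; rewrite lerBrDl; apply: le_trans (series_le_EfallY N).
rewrite /series /= [leRHS](big_cat_nat (n := k)) //= lerD2l (big_cat_nat (n := k)) //=.
rewrite addrAC subrr add0r mulr_sumr !big_nat; apply: ler_sum => j /andP[kj _].
by rewrite mulrC ler_wpM2l // ler_nat leq_ffact.
Qed.

Lemma sum_fstep_tail_ge (e : R) : 0 < e ->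
  exists k : nat, EfallY p l - e <= \sum_(0 <= i < k) fstep i * (1 - series p i.+1).
Proof.
move=> e0; move/cvgrPdist_le : is_cvg_EfallY => /(_ _ e0)[k _ /(_ k (leqnn k)) /=].
rewrite ler_norml => /andP[_ H]; exists k; rewrite sum_fstep_tail.
apply: (@le_trans _ _ (series pl k)); first by move: H; rewrite lerBlDr lerBlDl addrC.
rewrite lerDl mulr_ge0 // subr_ge0; exact: series_le1.
Qed.

End Truncation.

Section FtruncOrder.
Variables (R : realType) (l : nat).
Hypothesis l0 : (0 < l)%N.
Local Notation ftrunc := (ftrunc R l).

Lemma ftrunc_ge0 k x : 0 <= ftrunc k x.
Proof. by apply: sumr_ge0 => i _; rewrite mulr_ge0 ?fstep_ge0. Qed.

Lemma ftrunc_le k x : ftrunc k x <= (k ^_ l)%:R.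
Proof.
rewrite -sum_fstep //; apply: ler_sum => i _.
by case: (_ < _); rewrite ?mulr1 // mulr0 fstep_ge0.
Qed.

Lemma ftrunc_mono k x y : x <= y -> ftrunc k x <= ftrunc k y.
Proof.
move=> xy; apply: ler_sum => i _; rewrite ler_wpM2l ?fstep_ge0 // ler_nat.
by case: (ltP _ x) => // ix; rewrite (lt_le_trans ix xy).
Qed.

Variables (a : nat -> nat -> int) (n m : nat).
Let neg : seq nat -> R := cyc (fun c => (a n c < 0)%R%:R).

Lemma neg_ge1 t : ~~ all (fun c => 0 <= a n c) t -> 1 <= neg t.
Proof.
case/allPn => c ct; rewrite -ltNge => ac; rewrite /neg /cyc (big_rem c) //= ac.
by rewrite lerDl; apply: sumr_ge0.
Qed.

Lemma neg_ge0 t : 0 <= neg t.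
Proof. exact: sumr_ge0. Qed.

(** If some cycle has a negative coefficient, then [neg t >= 1] and the error term alone dominates
    the truncation, which is at most [k_(l)]; otherwise [H <= h]. *)
Lemma ftrunc_nsum_le k t :
  ftrunc k (nsum (bj a n m) t) <= ftrunc k (hsum (a n) t) + (k ^_ l)%:R * neg t.
Proof.
have [/allP a0|/neg_ge1 n1] := boolP (all (fun c => 0 <= a n c) t).
  by rewrite -[leLHS]addr0 lerD ?ftrunc_mono ?nsum_hsum_ge0 // mulr_ge0 ?neg_ge0.
by rewrite -[leLHS]add0r lerD ?ftrunc_ge0 // (le_trans (ftrunc_le _ _)) // ler_peMr.
Qed.

Lemma ftrunc_hsum_le k t : ftrunc k (hsum (a n) t) <=
  ftrunc k (nsum (bj a n m) t) + (k ^_ l)%:R * (neg t + (m%:Z < hsum (a n) t)%R%:R).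
Proof.
have [/allP a0|/neg_ge1 n1] := boolP (all (fun c => 0 <= a n c) t); last first.
  rewrite -[leLHS]add0r lerD ?ftrunc_ge0 // (le_trans (ftrunc_le _ _)) // ler_peMr //.
  by rewrite -[leLHS]addr0 lerD.
case: (ltP m%:Z) => [_|hm].
  rewrite -[leLHS]add0r lerD ?ftrunc_ge0 // (le_trans (ftrunc_le _ _)) // ler_peMr //.
  by rewrite lerDr neg_ge0.
by rewrite nsum_hsum // lerDl mulr_ge0 // addr0 neg_ge0.
Qed.

Lemma ffact_nsum_le k t (b := bj a n m) : (l < k)%N ->
  (nsum b t ^_ l)%:R <= ftrunc k (nsum b t) + (nsum b t ^_ l.+1)%:R / (k - l)%:R.
Proof.
move=> lk; have kl0 : 0 < (k - l)%:R :> R by rewrite ltr0n subn_gt0.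
rewrite ftrunc_nat // -(ler_pM2l kl0) mulrDr mulrCA divff ?gt_eqF // mulr1.
by rewrite -!natrM -natrD ler_nat ffact_minn_le.
Qed.

Lemma ftrunc_le_ffact k (x : nat) : ftrunc k x <= (x ^_ l)%:R.
Proof. by rewrite ftrunc_nat // ler_nat leq_ffact // geq_minl. Qed.

End FtruncOrder.

Section Moments.
Variables (R : realType) (theta : R) (a : nat -> nat -> int) (p : nat -> R).
Hypothesis theta1 : 1 <= theta.
Hypothesis p_ge0 : forall k, 0 <= p k.
Hypothesis p_sum1 : series p n @[n --> \oo] --> (1 : R).
Hypothesis cvg_law : forall (k : nat) (e : R), 0 < e ->
  exists n0 : nat, forall n, (n0 <= n)%N ->
    `|series p k - Ew theta n (fun t => (hsum (a n) t < k%:Z)%R%:R)| <= e.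
Local Notation E := (Ew theta).

Let theta0 : 0 < theta. Proof. exact: lt_le_trans theta1. Qed.

Lemma Ew_neg_to0 (e : R) : 0 < e -> exists n0 : nat, forall n, (n0 <= n)%N ->
  E n (cyc (fun c => (a n c < 0)%R%:R)) <= e.
Proof.
move=> e0; have et : 0 < e / theta by rewrite divr_gt0.
have [n0 H] := law_negative_weight theta1 p_ge0 p_sum1 cvg_law et.
exists n0 => n /H; rewrite ler_pdivlMr // => He.
rewrite Ew_cyc // (le_trans _ He) // mulr_suml !big_nat; apply: ler_sum => j /andP[_ jn].
rewrite /kmean -ltnS jn mul1r.
rewrite [leRHS](_ : _ = theta / j%:R * psi theta n j * (a n j < 0)%R%:R) //; ring.
Qed.

Lemma Ew_ftrunc l k (e : R) : 0 < e -> exists n0 : nat, forall n, (n0 <= n)%N ->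
  `|\sum_(0 <= i < k) fstep R l i * (1 - series p i.+1) -
    E n (fun t => ftrunc R l k (hsum (a n) t))| <= e.
Proof.
have EE n : E n (fun t => ftrunc R l k (hsum (a n) t)) = \sum_(0 <= i < k) fstep R l i *
    (1 - E n (fun t => (hsum (a n) t < i.+1%:Z)%R%:R)).
  by rewrite Ew_sum; apply: eq_bigr => i _; rewrite EwZ Ew_hsum_gt.
under eq_exists do under eq_forall do rewrite EE.
elim: k e {EE} => [|k IH] e e0.
  by exists 0%N => n _; rewrite !big_geq // subrr normr0 ltW.
have e20 : 0 < e / 2 by rewrite divr_gt0.
have [n0 h0] := IH _ e20.
have d0 : 0 < e / 2 / (fstep R l k + 1) by rewrite divr_gt0 // ltr_wpDl ?fstep_ge0.
have [n1 h1] := cvg_law k.+1 d0.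
exists (maxn n0 n1) => n; rewrite geq_max => /andP[/h0 {}h0 /h1].
rewrite ler_pdivlMr ?ltr_wpDl ?fstep_ge0 // => {}h1.
rewrite !big_nat_recr //= opprD addrACA (le_trans (ler_normD _ _)) //.
rewrite [leRHS](_ : _ = e / 2 + e / 2); last by field.
rewrite lerD // -mulrBr normrM (ger0_norm (fstep_ge0 _ _ _)) (le_trans _ h1) // mulrC.
have -> (x y : R) : 1 - x - (1 - y) = - (x - y) by ring.
by rewrite normrN; apply: ler_pM; rewrite ?normr_ge0 ?fstep_ge0 ?lerDl.
Qed.

Lemma Ew_gt_small (e : R) : 0 < e -> exists m0 : nat, forall m, (m0 <= m)%N ->
  exists n0 : nat, forall n, (n0 <= n)%N ->
    E n (fun t => (m%:Z < hsum (a n) t)%R%:R) <= e.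
Proof.
move=> e0; have e20 : 0 < e / 2 by rewrite divr_gt0.
have [m0 H] := series_tail p_sum1 e20; exists m0 => m mm.
have [n0 h] := cvg_law m.+1 e20; exists n0 => n /h; rewrite Ew_hsum_gt // ler_norml.
by move=> /andP[_]; have := H m.+1 (leqW mm); lra.
Qed.

Variables (alpha : R) (l : nat).
Hypothesis moment : cvgn (series (fun k => p k * powR k%:R alpha)).
Hypothesis l_alpha : l%:R <= alpha.
Hypothesis l0 : (0 < l)%N.

Let bm n m j : (bj a n m j <= m)%N.
Proof. by rewrite /bj; case: (a n j) => // k; rewrite geq_minr. Qed.

Let weight_bj n m (C : R) : \sum_(1 <= j < n.+1) (a n j != 0)%:R / j%:R <= C ->
  \sum_(1 <= j < n.+1) (bj a n m j != 0%N)%:R / j%:R <= C.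
Proof.
apply: le_trans; apply: ler_sum => j _; rewrite ler_wpM2r // ler_nat /bj.
by case: (a n j) => [[|k]|k]; rewrite ?min0n ?leq_b1.
Qed.

(** The truncation level [k] is fixed before [m]. Then [m] has to be large, since [H] may fall below
    [h] when [h > m]; the loss is at most [k_(l)] times a small probability. *)
Lemma Ew_ffact_ge (e : R) : 0 < e -> exists m0 : nat, forall m, (m0 <= m)%N ->
  exists n0 : nat, forall n, (n0 <= n)%N ->
    EfallY p l - e <= E n (fun t => (nsum (bj a n m) t ^_ l)%:R).
Proof.
move=> e0; have e40 : 0 < e / 4 by rewrite divr_gt0.
have [k hk] := sum_fstep_tail_ge l0 p_ge0 p_sum1 moment l_alpha e40.
pose D : R := (k ^_ l)%:R + 1; have D0 : 0 < D by rewrite ltr_wpDl.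
have d0 : 0 < e / 4 / D by rewrite divr_gt0.
have [m0 hm] := Ew_gt_small d0; exists m0 => m /hm[n0 h0].
have [n1 h1] := Ew_neg_to0 d0; have [n2 h2] := Ew_ftrunc l k e40.
exists (maxn n0 (maxn n1 n2)) => n; rewrite !geq_max => /and3P[/h0 {}h0 /h1 {}h1 /h2].
rewrite ler_norml => /andP[_ {}h2].
have up : E n (fun t => ftrunc R l k (hsum (a n) t)) <=
    E n (fun t => (nsum (bj a n m) t ^_ l)%:R) +
    (k ^_ l)%:R * (E n (cyc (fun c => (a n c < 0)%R%:R)) +
                   E n (fun t => (m%:Z < hsum (a n) t)%R%:R)).
  rewrite -EwD -EwZ -EwD; apply: le_Ew => // t _.
  by apply: le_trans (ftrunc_hsum_le _ l0 a n m k t) _; rewrite lerD2r ftrunc_le_ffact.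
have : (k ^_ l)%:R * (E n (cyc (fun c => (a n c < 0)%R%:R)) +
                   E n (fun t => (m%:Z < hsum (a n) t)%R%:R)) <= e / 4 + e / 4.
  apply: (@le_trans _ _ (D * (e / 4 / D + e / 4 / D))).
    apply: ler_pM; rewrite ?lerDl ?ler0n //; last exact: lerD.
    by apply: addr_ge0; apply: Ew_ge0 => // t _; rewrite ?ler0n // sumr_ge0.
  by rewrite mulrDr !(mulrC D) !divfK ?gt_eqF.
move: up h2 hk; lra.
Qed.

(** Here every [m >= 1] will do, because [H <= h] without negative cycles. With [m] fixed, the
    moment of order [l + 1] is bounded in [n], so a high level [k] makes the excess over the
    truncation small. *)
Lemma Ew_ffact_le m (e : R) : (0 < m)%N -> 0 < e -> exists n0 : nat, forall n, (n0 <= n)%N ->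
  E n (fun t => (nsum (bj a n m) t ^_ l)%:R) <= EfallY p l + e.
Proof.
move=> m0 e0; have e40 : 0 < e / 4 by rewrite divr_gt0.
have [C [n0 hC]] := law_nonzero_weight theta1 p_ge0 p_sum1 cvg_law.
have [K hK] := Ew_ffact_bounded theta1 l.+1 C m0.
(* With [k = l + s] the truncation error is at most [K / s]. *)
have [s [s0 hs]] := nat_ge (K / (e / 4)).
have Ks : K / s%:R <= e / 4 by rewrite ler_pdivrMr ?ltr0n // mulrC -ler_pdivrMr.
pose k := (l + s)%N.
have lk : (l < k)%N by rewrite -[X in (X < _)%N]addn0 ltn_add2l.
pose D : R := (k ^_ l)%:R + 1; have D0 : 0 < D by rewrite ltr_wpDl.
have d0 : 0 < e / 4 / D by rewrite divr_gt0.
have [n1 h1] := Ew_neg_to0 d0; have [n2 h2] := Ew_ftrunc l k e40.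
exists (maxn n0 (maxn n1 n2)) => n; rewrite !geq_max => /and3P[/hC {}hC /h1 {}h1 /h2].
rewrite ler_norml => /andP[{}h2 _].
have {}hK := hK n (bj a n m) (bm n m) (weight_bj m hC).
have up : E n (fun t => (nsum (bj a n m) t ^_ l)%:R) <=
    E n (fun t => ftrunc R l k (hsum (a n) t)) +
    (k ^_ l)%:R * E n (cyc (fun c => (a n c < 0)%R%:R)) +
    s%:R^-1 * E n (fun t => (nsum (bj a n m) t ^_ l.+1)%:R).
  rewrite -!EwZ -!EwD; apply: le_Ew => // t _.
  apply: le_trans (ffact_nsum_le _ l0 a n m t lk) _.
  by rewrite addKn mulrC lerD2r ftrunc_nsum_le.
have : (k ^_ l)%:R * E n (cyc (fun c => (a n c < 0)%R%:R)) <= e / 4.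
  apply: (@le_trans _ _ (D * (e / 4 / D))); last by rewrite mulrC divfK ?gt_eqF.
  apply: ler_pM; rewrite ?lerDl ?ler0n //.
  by apply: Ew_ge0 => // t _; rewrite sumr_ge0.
have : s%:R^-1 * E n (fun t => (nsum (bj a n m) t ^_ l.+1)%:R) <= e / 4.
  by apply: le_trans Ks; rewrite mulrC ler_wpM2r.
have := sum_fstep_tail_le l0 p_ge0 p_sum1 moment l_alpha k.
move: up h2; lra.
Qed.

Lemma Upsilon_EfallY (e : R) : 0 < e -> exists m0 : nat, forall m, (m0 <= m)%N ->
  exists n0 : nat, forall n, (n0 <= n)%N -> `|Upsilon theta a n l m - EfallY p l| <= e.
Proof.
move=> e0; have e20 : 0 < e / 2 by rewrite divr_gt0.
have [C [n0 hC]] := law_nonzero_weight theta1 p_ge0 p_sum1 cvg_law.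
have [m0 hm] := Ew_ffact_ge e20; exists (maxn m0 1) => m; rewrite geq_max => /andP[/hm[n1 h1] m1].
have [n2 h2] := Ew_ffact_le m1 e20; have [n3 h3] := moment_kernel_close theta1 l C m1 e20.
exists (maxn (maxn n0 n1) (maxn n2 n3)) => n.
rewrite !geq_max => /andP[/andP[/hC {}hC /h1 {}h1] /andP[/h2 {}h2 n3n]].
have := h3 n (bj a n m) n3n (bm n m) (weight_bj m hC).
rewrite -Upsilon_kernel_sum //.
rewrite !ler_norml => /andP[? ?]; apply/andP; split; lra.
Qed.

End Moments.

(** The threshold for [n] may depend on [m], which the inner upper limit absorbs; finiteness of the
    upper limits holds only for large [m] and is part of the conclusion. *)
Lemma limn_esup_cvg0 (R : realType) (u : nat -> nat -> R) :
  (forall m n, 0 <= u m n) ->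
  (forall e : R, 0 < e -> exists m0 : nat, forall m, (m0 <= m)%N ->
     exists n0 : nat, forall n, (n0 <= n)%N -> u m n <= e) ->
  limn_esup (fun n => (u m n)%:E) @[m --> \oo] --> 0%E.
Proof.
move=> u0 ule; have sup_le (e : R) m n0 : (forall n, (n0 <= n)%N -> u m n <= e) ->
    (limn_esup (fun n => (u m n)%:E) <= e%:E)%E.
  move=> um; rewrite limn_esup_lim; apply: lime_le; first exact: is_cvg_esups.
  exists n0 => // n /= n0n; apply: ge_ereal_sup => _ [k /= nk <-].
  by rewrite lee_fin um // (leq_trans n0n).
have sup_ge m : (0 <= limn_esup (fun n => (u m n)%:E))%E.
  rewrite limn_esup_lim; apply: lime_ge; first exact: is_cvg_esups.
  apply: nearW => n; apply: ereal_sup_ge; exists (u m n)%:E; last by rewrite lee_fin.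
  by exists n => /=.
have fin m e : (limn_esup (fun n => (u m n)%:E) <= e%:E)%E ->
    limn_esup (fun n => (u m n)%:E) \is a fin_num.
  by move=> le; rewrite ge0_fin_numE // (le_lt_trans le) ?ltry.
apply/fine_cvgP; split.
  have [m0 hm] := ule 1 ltr01; exists m0 => // m /hm[n0 /sup_le]; exact: fin.
apply/cvgrPdist_le => e e0; have [m0 hm] := ule e e0.
exists m0 => // m /hm[n0 /sup_le le]; rewrite /= sub0r normrN ger0_norm ?fine_ge0 //.
by rewrite -lee_fin fineK // (fin _ _ le).
Qed.

Theorem theorem1 (R : realType) (theta : R) (a : nat -> nat -> int)
    (p : nat -> R) (alpha eps : R) :
  1 <= theta ->
  (forall k, 0 <= p k) ->
  series p n @[n --> \oo] --> (1 : R) ->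
  0 < eps -> 2 + eps <= alpha ->
  cvgn (series (fun k => p k * powR k%:R alpha)) ->
  (forall x : R, {for x, continuous (FY p)} ->
     Tn theta a n x @[n --> \oo] --> FY p x) ->
  (\sum_(1 <= j < n) (if a n j <= -1 then 1 else 0) / j%:R *
       powR (1 - j%:R / n%:R) (theta - 1)) @[n --> \oo] --> 0
  /\
  (forall l : nat, (1 <= l)%N -> l%:R <= alpha - 1 - eps ->
     limn_esup (fun n => (`|Upsilon theta a n l m - EfallY p l|)%:E)
       @[m --> \oo] --> 0%E).
Proof.
move=> theta1 p_ge0 p_sum1 eps0 alpha_ge moment weak.
have cvg_law := Ew_hsum_lt (lt_le_trans ltr01 theta1) weak.
split; first exact: negative_weight_cvg0 p_sum1 cvg_law.
move=> l l0 l_le; apply: limn_esup_cvg0 => // e e0.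
apply: (Upsilon_EfallY theta1 p_ge0 p_sum1 cvg_law moment) => //.
by apply: le_trans l_le _; lra.
Qed.
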